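(* Suppose that Assumption A (stated in the context) holds, and let $$C_1 := 3\left((L_{\ell,\theta}^{\mathrm{Lip}})^2 I_{\max} + (L_{\beta,\theta}^{\mathrm{Lip}} L_{G,\beta}^{\mathrm{Lip}})^2\right)\sigma_{\max}^2,\qquad C_2 := 3 M_\ell I_{\max}\left(\frac{(L_{\beta,\theta}^{\mathrm{H}})^2}{12}+\frac{3\sigma_{\max}^2}{2}\right),$$ $$L_{\mathcal L}^{\mathrm{sm}} := L_{\ell,\theta}^{\mathrm{sm}} + L_{\ell,\theta}^{\mathrm{Lip}} L_{\beta,\theta}^{\mathrm{Lip}}\sqrt{I_{\max}} + L_{\beta,\theta}^{\mathrm{sm}}\sqrt{M_\ell I_{\max}} + L_{\beta,\theta}^{\mathrm{Lip}}\left(L_{G,\beta}^{\mathrm{Lip}} L_{\beta,\theta}^{\mathrm{Lip}} + L_{G,\theta}^{\mathrm{Lip}}\right),$$ with the constants defined in the context. Consider the algorithm DSA-PGM (described in the context) initialized at $\theta_0\in\Theta_\delta$ with stepsize $0<\alpha\le 1/L_{\mathcal L}^{\mathrm{sm}}$. For any $\epsilon>0$, choose $T$ and $b$ as the smallest positive integers satisfying $$T\ge \frac{6(\mathcal L(\theta_0)-\mathcal L_* )}{\alpha\epsilon^2},\qquad b\ge \max\left(b_{\min},\ \frac{3C_1}{\epsilon^2},\ \frac{(3nC_2)^{1.5}}{\epsilon^3}\right),$$ and set the perturbation radius $\delta=b^{-1/6}$. Then $$\frac1T\sum_{t=0}^{T-1}\mathbb E\left[\|\mathcal G_\alpha(\theta_t)\|^2\right]\le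 \epsilon^2,$$ and the total number of samples used by the algorithm over $T$ iterations is $T\cdot(2n+1)\,b=O(n^{2.5}\epsilon^{-5})$.
   Context: Setting. $n,m,d$ are positive integers; $\|\cdot\|$ is the Euclidean norm for vectors and the induced (operator) norm for matrices and for derivative tensors. $\Theta\subseteq\mathbb R^n$ is the model parameter set, $\beta:\mathbb R^n\to\mathbb R^m$ the distribution parameter mapping with $m\times n$ Jacobian $\frac{\partial\beta}{\partial\theta}$, $B\subseteq\mathbb R^m$ the distribution parameter space, and $\ell:\mathbb R^d\times\mathbb R^n\to\mathbb R$, $(z,\theta)\mapsto\ell(z;\theta)$, the loss. $\{\mathcal D_{\beta_0}\}_{\beta_0\in B}$ is a family of probability distributions on a data space $\mathcal Z\subseteq\mathbb R^d$, dominated by a common $\sigma$-finite measure $\mu$, with densities $p(\cdot;\beta_0)$. $\mathrm{Pred}$ is an estimator mapping a finite dataset to an element of $B$. For $\delta>0$, with $e_i$ the standard basis vectors of $\mathbb R^n$, $$\Theta_\delta:=\{\theta\in\Theta:\theta\pm\delta e_i\in\Theta,\ i=1,\dots,n\}.$$ Define the score $s(z;\beta_0):=\nabla_\beta\ln p(z;\beta_0)$, $G(\theta;\beta_0):=\mathbb E_{z\sim\mathcal D_{\beta_0}}[\ell(z;\theta)s(z;\beta_0)]\in\mathbb R^m$, the Fisher information $I(\beta_0):=\mathbb E_{z\sim\mathcal D_{\beta_0}}[s(z;\beta_0)s(z;\beta_0)^\top]$, and the performative loss $\mathcal L(\theta):=\mathbb E_{z\sim\mathcal D_{\beta(\theta)}}[\ell(z;\theta)]$.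 Its gradient is $\nabla\mathcal L(\theta)=\nabla_1\mathcal L(\theta)+\nabla_2\mathcal L(\theta)$ with $\nabla_1\mathcal L(\theta)=\mathbb E_{z\sim\mathcal D_{\beta(\theta)}}[\nabla_\theta\ell(z;\theta)]$ and $\nabla_2\mathcal L(\theta)=\frac{\partial\beta}{\partial\theta}(\theta)^\top G(\theta;\beta(\theta))$. Assumption A. (1) $\Theta$ and $\Theta_\delta$ (for the perturbation radius $\delta$ used) are nonempty, closed, convex and compact. (2) $B$ is convex and compact, and $\beta(\Theta)\subseteq B$. (3) $\beta$ is $C^3$. (4) The densities $\{p(\cdot;\beta_0)\}_{\beta_0\in B}$ have common support, $p(z;\cdot)$ is $C^2$ on $B$, and differentiation under the integral sign with respect to $\beta_0$ is valid (for the integrals $\int p\,d\mu$, $\int\ell\,p\,d\mu$, $\int\ell\,s\,p\,d\mu$). (5) There are finite constants $K_1,K_2\ge0$ and integers $q_1,q_2\ge0$ with $\|s(z;\beta_0)\|\le K_1(1+\|z\|^{q_1})$ and $\|\frac{\partial}{\partial\beta}s(z;\beta_0)\|\le K_2(1+\|z\|^{q_2})$ for all $z$ and $\beta_0\in B$. (6) $\ell$ is $C^2$, and there are finite constants $K_3,K_4,K_5\ge0$ and integers $q_3,q_4,q_5\ge0$ with $|\ell(z;\theta)|\le K_3(1+\|z\|^{q_3})$, $\|\nabla_\theta\ell(z;\theta)\|\le K_4(1+\|z\|^{q_4})$, $\|\nabla_\theta^2\ell(z;\theta)\|\le K_5(1+\|z\|^{q_5})$ for all $z$ and $\theta\in\Theta$.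 (7) With $q_{\max}:=\max\{2q_1+q_3,\ q_2+q_3,\ 2q_3,\ 2q_4,\ q_1+q_4,\ q_5\}$, there are constants $M_k<\infty$ with $\sup_{\beta_0\in B}\mathbb E_{z\sim\mathcal D_{\beta_0}}[\|z\|^k]\le M_k$ for $0\le k\le q_{\max}$. (8) There are $\sigma_{\max}\ge0$ and $b_{\min}\in\mathbb N$ such that for every $\theta\in\Theta$ and $b\ge b_{\min}$, the estimator $\hat\beta=\mathrm{Pred}(\{z_i\}_{i=1}^b)\in B$ built from i.i.d. samples $z_i\sim\mathcal D_{\beta(\theta)}$ satisfies $\mathbb E[\|\hat\beta-\beta(\theta)\|^2]\le\sigma_{\max}^2/b$. Constants. $\mathcal L_*:=\inf_{\theta\in\Theta}\mathcal L(\theta)>-\infty$, and $L_{\ell,\theta}^{\mathrm{Lip}},L_{\ell,\theta}^{\mathrm{sm}},L_{\beta,\theta}^{\mathrm{Lip}},L_{\beta,\theta}^{\mathrm{sm}},L_{\beta,\theta}^{\mathrm H},L_{G,\beta}^{\mathrm{Lip}},L_{G,\theta}^{\mathrm{Lip}},M_\ell,I_{\max}\ge0$ are finite constants such that for all $\theta,\theta'\in\Theta$ and $\beta_0,\beta_0'\in B$: $\sup_{\beta_1\in B}\mathbb E_{z\sim\mathcal D_{\beta_1}}[\|\nabla_\theta\ell(z;\theta)\|^2]^{1/2}\le L_{\ell,\theta}^{\mathrm{Lip}}$; $\mathbb E_{z\sim\mathcal D_{\beta(\theta)}}[\|\nabla_\theta\ell(z;\theta)-\nabla_\theta\ell(z;\theta')\|]\le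 L_{\ell,\theta}^{\mathrm{sm}}\|\theta-\theta'\|$; $\|\beta(\theta)-\beta(\theta')\|\le L_{\beta,\theta}^{\mathrm{Lip}}\|\theta-\theta'\|$; $\|\frac{\partial\beta}{\partial\theta}(\theta)-\frac{\partial\beta}{\partial\theta}(\theta')\|\le L_{\beta,\theta}^{\mathrm{sm}}\|\theta-\theta'\|$; $\|\frac{\partial^2\beta}{\partial\theta^2}(\theta)-\frac{\partial^2\beta}{\partial\theta^2}(\theta')\|\le L_{\beta,\theta}^{\mathrm H}\|\theta-\theta'\|$; $\|G(\theta;\beta_0)-G(\theta';\beta_0')\|\le L_{G,\beta}^{\mathrm{Lip}}\|\beta_0-\beta_0'\|+L_{G,\theta}^{\mathrm{Lip}}\|\theta-\theta'\|$; $\mathrm{Var}_{z\sim\mathcal D_{\beta_0}}[\ell(z;\theta)]\le M_\ell$; $\mathrm{Tr}(I(\beta_0))\le I_{\max}$. Algorithm DSA-PGM. Inputs: $\theta_0\in\Theta_\delta$, batch size $b\in\mathbb N$, perturbation radius $\delta>0$, stepsize $\alpha>0$. At each iteration $t=0,1,2,\dots$, given $\theta_t$ (fresh samples are drawn conditionally on the past): draw i.i.d. samples $\{z_{t,j}\}_{j=1}^b\sim\mathcal D_{\beta(\theta_t)}$ and, for $i=1,\dots,n$, i.i.d. samples $\{z_{t,i,j}^{\pm}\}_{j=1}^b\sim\mathcal D_{\beta(\theta_t\pm\delta e_i)}$; set $\hat\beta_t=\mathrm{Pred}(\{z_{t,j}\}_j)$, $\hat\beta_{t,i}^\pm=\mathrm{Pred}(\{z_{t,i,j}^\pm\}_j)$;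 let $\widehat{\frac{\partial\beta}{\partial\theta}}(\theta_t)$ be the $m\times n$ matrix with $i$-th column $\frac{\hat\beta_{t,i}^+-\hat\beta_{t,i}^-}{2\delta}$; set $\widehat{\nabla_1\mathcal L}(\theta_t)=\mathbb E_{z\sim\mathcal D_{\hat\beta_t}}[\nabla_\theta\ell(z;\theta_t)]$, $\widehat{\nabla_2\mathcal L}(\theta_t)=\widehat{\frac{\partial\beta}{\partial\theta}}(\theta_t)^\top G(\theta_t;\hat\beta_t)$ (expectations over $\mathcal D_{\hat\beta_t}$ computed exactly), $\widehat{\nabla\mathcal L}(\theta_t)=\widehat{\nabla_1\mathcal L}(\theta_t)+\widehat{\nabla_2\mathcal L}(\theta_t)$; update $\theta_{t+1}=\mathrm{Proj}(\theta_t-\alpha\widehat{\nabla\mathcal L}(\theta_t))$, where $\mathrm{Proj}$ is Euclidean projection onto $\Theta_\delta$. Each iteration uses $(2n+1)b$ samples. Gradient mapping: $\mathcal G_\alpha(\theta):=\frac1\alpha\left(\theta-\mathrm{Proj}(\theta-\alpha\nabla\mathcal L(\theta))\right)$. In the $O(\cdot)$ bound, $\epsilon$ is bounded above (e.g. $0<\epsilon\le1$) and the quantities $\alpha$, $\mathcal L(\theta_0)-\mathcal L_*$, $b_{\min}$, $C_1$, $C_2$ are treated as constants independent of $n$ and $\epsilon$. *)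

(* Defs.v *)
From HB Require Import structures.
From mathcomp Require Import all_boot all_order all_algebra.
From mathcomp Require Import all_classical all_reals all_analysis.

Set Implicit Arguments.
Unset Strict Implicit.
Unset Printing Implicit Defensive.

Import Order.TTheory GRing.Theory Num.Theory.
Import numFieldNormedType.Exports.

Local Open Scope classical_set_scope.
Local Open Scope ring_scope.

(* Vectors are row vectors.  The library norm [`|x|] on matrices is the max
   norm, so the Euclidean norm and the operator norms it induces are defined
   here; topology and differentiability do not depend on the choice. *)

Definition dot (R : realType) (k : nat) (u v : 'rV[R]_k) : R :=
  \sum_(i < k) u 0 i * v 0 i.

Definition enorm (R : realType) (k : nat) (u : 'rV[R]_k) : R :=
  Num.sqrt (\sum_(i < k) u 0 i ^+ 2).

Definition ev (R : realType) (k : nat) (i : 'I_k) : 'rV[R]_k := delta_mx 0 i.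

(* [x *m A^T] is the row form of the column [A x]. *)
Definition opnorm (R : realType) (p q : nat) (A : 'M[R]_(p, q)) : R :=
  sup [set enorm (x *m A^T) | x in [set x : 'rV[R]_q | enorm x <= 1]].

Definition opnorm2 (R : realType) (p q : nat)
    (T : 'rV[R]_p -> 'rV[R]_p -> 'rV[R]_q) : R :=
  sup [set enorm (T uv.1 uv.2) |
       uv in [set uv : 'rV[R]_p * 'rV[R]_p | enorm uv.1 <= 1 /\ enorm uv.2 <= 1]].

Definition grad (R : realType) (k : nat) (f : 'rV[R]_k -> R) (x : 'rV[R]_k)
    : 'rV[R]_k :=
  \row_i 'D_(ev R i) f x.

Definition hessian (R : realType) (k : nat) (f : 'rV[R]_k -> R) (x : 'rV[R]_k)
    : 'M[R]_k :=
  \matrix_(i, j) 'D_(ev R j) ('D_(ev R i) f) x.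

(* The library Jacobian ['J f x] acts on rows ([v *m 'J f x = 'd f x v]); its
   transpose is the usual matrix of partial derivatives, one row per output. *)
Definition jac (R : realType) (p q : nat) (f : 'rV[R]_p -> 'rV[R]_q)
    (x : 'rV[R]_p) : 'M[R]_(q, p) :=
  ('J f x)^T.

Definition D2 (R : realType) (p q : nat) (f : 'rV[R]_p -> 'rV[R]_q)
    (x u v : 'rV[R]_p) : 'rV[R]_q :=
  'D_v ('D_u f) x.

(* [f] is C^k on the open set [U]; [V] is meant to be finite dimensional, so
   that continuity of all directional derivatives is continuity of the
   differential. *)
Fixpoint Ck (R : realType) (V W : normedModType R) (k : nat) (U : set V)
    (f : V -> W) : Prop :=
  match k with
  | 0 => forall x, U x -> {for x, continuous f}
  | k'.+1 => (forall x, U x -> differentiable f x) /\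
             (forall v, Ck k' U ('D_v f))
  end.

Definition Ck_on (R : realType) (V W : normedModType R) (k : nat) (A : set V)
    (f : V -> W) : Prop :=
  exists U : set V, [/\ open U, A `<=` U & Ck k U f].

(* First-order expansion relative to [A]: this makes sense at boundary points
   of [A] and does not involve values of [F] outside [A]. *)
Definition has_grad_within (R : realType) (k : nat) (A : set 'rV[R]_k)
    (F : 'rV[R]_k -> R) (x g : 'rV[R]_k) : Prop :=
  forall e : R, 0 < e ->
    \forall y \near within A (nbhs x),
      `|F y - F x - dot g (y - x)| <= e * enorm (y - x).

Definition is_eproj (R : realType) (k : nat) (C : set 'rV[R]_k)
    (x y : 'rV[R]_k) : Prop :=
  C y /\ forall y', C y' -> enorm (x - y) <= enorm (x - y').

Definition eproj (R : realType) (k : nat) (C : set 'rV[R]_k) (x : 'rV[R]_k)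
    : 'rV[R]_k :=
  get (is_eproj C x).

(* R^k with its Borel sigma-algebra. *)
Notation borel R k := (g_sigma_algebraType (@open 'rV[R]_k)).

(* [Q] is the law of [b] independent draws from [P]. *)
Definition iid_law (R : realType) (dT : measure_display) (T : measurableType dT)
    (b : nat) (P : probability T R) (Q : probability (b.-tuple T) R) : Prop :=
  forall S : 'I_b -> set T, (forall j, measurable (S j)) ->
    Q [set x | forall j, S j (tnth x j)] = (\prod_(j < b) fine (P (S j)))%:E.

Definition diff_under_integral (R : realType) (d m : nat)
    (mu : {measure set borel R d -> \bar R}) (Z : set (borel R d))
    (B : set 'rV[R]_m) (f : 'rV[R]_d -> 'rV[R]_m -> R) : Prop :=
  forall b0, B b0 ->
    [/\ mu.-integrable Z (fun z => (f z b0)%:E),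
        forall j, mu.-integrable Z (fun z => ('D_(ev R j) (f z) b0)%:E) &
        has_grad_within B (fun b1 => \int[mu]_(z in Z) f z b1) b0
          (\row_j \int[mu]_(z in Z) 'D_(ev R j) (f z) b0)].

(* Objects indexed by [B] ([dist], [dens]) or defined on [Z] are carried by
   total functions; only their values for indices in [B] and points of [Z] are
   constrained by the assumptions. *)
Record problem (R : realType) (n m d : nat) := Problem {
  Theta : set 'rV[R]_n;
  B : set 'rV[R]_m;
  Z : set (borel R d);
  beta : 'rV[R]_n -> 'rV[R]_m;
  loss : 'rV[R]_d -> 'rV[R]_n -> R;
  mu : {sigma_finite_measure set borel R d -> \bar R};
  dist : 'rV[R]_m -> probability (borel R d) R;
  dens : 'rV[R]_d -> 'rV[R]_m -> R;
  Pred : forall b : nat, b.-tuple (borel R d) -> borel R m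
}.

Record constants (R : realType) := Constants {
  L_loss_Lip : R;
  L_loss_sm : R;
  L_beta_Lip : R;
  L_beta_sm : R;
  L_beta_H : R;
  L_G_beta : R;
  L_G_theta : R;
  M_loss : R;
  I_max : R;
  sigma_max : R;
  b_min : nat
}.

Section Model.
Context (R : realType) (n m d : nat) (pb : problem R n m d).

Definition Theta_delta (delta : R) : set 'rV[R]_n :=
  [set theta | Theta pb theta /\
     forall i : 'I_n, Theta pb (theta + delta *: ev R i) /\
                      Theta pb (theta - delta *: ev R i)].

Definition expect (b0 : 'rV[R]_m) (f : 'rV[R]_d -> R) : R :=
  \int[dist pb b0]_(z in Z pb) f z.

(* Off the support, where [ln p] is undefined, the score is 0. *)
Definition score (z : 'rV[R]_d) (b0 : 'rV[R]_m) : 'rV[R]_m :=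
  if 0 < dens pb z b0 then grad (fun b1 => ln (dens pb z b1)) b0 else 0.

Definition grad_loss (z : 'rV[R]_d) (theta : 'rV[R]_n) : 'rV[R]_n :=
  grad (loss pb z) theta.

Definition G (theta : 'rV[R]_n) (b0 : 'rV[R]_m) : 'rV[R]_m :=
  \row_k expect b0 (fun z => loss pb z theta * score z b0 0 k).

Definition fisher (b0 : 'rV[R]_m) : 'M[R]_m :=
  \matrix_(k, l) expect b0 (fun z => score z b0 0 k * score z b0 0 l).

Definition perf_loss (theta : 'rV[R]_n) : R :=
  expect (beta pb theta) (fun z => loss pb z theta).

Definition perf_loss_inf : R := inf [set perf_loss theta | theta in Theta pb].

Definition expect_grad_loss (theta : 'rV[R]_n) (b0 : 'rV[R]_m) : 'rV[R]_n :=
  \row_i expect b0 (fun z => grad_loss z theta 0 i).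

Definition grad1 (theta : 'rV[R]_n) : 'rV[R]_n :=
  expect_grad_loss theta (beta pb theta).

(* The row form of [J^T g] is [g *m J]. *)
Definition grad2 (theta : 'rV[R]_n) : 'rV[R]_n :=
  G theta (beta pb theta) *m jac (beta pb) theta.

Definition grad_perf (theta : 'rV[R]_n) : 'rV[R]_n := grad1 theta + grad2 theta.

Definition grad_map (delta alpha : R) (theta : 'rV[R]_n) : 'rV[R]_n :=
  alpha^-1 *:
    (theta - eproj (Theta_delta delta) (theta - alpha *: grad_perf theta)).

Definition polynomial_bounds : Prop :=
  exists (q1 q2 q3 q4 q5 : nat) (K1 K2 K3 K4 K5 : R) (M : nat -> R),
    [/\ [/\ 0 <= K1, 0 <= K2, 0 <= K3, 0 <= K4 & 0 <= K5],
        forall z b0, Z pb z -> B pb b0 -> 0 < dens pb z b0 ->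
          enorm (score z b0) <= K1 * (1 + enorm z ^+ q1) /\
          opnorm (jac (score z) b0) <= K2 * (1 + enorm z ^+ q2),
        forall z theta, Z pb z -> Theta pb theta ->
          [/\ `|loss pb z theta| <= K3 * (1 + enorm z ^+ q3),
              enorm (grad_loss z theta) <= K4 * (1 + enorm z ^+ q4) &
              opnorm (hessian (loss pb z) theta) <= K5 * (1 + enorm z ^+ q5)] &
        let q_max := \max_(q <- [:: (2 * q1 + q3)%N; (q2 + q3)%N; (2 * q3)%N;
                                    (2 * q4)%N; (q1 + q4)%N; q5]) q in
        forall (b0 : 'rV[R]_m) (k : nat), B pb b0 -> (k <= q_max)%N ->
          (\int[dist pb b0]_(z in Z pb) (enorm z ^+ k)%:E <= (M k)%:E)%E].

(* The estimator is only constrained on nonempty datasets: at [b = 0] the error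
   bound would degenerate, as [x / 0 = 0]. *)
Record assumptionA (delta sigma : R) (bmin : nat) : Prop := AssumptionA {
  A_Theta : [/\ Theta pb !=set0, closed (Theta pb),
                convex_set (Theta pb) & compact (Theta pb)];
  A_Theta_delta : [/\ Theta_delta delta !=set0, closed (Theta_delta delta),
                      convex_set (Theta_delta delta) &
                      compact (Theta_delta delta)];
  A_B : [/\ convex_set (B pb), compact (B pb) &
            forall theta, Theta pb theta -> B pb (beta pb theta)];
  A_beta : Ck 3 setT (beta pb);
  A_Z : measurable (Z pb);
  A_dens : forall b0, B pb b0 ->
    [/\ measurable_fun (Z pb) (fun z : borel R d => dens pb z b0),
        forall z, Z pb z -> 0 <= dens pb z b0 &
        forall S, measurable S ->
          dist pb b0 S = (\int[mu pb]_(z in S `&` Z pb) (dens pb z b0)%:E)%E];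
  A_support : forall z b0 b1, Z pb z -> B pb b0 -> B pb b1 ->
    0 < dens pb z b0 -> 0 < dens pb z b1;
  A_dens_C2 : forall z, Z pb z -> Ck_on 2 (B pb) (dens pb z);
  A_diff_p : diff_under_integral (mu pb) (Z pb) (B pb) (dens pb);
  A_diff_lp : forall theta, Theta pb theta ->
    diff_under_integral (mu pb) (Z pb) (B pb)
      (fun z b0 => loss pb z theta * dens pb z b0);
  A_diff_lsp : forall theta k, Theta pb theta ->
    diff_under_integral (mu pb) (Z pb) (B pb)
      (fun z b0 => loss pb z theta * score z b0 0 k * dens pb z b0);
  A_loss_C2 : Ck 2 setT (fun zt : 'rV[R]_d * 'rV[R]_n => loss pb zt.1 zt.2);
  A_bounds : polynomial_bounds;
  A_sigma : 0 <= sigma;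
  A_Pred_measurable : forall b, (0 < b)%N -> measurable_fun setT (@Pred _ _ _ _ pb b);
  A_Pred_B : forall b (x : b.-tuple (borel R d)), (0 < b)%N ->
    (forall j, Z pb (tnth x j)) -> B pb (Pred pb x);
  A_Pred_error : forall theta b (Q : probability (b.-tuple (borel R d)) R),
    Theta pb theta -> (0 < b)%N -> (bmin <= b)%N ->
    iid_law (dist pb (beta pb theta)) Q ->
    (\int[Q]_x (enorm (Pred pb x - beta pb theta) ^+ 2)%:E
       <= (sigma ^+ 2 / b%:R)%:E)%E
}.

Record valid_constants (c : constants R) : Prop := ValidConstants {
  c_ge0 : [/\ 0 <= L_loss_Lip c, 0 <= L_loss_sm c, 0 <= L_beta_Lip c,
              0 <= L_beta_sm c & 0 <= L_beta_H c] /\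
          [/\ 0 <= L_G_beta c, 0 <= L_G_theta c, 0 <= M_loss c & 0 <= I_max c];
  c_inf : has_lbound [set perf_loss theta | theta in Theta pb];
  c_loss_Lip : forall theta b1, Theta pb theta -> B pb b1 ->
    Num.sqrt (expect b1 (fun z => enorm (grad_loss z theta) ^+ 2))
      <= L_loss_Lip c;
  c_loss_sm : forall theta theta', Theta pb theta -> Theta pb theta' ->
    expect (beta pb theta)
        (fun z => enorm (grad_loss z theta - grad_loss z theta'))
      <= L_loss_sm c * enorm (theta - theta');
  c_beta_Lip : forall theta theta', Theta pb theta -> Theta pb theta' ->
    enorm (beta pb theta - beta pb theta')
      <= L_beta_Lip c * enorm (theta - theta');
  c_beta_sm : forall theta theta', Theta pb theta -> Theta pb theta' ->
    opnorm (jac (beta pb) theta - jac (beta pb) theta')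
      <= L_beta_sm c * enorm (theta - theta');
  c_beta_H : forall theta theta', Theta pb theta -> Theta pb theta' ->
    opnorm2 (fun u v => D2 (beta pb) theta u v - D2 (beta pb) theta' u v)
      <= L_beta_H c * enorm (theta - theta');
  c_G : forall theta theta' b0 b0', Theta pb theta -> Theta pb theta' ->
    B pb b0 -> B pb b0' ->
    enorm (G theta b0 - G theta' b0')
      <= L_G_beta c * enorm (b0 - b0') + L_G_theta c * enorm (theta - theta');
  c_var : forall theta b0, Theta pb theta -> B pb b0 ->
    (variance (dist pb b0) (fun z : borel R d => loss pb z theta)
       <= (M_loss c)%:E)%E;
  c_fisher : forall b0, B pb b0 -> \tr (fisher b0) <= I_max c
}.

(* The 2n+1 batches of one iteration: [None] is drawn at theta_t and
   [Some (i, s)] at theta_t + delta e_i ([s = true]) or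
   theta_t - delta e_i ([s = false]). *)
Definition batch : finType := option ('I_n * bool).

Definition query (delta : R) (theta : 'rV[R]_n) (c : batch) : 'rV[R]_n :=
  match c with
  | None => theta
  | Some (i, true) => theta + delta *: ev R i
  | Some (i, false) => theta - delta *: ev R i
  end.

Definition jac_hat (delta : R) (bhat : batch -> 'rV[R]_m) : 'M[R]_(m, n) :=
  \matrix_(k, i)
    ((bhat (Some (i, true)) - bhat (Some (i, false))) 0 k / (2 * delta)).

Definition grad_hat (delta : R) (theta : 'rV[R]_n) (bhat : batch -> 'rV[R]_m)
    : 'rV[R]_n :=
  expect_grad_loss theta (bhat None) + G theta (bhat None) *m jac_hat delta bhat.

Definition batch_estimates (b : nat) (s : batch -> 'I_b -> borel R d)
    : batch -> 'rV[R]_m :=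
  fun c => Pred pb [tuple s c j | j < b].

Definition dsa_step (b : nat) (delta alpha : R) (theta : 'rV[R]_n)
    (s : batch -> 'I_b -> borel R d) : 'rV[R]_n :=
  eproj (Theta_delta delta)
    (theta - alpha *: grad_hat delta theta (batch_estimates s)).

(* The sigma-algebra generated by the iterates up to time [t] and the samples
   drawn strictly before time [t]. *)
Definition past (Omega : Type) (b : nat) (theta : nat -> Omega -> borel R n)
    (zs : nat -> batch -> 'I_b -> Omega -> borel R d) (t : nat)
    : set (set Omega) :=
  <<s [set A | (exists2 s, (s <= t)%N &
                  exists2 S, measurable S & A = theta s @^-1` S) \/
               (exists2 s, (s < t)%N & exists c j,
                  exists2 S, measurable S & A = zs s c j @^-1` S)] >>.

(* [run_fresh]: conditionally on the past, the samples of iteration [t] are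
   independent and those of batch [c] have law [dist (beta (query theta_t c))]. *)
Record dsa_run (dO : measure_display) (Omega : measurableType dO)
    (P : probability Omega R) (theta0 : 'rV[R]_n) (b : nat) (delta alpha : R)
    (theta : nat -> Omega -> borel R n)
    (zs : nat -> batch -> 'I_b -> Omega -> borel R d) : Prop := DsaRun {
  run_theta_measurable : forall t, measurable_fun setT (theta t);
  run_zs_measurable : forall t c j, measurable_fun setT (zs t c j);
  run_zs_Z : forall t c j w, Z pb (zs t c j w);
  run_init : forall w, theta 0%N w = theta0;
  run_step : forall t w,
    theta t.+1 w = dsa_step delta alpha (theta t w) (fun c j => zs t c j w);
  run_fresh : forall t (A : set Omega) (S : batch -> 'I_b -> set (borel R d)),
    past theta zs t A -> (forall c j, measurable (S c j)) ->
    P (A `&` [set w | forall c j, S c j (zs t c j w)]) =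
    (\int[P]_(w in A)
       (\prod_(c : batch) \prod_(j < b)
          fine (dist pb (beta pb (query delta (theta t w) c)) (S c j)))%:E)%E
}.

End Model.

Definition C1 (R : realType) (c : constants R) : R :=
  3 * (L_loss_Lip c ^+ 2 * I_max c + (L_beta_Lip c * L_G_beta c) ^+ 2)
    * sigma_max c ^+ 2.

Definition C2 (R : realType) (c : constants R) : R :=
  3 * M_loss c * I_max c * (L_beta_H c ^+ 2 / 12 + 3 * sigma_max c ^+ 2 / 2).

Definition L_perf_sm (R : realType) (c : constants R) : R :=
  L_loss_sm c + L_loss_Lip c * L_beta_Lip c * Num.sqrt (I_max c)
  + L_beta_sm c * Num.sqrt (M_loss c * I_max c)
  + L_beta_Lip c * (L_G_beta c * L_beta_Lip c + L_G_theta c).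

Definition least_pos (Q : nat -> Prop) (k : nat) : Prop :=
  [/\ (0 < k)%N, Q k & forall k', (0 < k')%N -> Q k' -> (k <= k')%N].

(* One index per sample drawn during the first [T] iterations. *)
Definition sample_index (n b T : nat) : finType :=
  ('I_T * batch n * 'I_b)%type.

(* Main.v *)
Require Import Defs.
From HB Require Import structures.
From mathcomp Require Import all_boot all_order all_algebra.
From mathcomp Require Import all_classical all_reals all_analysis.
From mathcomp Require Import measurable_realfun.
From mathcomp Require Import ring lra.
Import Order.TTheory GRing.Theory Num.Theory.
Import numFieldNormedType.Exports.
Local Open Scope classical_set_scope.
Local Open Scope ring_scope.

Set Implicit Arguments.
Unset Strict Implicit.
Unset Printing Implicit Defensive.

(* The estimate is one of inexact projected gradient descent.  Strong convexity of
   [y |-> <g, y - x> + |y - x|^2 / (2 a)] shows that a projected step with gradient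
   [g + e] decreases the performative loss by at least [a / 2] times
   [|grad_map|^2 - |e|^2]; summing over the run leaves the initial gap and the mean of
   [|e|^2].

   The error [e] splits into the effect of the estimated parameter on the first gradient,
   its effect on [G], and the error of the estimated Jacobian, whence the factors 3.  A
   column of the Jacobian has bias at most [L_beta_H delta^2 / 6] (central differences)
   and mean square noise of order [sigma^2 / (b delta^2)], which equals [sigma^2 delta^4] for
   [delta = b^(-1/6)].

   [b |-> E_b f] is Lipschitz: along a segment of [B] the increment of the density is a
   limit of Riemann sums of [score * density], so Fatou's lemma and Cauchy-Schwarz bound
   [\int |f| |p_b1 - p_b0|] by [sup |f|_L2 * sqrt I_max * |b1 - b0|].  Since [B] may have
   empty interior, the mean score vanishes only in the directions of [B - B]; this is
   enough, because finite differences of points of [B] and the derivatives of [beta] lie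
   in the closed span of these directions.

   The conditional law of a batch given the current iterate is recovered from
   its values on rectangles by a pi-lambda argument. *)

(** * Euclidean geometry *)

(** The constants control increments within [Theta] and [B] only. The iterates stay in
    [Theta_delta], whose points are interior to [Theta], so derivatives of [beta] there are limits
    of controlled increments, and the formula [grad_perf] can be proved to be the derivative of the
    performative loss. Riemann sums replace an integral along the segment because exchanging
    integrals would ask for joint measurability of the score in data and parameter. Regularity in
    the parameter is only pointwise in the data, so the sums converge at no uniform rate: hence
    Fatou's lemma. Along a run, the loss, the gradient mapping and the conditional laws are
    measurable because they are Lipschitz on the closed set [Theta_delta]. In [C2], 1/12 is 3
    (1/6)^2 from the bias, and 3/2 is 3 * 2 / 4: three terms, two noisy evaluations, divisor (2
    delta)^2. The choices of [T] and [b] make each of the three contributions, initial gap, [C1]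
    term and [C2] term, at most eps^2 / 3. *)

Section Euclid.
Context {R : realType}.
Implicit Types (k : nat).

Lemma dotC {k} (u v : 'rV[R]_k) : dot u v = dot v u.
Proof. by apply: eq_bigr => i _; rewrite mulrC. Qed.

Lemma dotDl {k} (u v w : 'rV[R]_k) : dot (u + v) w = dot u w + dot v w.
Proof. by rewrite -big_split; apply: eq_bigr => i _; rewrite mxE mulrDl. Qed.

Lemma dotZl {k} a (u w : 'rV[R]_k) : dot (a *: u) w = a * dot u w.
Proof. by rewrite mulr_sumr; apply: eq_bigr => i _; rewrite mxE mulrA. Qed.

Lemma dotNl {k} (u w : 'rV[R]_k) : dot (- u) w = - dot u w.
Proof. by rewrite -scaleN1r dotZl mulN1r. Qed.

Lemma dotBl {k} (u v w : 'rV[R]_k) : dot (u - v) w = dot u w - dot v w.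
Proof. by rewrite dotDl dotNl. Qed.

Lemma dotDr {k} (u v w : 'rV[R]_k) : dot w (u + v) = dot w u + dot w v.
Proof. by rewrite dotC dotDl !(dotC w). Qed.

Lemma dotZr {k} a (u w : 'rV[R]_k) : dot w (a *: u) = a * dot w u.
Proof. by rewrite dotC dotZl (dotC w). Qed.

Lemma dotNr {k} (u w : 'rV[R]_k) : dot w (- u) = - dot w u.
Proof. by rewrite dotC dotNl (dotC w). Qed.

Lemma dotBr {k} (u v w : 'rV[R]_k) : dot w (u - v) = dot w u - dot w v.
Proof. by rewrite dotDr dotNr. Qed.

Lemma dot0r {k} (w : 'rV[R]_k) : dot w 0 = 0.
Proof. by rewrite -(scale0r 0) dotZr mul0r. Qed.

Lemma dot0l {k} (w : 'rV[R]_k) : dot 0 w = 0.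
Proof. by rewrite dotC dot0r. Qed.

Lemma dot_mulmx {p q} (u : 'rV[R]_p) (A : 'M[R]_(p, q)) (v : 'rV[R]_q) :
  dot (u *m A) v = dot u (v *m A^T).
Proof.
rewrite /dot; under eq_bigr do rewrite mxE mulr_suml.
rewrite exchange_big; apply: eq_bigr => i _ /=.
rewrite mxE mulr_sumr; apply: eq_bigr => j _.
by rewrite mxE; ring.
Qed.

Lemma dot_ev {k} (u : 'rV[R]_k) i : dot u (ev R i) = u 0 i.
Proof.
rewrite /dot (bigD1 i)//= big1 ?addr0 => [|j /negPf ji].
  by rewrite mxE !eqxx mulr1.
by rewrite mxE eqxx ji mulr0.
Qed.

Lemma dotuu_ge0 {k} (u : 'rV[R]_k) : 0 <= dot u u.
Proof. by apply: sumr_ge0 => i _; rewrite -expr2 sqr_ge0. Qed.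

Lemma enorm_sqr {k} (u : 'rV[R]_k) : enorm u ^+ 2 = dot u u.
Proof.
rewrite sqr_sqrtr; first by apply: eq_bigr => i _; rewrite expr2.
by apply: sumr_ge0 => i _; rewrite sqr_ge0.
Qed.

Lemma enorm_ge0 {k} (u : 'rV[R]_k) : 0 <= enorm u.
Proof. exact: sqrtr_ge0. Qed.

Lemma enormE {k} (u : 'rV[R]_k) : enorm u = Num.sqrt (dot u u).
Proof. by rewrite -enorm_sqr sqrtr_sqr ger0_norm ?enorm_ge0. Qed.

Lemma enorm0 {k} : enorm (0 : 'rV[R]_k) = 0.
Proof. by rewrite enormE dot0r sqrtr0. Qed.

Lemma coord_le_enorm {k} (u : 'rV[R]_k) i : `|u 0 i| <= enorm u.
Proof.
rewrite -sqrtr_sqr ler_wsqrtr// (bigD1 i)//= lerDl.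
by apply: sumr_ge0 => j _; rewrite sqr_ge0.
Qed.

Lemma enorm0_eq0 {k} (u : 'rV[R]_k) : enorm u = 0 -> u = 0.
Proof.
move=> u0; apply/rowP => i; rewrite mxE; apply/eqP; rewrite -normr_eq0.
by rewrite eq_le normr_ge0 andbT -u0 coord_le_enorm.
Qed.

Lemma enorm_gt0 {k} (u : 'rV[R]_k) : (0 < enorm u) = (u != 0).
Proof.
rewrite lt_neqAle enorm_ge0 andbT eq_sym; congr negb.
by apply/eqP/eqP => [/enorm0_eq0//|->]; rewrite enorm0.
Qed.

Lemma enormZ {k} a (u : 'rV[R]_k) : enorm (a *: u) = `|a| * enorm u.
Proof.
by rewrite !enormE dotZl dotZr mulrA -expr2 sqrtrM ?sqr_ge0// sqrtr_sqr.
Qed.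

Lemma enormN {k} (u : 'rV[R]_k) : enorm (- u) = enorm u.
Proof. by rewrite -scaleN1r enormZ normrN1 mul1r. Qed.

Lemma enorm_distC {k} (u v : 'rV[R]_k) : enorm (u - v) = enorm (v - u).
Proof. by rewrite -enormN opprB. Qed.

Lemma dot_le_enorm {k} (u v : 'rV[R]_k) : dot u v <= enorm u * enorm v.
Proof.
have [->|v0] := eqVneq v 0; first by rewrite dot0r enorm0 mulr0.
have c0 : 0 < enorm v by rewrite enorm_gt0.
(* With a = |u|, c = |v|, b = <u, v>, this square expands to c^2 (a^2 c^2 - b^2). *)
have := dotuu_ge0 (enorm v ^+ 2 *: u - dot u v *: v).
rewrite dotBl !dotBr !dotZl !dotZr (dotC v u) -!enorm_sqr.
have [/= b0|b0] := leP (dot u v) 0.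
  by move=> _; rewrite (le_trans b0)// mulr_ge0 ?enorm_ge0.
set a := enorm u; set c := enorm v in c0 *; set b := dot u v in b0 *.
move=> h; have {h}: 0 <= c ^+ 2 * ((a * c) ^+ 2 - b ^+ 2) by nra.
rewrite pmulr_rge0 ?exprn_gt0// subr_ge0.
by rewrite ler_pXn2r// nnegrE ?mulr_ge0 ?enorm_ge0// ltW.
Qed.

Lemma normr_dot_le {k} (u v : 'rV[R]_k) : `|dot u v| <= enorm u * enorm v.
Proof.
by rewrite ler_norml lerNl -dotNl dot_le_enorm// -(enormN u) dot_le_enorm.
Qed.

Lemma enormD {k} (u v : 'rV[R]_k) : enorm (u + v) <= enorm u + enorm v.
Proof.
have h : 0 <= enorm u + enorm v by rewrite addr_ge0 ?enorm_ge0.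
rewrite -(@ler_pXn2r _ 2)// ?nnegrE ?enorm_ge0//.
rewrite enorm_sqr dotDl !dotDr sqrrD -!enorm_sqr (dotC v u).
have := dot_le_enorm u v; lra.
Qed.

Lemma enormB {k} (u v : 'rV[R]_k) : enorm (u - v) <= enorm u + enorm v.
Proof. by rewrite -(enormN v) enormD. Qed.

(** Testing against [u] itself suffices. In this form, bounds on vector-valued expectations reduce
    to scalar integrals against a fixed test vector. *)
Lemma enorm_le_dual {k} (u : 'rV[R]_k) c :
  0 <= c -> (forall v, dot u v <= c * enorm v) -> enorm u <= c.
Proof.
move=> c0 /(_ u); rewrite -enorm_sqr expr2.
have [->|u0] := eqVneq u 0; first by rewrite enorm0.
by rewrite ler_pM2r// enorm_gt0.
Qed.

Lemma enorm_ev {k} i : enorm (ev R i : 'rV[R]_k) = 1.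
Proof. by rewrite enormE dot_ev mxE !eqxx sqrtr1. Qed.

Lemma row_sum_ev {k} (u : 'rV[R]_k) : u = \sum_i u 0 i *: ev R i.
Proof. exact: row_sum_delta. Qed.

Lemma enorm_sum {k} (I : finType) (F : I -> 'rV[R]_k) :
  enorm (\sum_i F i) <= \sum_i enorm (F i).
Proof.
apply: (big_ind2 (fun x y => enorm x <= y)) => //; first by rewrite enorm0.
by move=> x1 x2 y1 y2 h1 h2; rewrite (le_trans (enormD _ _))// lerD.
Qed.

(** With [enorm_le_norm], this lets Euclidean balls serve as neighbourhoods for the topology of the
    max norm. *)
Lemma norm_le_enorm {k} (u : 'rV[R]_k) : `|u| <= enorm u.
Proof.
rewrite [leLHS]/Num.Def.normr/= mx_normrE (bigmax_le _ (enorm_ge0 u))//.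
by move=> -[i j] _ /=; rewrite ord1 coord_le_enorm.
Qed.

Lemma enorm_le_norm {k} (u : 'rV[R]_k) : enorm u <= k%:R * `|u|.
Proof.
rewrite {1}(row_sum_ev u) (le_trans (enorm_sum _))//.
rewrite (_ : k%:R * `|u| = \sum_(i < k) `|u|); last first.
  by rewrite sumr_const card_ord mulr_natl.
apply: ler_sum => i _; rewrite enormZ enorm_ev mulr1.
rewrite [leRHS]/Num.Def.normr/= mx_normrE.
by apply: (le_trans _ (le_bigmax _ _ (0, i))).
Qed.

(** The difference of the two sides is the sum of the squared pairwise differences of [u], [v],
    [w]. *)
Lemma sqr_enormD3 {k} (u v w : 'rV[R]_k) :
  enorm (u + v + w) ^+ 2 <= 3 * (enorm u ^+ 2 + enorm v ^+ 2 + enorm w ^+ 2).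
Proof.
rewrite !enorm_sqr.
have := dotuu_ge0 (u - v); have := dotuu_ge0 (u - w); have := dotuu_ge0 (v - w).
rewrite !dotBl !dotBr !dotDl !dotDr (dotC v u) (dotC w u) (dotC w v); lra.
Qed.

Lemma enormBZ_sqr k (u v : 'rV[R]_k) l : enorm (u - l *: v) ^+ 2 =
  enorm u ^+ 2 - 2 * l * dot u v + l ^+ 2 * enorm v ^+ 2.
Proof. by rewrite !enorm_sqr dotBl !dotBr !dotZl !dotZr (dotC v u); ring. Qed.

(** [sup] takes a default value on unbounded sets, so boundedness must be known before [opnorm] can
    be used; the sum of the row norms of the transpose is a crude bound. *)
Lemma opnorm_ubound {p q} (A : 'M[R]_(p, q)) :
  has_sup [set enorm (x *m A^T) | x in [set x : 'rV[R]_q | enorm x <= 1]].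
Proof.
split; first by exists (enorm (0 *m A^T)), 0 => //=; rewrite enorm0.
exists (\sum_i enorm (row i A^T)) => _ [x /= x1 <-].
rewrite mulmx_sum_row (le_trans (enorm_sum _))//; apply: ler_sum => i _.
rewrite enormZ ler_piMl ?enorm_ge0//.
by rewrite (le_trans (coord_le_enorm _ _)).
Qed.

Lemma enorm_mulmx_opnorm {p q} (A : 'M[R]_(p, q)) (x : 'rV[R]_q) :
  enorm (x *m A^T) <= opnorm A * enorm x.
Proof.
have [->|x0] := eqVneq x 0; first by rewrite mul0mx !enorm0 mulr0.
have c0 : 0 < enorm x by rewrite enorm_gt0.
rewrite -ler_pdivrMr// mulrC -[X in X * _]ger0_norm ?invr_ge0 ?enorm_ge0//.
rewrite -enormZ scalemxAl; apply: ub_le_sup; first exact: (opnorm_ubound A).2.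
exists ((enorm x)^-1 *: x) => //=.
by rewrite enormZ ger0_norm ?invr_ge0 ?enorm_ge0// mulVf// gt_eqF.
Qed.

End Euclid.

(** * Projection onto a compact convex set and the inexact projected step *)

Section Projection.
Context {R : realType} {k : nat}.
Implicit Types (x y : 'rV[R]_k) (C : set 'rV[R]_k).

Lemma near_enorm x e : 0 < e -> \forall y \near x, enorm (y - x) < e.
Proof.
move=> e0; have e1 : 0 < e / k.+1%:R by rewrite divr_gt0.
apply/nbhs_ballP; exists (e / k.+1%:R) => //= y; rewrite -ball_normE/=.
rewrite ltr_pdivlMr// mulrC distrC; apply: le_lt_trans.
by rewrite (le_trans (enorm_le_norm _))// ler_wpM2r// ler_nat.
Qed.

Lemma lipschitz_continuous (f : 'rV[R]_k -> R) K :
  (forall x y, `|f x - f y| <= K * enorm (x - y)) -> continuous f.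
Proof.
move=> fK x; apply/(@cvgrPdist_lt _ _ _ _ (nbhs_filter x)) => e e0.
have K0 : 0 < `|K| + 1 by rewrite ltr_wpDl.
have := near_enorm x (divr_gt0 e0 K0); apply: filterS => y.
move=> h; rewrite (le_lt_trans (fK _ _))//; move: h.
rewrite ltr_pdivlMr// mulrC enorm_distC; apply: le_lt_trans.
by rewrite ler_wpM2r ?enorm_ge0// ler_wpDr// ler_norm.
Qed.

Lemma enorm_lip x y : `|enorm x - enorm y| <= enorm (x - y).
Proof.
have h1 : enorm x <= enorm (x - y) + enorm y.
  by rewrite -{1}(subrK y x) enormD.
have h2 : enorm y <= enorm (x - y) + enorm x.
  by rewrite enorm_distC -{1}(subrK x y) enormD.
by rewrite ler_norml; apply/andP; split; lra.
Qed.

Lemma continuous_enorm : continuous (@enorm R k).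
Proof. by apply: (@lipschitz_continuous _ 1) => x y; rewrite mul1r enorm_lip. Qed.

Lemma convex_setP C x y (l : R) : convex_set C -> C x -> C y ->
  0 <= l <= 1 -> C (l *: x + (1 - l) *: y).
Proof.
move=> cC Cx Cy /andP[l0 l1].
have := cC x y (Itv01 l0 l1).
by rewrite !inE => /(_ Cx Cy).
Qed.

(** [eproj] is defined by choice, so a minimiser has to be exhibited; compactness provides one. *)
Lemma eprojP C x : C !=set0 -> compact C -> is_eproj C x (eproj C x).
Proof.
move=> C0 cC; apply: (@getPex _ (is_eproj C x)).
have [|y Cy yP] := @compact_EVT_min _ _ (fun y => enorm (x - y)) C C0 cC.
  apply: continuous_subspaceT; apply: (@lipschitz_continuous _ 1) => u v.
  rewrite mul1r (le_trans (enorm_lip _ _))//.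
  by rewrite opprB addrC subrKA enorm_distC.
by exists y; split; [rewrite inE in Cy|move=> y' Cy'; apply: yP; rewrite inE].
Qed.

Context (C : set 'rV[R]_k).
Hypotheses (C0 : C !=set0) (cptC : compact C) (cvxC : convex_set C).

Lemma eproj_mem x : C (eproj C x).
Proof. exact: (eprojP x C0 cptC).1. Qed.

Lemma eproj_obtuse x y : C y -> dot (x - eproj C x) (y - eproj C x) <= 0.
Proof.
move=> Cy; have [Cp pmin] := eprojP x C0 cptC.
set p := eproj C x in Cp pmin *.
apply/ler_addgt0Pr => e e0; rewrite add0r.
set D := enorm (y - p) ^+ 2; have D0 : 0 <= D by rewrite sqr_ge0.
(* The projection is compared with the point at fraction [l] of the way to [y]; [l] is small enough
   for the second-order term [l * D] to be at most [e]. *)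
set l := Num.min 1 (e / (D + 1)).
have l0 : 0 < l by rewrite lt_min ltr01 divr_gt0// ltr_wpDl.
have l1 : l <= 1 by rewrite ge_min lexx.
have le : l * D <= e.
  rewrite (@le_trans _ _ (e / (D + 1) * D))// ?ler_wpM2r// ?ge_min ?lexx ?orbT//.
  by rewrite mulrAC ler_pdivrMr; [nra|lra].
have : C (l *: y + (1 - l) *: p) by apply: convex_setP => //; rewrite (ltW l0).
move=> /pmin; rewrite -(@ler_pXn2r _ 2)// ?nnegrE ?enorm_ge0//.
have -> : x - (l *: y + (1 - l) *: p) = (x - p) - l *: (y - p).
  by apply/rowP => i; rewrite !mxE; ring.
rewrite enormBZ_sqr -/D => h.
have {}h : l * (2 * dot (x - p) (y - p)) <= l * e.
  have : l * (l * D) <= l * e by rewrite ler_pM2l.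
  lra.
by rewrite ler_pM2l// in h; lra.
Qed.

(** Sum of the two obtuse-angle inequalities. It makes the gradient mapping Lipschitz, hence
    measurable along a run. *)
Lemma eproj_nonexp x y : enorm (eproj C x - eproj C y) <= enorm (x - y).
Proof.
have h1 := eproj_obtuse x (eproj_mem y).
have h2 := eproj_obtuse y (eproj_mem x).
set p := eproj C x in h1 h2 *; set q := eproj C y in h1 h2 *.
have [pq0|pq0] := eqVneq (enorm (p - q)) 0; first by rewrite pq0 enorm_ge0.
have pq : 0 < enorm (p - q) by rewrite lt_neqAle eq_sym pq0 enorm_ge0.
rewrite -(ler_pM2r pq) -expr2 enorm_sqr.
apply: (le_trans _ (dot_le_enorm _ _)).
by move: h1 h2; rewrite !dotBl !dotBr; lra.
Qed.

(** The exact step [xh] is tested against [x], the inexact step [xp] against [xh]. Twice the sum of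
    the two variational inequalities leaves the cross term 2 a <e, xh - xp>, which Young's
    inequality bounds by a^2 |e|^2 + |xh - xp|^2; the last square cancels, so the error enters with
    factor 1. *)
Lemma inexact_prox_step x g e a xh xp : C x -> 0 < a ->
  xh = eproj C (x - a *: g) -> xp = eproj C (x - a *: (g + e)) ->
  enorm (a^-1 *: (x - xh)) ^+ 2 + 2 / a * (dot g (xp - x) +
    enorm (xp - x) ^+ 2 / (2 * a)) <= enorm e ^+ 2.
Proof.
move=> Cx a0 xhE xpE.
have h1 := eproj_obtuse (x - a *: g) Cx.
have h2 := eproj_obtuse (x - a *: (g + e)) (eproj_mem (x - a *: g)).
rewrite -xhE in h1 h2; rewrite -xpE in h2; move: xhE xpE => _ _.
have h3 := dotuu_ge0 (a *: e - (xh - xp)).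
rewrite enormZ exprMn ger0_norm; last by rewrite invr_ge0 ltW.
rewrite !enorm_sqr -(@ler_pM2r _ (a ^+ 2)) ?exprn_gt0//.
have -> : (a^-1 ^+ 2 * dot (x - xh) (x - xh) +
   2 / a * (dot g (xp - x) + dot (xp - x) (xp - x) / (2 * a))) * a ^+ 2 =
   dot (x - xh) (x - xh) + 2 * a * dot g (xp - x) + dot (xp - x) (xp - x).
  by field; rewrite gt_eqF.
move: h1 h2 h3; rewrite !(dotBl, dotBr, dotDl, dotDr, dotNl, dotNr, dotZl, dotZr).
rewrite ?(dotC x g) ?(dotC xp g) ?(dotC xh g) ?(dotC xp x) ?(dotC xh x).
rewrite ?(dotC xh xp) ?(dotC xp e) ?(dotC xh e) ?(dotC x e).
lra.
Qed.

End Projection.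

(** * Differential calculus *)

Section Lines.
Context {R : realType}.

Lemma is_derive_line (V W : normedModType R) (f : V -> W) x v s :
  derivable f (x + s *: v) v ->
  is_derive s 1 (fun t : R => f (x + t *: v)) ('D_v f (x + s *: v)).
Proof.
have E : (fun h : R => h^-1 *: (((fun t => f (x + t *: v)) \o shift s) (h *: 1)
           - f (x + s *: v))) =
         (fun h => h^-1 *: ((f \o shift (x + s *: v)) (h *: v) - f (x + s *: v))).
  apply/funext => h /=; rewrite /shift/= [h *: 1]mulr1; congr (_ *: (f _ - _)).
  by rewrite scalerDl addrCA.
by move=> df; apply: DeriveDef; rewrite /derivable /derive E.
Qed.

Lemma is_derive_coord {k} (V : normedModType R) (g : V -> 'rV[R]_k) x v dg i :
  is_derive x v g dg -> is_derive x v (fun t => g t 0 i) (dg 0 i).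
Proof.
move=> dgx; have dg0 : derivable g x v by [].
have /derivable_mxP/(_ 0 i) h := dg0.
by apply: DeriveDef => //; rewrite -(@derive_val _ _ _ _ _ _ _ dgx) derive_mx// mxE.
Qed.

Lemma is_derive_dot {k} (V : normedModType R) (g : V -> 'rV[R]_k) x v dg w :
  is_derive x v g dg -> is_derive x v (fun t => dot (g t) w) (dot dg w).
Proof.
move=> dgx.
have -> : (fun t => dot (g t) w) = \sum_(i < k) (w 0 i *: (fun t => g t 0 i)).
  apply/funext => t; rewrite fct_sumE; apply: eq_bigr => i _.
  by rewrite [RHS]mulrC.
have -> : dot dg w = \sum_(i < k) (w 0 i *: dg 0 i).
  by apply: eq_bigr => i _; rewrite [RHS]mulrC.
apply: is_derive_sum => i; apply: is_deriveZ; exact: is_derive_coord.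
Qed.

Lemma is_derive_monomial (c x : R) n :
  is_derive x 1 (fun y => c * y ^+ n) (c * (n%:R * x ^+ n.-1)).
Proof.
apply: (@is_deriveZ _ _ _ (fun y : R => y ^+ n)).
apply: DeriveDef; first exact: exprn_derivable.
by rewrite exp_derive [_ *: 1]mulr1.
Qed.

Lemma le_of_derive (f df : R -> R) (a b : R) : a <= b ->
  (forall x : R, a <= x <= b -> is_derive x 1 f (df x)) ->
  (forall x, a <= x <= b -> df x <= 0) -> f b <= f a.
Proof.
move=> ab dfP dfN.
have [||c] := @MVT_segment _ f df a b ab.
- by move=> x; rewrite in_itv/= => /andP[/ltW h1 /ltW h2]; apply: dfP; rewrite h1.
- apply: derivable_within_continuous => x; rewrite in_itv/= => h.
  by have := dfP _ h.
- rewrite in_itv/= => /dfN h /eqP; rewrite subr_eq => /eqP ->.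
  by rewrite gerDr mulr_le0_ge0// subr_ge0.
Qed.

(** Monotonicity is applied to [f1], then to [f], after subtracting a polynomial: an upper bound on
    [f2] is enough, without continuity or an integral remainder. Two-sided bounds come from applying
    it to [f] and [- f]. *)
Lemma taylor1 (f f1 f2 : R -> R) (M h : R) : 0 <= h ->
  (forall x : R, 0 <= x <= h -> is_derive x 1 f (f1 x)) ->
  (forall x : R, 0 <= x <= h -> is_derive x 1 f1 (f2 x)) ->
  (forall x, 0 <= x <= h -> f2 x <= M) ->
  f h - f 0 - h * f1 0 <= M * h ^+ 2 / 2.
Proof.
move=> h0 d1 d2 f2M.
have f1M x : 0 <= x <= h -> f1 x - f1 0 - M * x <= 0.
  move=> /andP[x0 xh].
  have := @le_of_derive (f1 - (fun y => M * y)) (fun y => f2 y - M) 0 x x0.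
  rewrite -[(f1 - _) x]/(f1 x - _) -[(f1 - _) 0]/(f1 0 - _) => h1.
  suff : f1 x - M * x <= f1 0 - M * 0 by lra.
  apply: h1 => y /andP[y0 yx].
    have yh : 0 <= y <= h by rewrite y0 (le_trans yx).
    have := d2 _ yh => ?; apply: is_deriveB.
    by apply: is_derive_eq; exact: mulr1.
  by rewrite subr_le0 f2M// y0 (le_trans yx).
have := @le_of_derive (f - (fun y => y * f1 0) - (fun y => M / 2 * y ^+ 2))
  (fun y => f1 y - f1 0 - M * y) 0 h h0.
rewrite -[(f - _ - _) h]/(f h - _ - _) -[(f - _ - _) 0]/(f 0 - _ - _) => h1.
suff : f h - h * f1 0 - M / 2 * h ^+ 2 <= f 0 - 0 * f1 0 - M / 2 * 0 ^+ 2 by lra.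
apply: h1 => // y yh; have := d1 _ yh => ?.
apply: is_deriveB.
  by apply: is_deriveB; apply: is_derive_eq; rewrite scaler0 add0r; exact: mulr1.
by apply: is_derive_eq (is_derive_monomial _ _ _) _; rewrite /= expr1; field.
Qed.

(** Made for a symmetric difference with its linear part removed: its second derivative is
    controlled linearly near 0 by Lipschitz continuity alone, so no third derivative enters. *)
Lemma central_difference (f f1 f2 : R -> R) (K h : R) : 0 <= h ->
  (forall x : R, 0 <= x <= h -> is_derive x 1 f (f1 x)) ->
  (forall x : R, 0 <= x <= h -> is_derive x 1 f1 (f2 x)) ->
  (forall x, 0 <= x <= h -> f2 x <= K * x) -> f1 0 = 0 ->
  f h - f 0 <= K * h ^+ 3 / 6.
Proof.
move=> h0 d1 d2 f2M f10.
have f1M x : 0 <= x <= h -> f1 x - K * x ^+ 2 / 2 <= 0.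
  move=> /andP[x0 xh].
  have := @le_of_derive (f1 - (fun y => K / 2 * y ^+ 2)) (fun y => f2 y - K * y) 0 x x0.
  rewrite -[(f1 - _) x]/(f1 x - _) -[(f1 - _) 0]/(f1 0 - _) f10 => h1.
  suff : f1 x - K / 2 * x ^+ 2 <= 0 - K / 2 * 0 ^+ 2 by lra.
  apply: h1 => y /andP[y0 yx].
    have yh : 0 <= y <= h by rewrite y0 (le_trans yx).
    have := d2 _ yh => ?; apply: is_deriveB.
    by apply: is_derive_eq (is_derive_monomial _ _ _) _; rewrite /= expr1; field.
  by rewrite subr_le0 f2M// y0 (le_trans yx).
have := @le_of_derive (f - (fun y => K / 6 * y ^+ 3))
  (fun y => f1 y - K * y ^+ 2 / 2) 0 h h0.
rewrite -[(f - _) h]/(f h - _) -[(f - _) 0]/(f 0 - _) => h1.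
suff : f h - K / 6 * h ^+ 3 <= f 0 - K / 6 * 0 ^+ 3 by lra.
apply: h1 => // y yh; have := d1 _ yh => ?.
apply: is_deriveB.
by apply: is_derive_eq (is_derive_monomial _ _ _) _; rewrite /=; field.
Qed.

Lemma derive_dot_grad {k} (f : 'rV[R]_k -> R) x v :
  differentiable f x -> 'D_v f x = dot (grad f x) v.
Proof.
move=> df; rewrite deriveE// {1}(row_sum_ev v) linear_sum.
by apply: eq_bigr => i _; rewrite linearZ mxE deriveE// [LHS]mulrC.
Qed.

Lemma derive_jac {p q} (f : 'rV[R]_p -> 'rV[R]_q) x v :
  differentiable f x -> 'D_v f x = v *m (jac f x)^T.
Proof. by move=> df; rewrite deriveEjacobian// /jac trmxK. Qed.

End Lines.

Section Calculus.
Context {R : realType}.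

(** A derivative is a limit of difference quotients. The closed set will be a ball, to bound the
    derivative of [beta], or a hyperplane, to show orthogonality. *)
Lemma derive_closed (V W : normedModType R) (f : V -> W) x v (S : set W) :
  derivable f x v -> closed S ->
  (\forall h \near (0 : R)^', S (h^-1 *: (f (h *: v + x) - f x))) ->
  S ('D_v f x).
Proof.
move=> df cS nS; exact: (@closed_cvg _ _ _ _ _ _ cS nS).
Qed.

Lemma closed_enorm_le k (c : R) : closed [set u : 'rV[R]_k | enorm u <= c].
Proof.
apply: (@closed_comp _ _ (@enorm R k) [set y | y <= c]); last exact: closed_le.
by move=> x _; exact: continuous_enorm.
Qed.

Lemma continuous_dot k (g : 'rV[R]_k) : continuous (dot g).
Proof.
apply: (@lipschitz_continuous _ _ _ (enorm g)) => x y.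
by rewrite -dotBr normr_dot_le.
Qed.

Lemma closed_dot_eq0 k (g : 'rV[R]_k) : closed [set u : 'rV[R]_k | dot g u = 0].
Proof.
apply: (@closed_comp _ _ (dot g) [set y | y = 0]).
  by move=> x _; exact: continuous_dot.
exact: closed_eq.
Qed.

Lemma derive_row_sum k (W : normedModType R) (f : 'rV[R]_k -> W) x v :
  differentiable f x -> 'D_v f x = \sum_i v 0 i *: 'D_(ev R i) f x.
Proof.
move=> df; rewrite deriveE// {1}(row_sum_ev v) linear_sum.
by apply: eq_bigr => i _; rewrite linearZ deriveE.
Qed.

(** Bilinearity in the two directions, which an iterated directional derivative has only under
    differentiability. *)
Lemma derive2_row_sum k (W : normedModType R) (f : 'rV[R]_k -> W) x u v :
  (forall y, differentiable f y) ->
  (forall w, differentiable ('D_w f) x) ->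
  'D_v ('D_u f) x =
    \sum_i \sum_j (u 0 i * v 0 j) *: 'D_(ev R j) ('D_(ev R i) f) x.
Proof.
move=> df d2f.
have -> : 'D_u f = \sum_i u 0 i *: 'D_(ev R i) f.
  by apply/funext => y; rewrite fct_sumE derive_row_sum.
rewrite derive_sum; last by move=> i; apply: derivableZ; exact: diff_derivable.
apply: eq_bigr => i _; rewrite deriveZ; last exact: diff_derivable.
rewrite derive_row_sum// scaler_sumr; apply: eq_bigr => j _.
by rewrite scalerA.
Qed.

Lemma derive_opp (V W : normedModType R) (f : V -> W) x v :
  differentiable f x -> 'D_(- v) f x = - 'D_v f x.
Proof. by move=> df; rewrite !deriveE// linearN. Qed.

Lemma derive2_opp (V W : normedModType R) (f : V -> W) x v :
  (forall y, differentiable f y) -> differentiable ('D_v f) x ->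
  'D_(- v) ('D_(- v) f) x = 'D_v ('D_v f) x.
Proof.
move=> df d2f; have -> : 'D_(- v) f = - 'D_v f.
  by apply/funext => y; rewrite derive_opp.
rewrite derive_opp; last exact: differentiableN.
by rewrite deriveN ?opprK//; exact: diff_derivable.
Qed.

(** [A] certifies that the set under [sup] is bounded; its value does not enter the conclusion. *)
Lemma opnorm2_ge k p (T : 'rV[R]_k -> 'rV[R]_k -> 'rV[R]_p) u v (A : R) :
  (forall u v, enorm u <= 1 -> enorm v <= 1 -> enorm (T u v) <= A) ->
  enorm u <= 1 -> enorm v <= 1 -> enorm (T u v) <= opnorm2 T.
Proof.
move=> TA u1 v1; apply: ub_le_sup; last by exists (u, v).
by exists A => _ [[a b] /= [a1 b1] <-]; exact: TA.
Qed.

Lemma convex_avg k (C : set 'rV[R]_k) j (p : 'I_j -> 'rV[R]_k) :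
  convex_set C -> (0 < j)%N -> (forall i, C (p i)) -> C (j%:R^-1 *: \sum_i p i).
Proof.
move=> cC; case: j p => // j p _; elim: j p => [|j IH] p Cp.
  by rewrite big_ord1 invr1 scale1r.
rewrite big_ord_recr/= scalerDr.
set q := \sum_i _.
have q' : C (j.+1%:R^-1 *: q) by apply: IH.
have -> : j.+2%:R^-1 *: q + j.+2%:R^-1 *: p ord_max =
  (j.+1%:R / j.+2%:R) *: (j.+1%:R^-1 *: q) +
  (1 - (j.+1%:R / j.+2%:R)) *: p ord_max.
  rewrite -(natr1 j.+1) scalerA.
  have a0 : 0 < j.+1%:R :> R by [].
  move: (j.+1%:R : R) a0 => a a0.
  have a1 : a + 1 != 0 by lra.
  by congr (_ *: _ + _ *: _); field; rewrite ?a1 ?gt_eqF.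
apply: convex_setP => //; rewrite divr_ge0//= ler_pdivrMr// mul1r.
by rewrite ler_nat.
Qed.

End Calculus.

(** * Position of [Theta_delta] inside [Theta] *)

Section BetaMap.
Context {R : realType} {n m d : nat} (pb : problem R n m d).
Context (delta sigma : R) (bmin : nat) (c : constants R).
Hypotheses (HA : assumptionA pb delta sigma bmin) (HV : valid_constants pb c).
Hypotheses (n0 : (0 < n)%N) (delta0 : 0 < delta).

Lemma Theta_deltaW th : Theta_delta pb delta th -> Theta pb th.
Proof. by case. Qed.

Lemma Theta_segment x y t : Theta pb x -> Theta pb y -> 0 <= t <= 1 ->
  Theta pb (x + t *: (y - x)).
Proof.
move=> Tx Ty t01; have [_ _ cT _] := A_Theta HA.
have := convex_setP cT Ty Tx t01; congr (Theta pb _).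
by apply/rowP => i; rewrite !mxE; ring.
Qed.

Lemma Theta_delta_segment x y t : Theta_delta pb delta x ->
  Theta_delta pb delta y -> 0 <= t <= 1 -> Theta_delta pb delta (x + t *: (y - x)).
Proof.
move=> Tx Ty t01; have [_ _ cT _] := A_Theta_delta HA.
have := convex_setP cT Ty Tx t01; congr (Theta_delta pb _ _).
by apply/rowP => i; rewrite !mxE; ring.
Qed.

Lemma B_segment x y t : B pb x -> B pb y -> 0 <= t <= 1 ->
  B pb (x + t *: (y - x)).
Proof.
move=> Tx Ty t01; have [cT _ _] := A_B HA.
have := convex_setP cT Ty Tx t01; congr (B pb _).
by apply/rowP => i; rewrite !mxE; ring.
Qed.

Lemma Theta_coord_line x i t : Theta_delta pb delta x -> `|t| <= delta ->
  Theta pb (x + t *: ev R i).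
Proof.
move=> [Tx /(_ i)[Tp Tm]].
have td s : 0 <= s -> s <= delta -> 0 <= s / delta <= 1.
  by move=> s0 sd; rewrite divr_ge0 ?(ltW delta0)//= ler_pdivrMr ?mul1r.
have [t0|t0] := ger0P t => tdelta.
  have := Theta_segment Tx Tp (td _ t0 tdelta); congr (Theta pb _).
  by rewrite [X in _ *: X]addrAC subrr add0r scalerA divfK// gt_eqF.
have := Theta_segment Tx Tm (td (- t) _ tdelta); rewrite oppr_ge0 => /(_ (ltW t0)).
congr (Theta pb _).
by rewrite [X in _ *: X]addrAC subrr add0r scalerN scalerA divfK ?gt_eqF// scaleNr opprK.
Qed.

(** [y] is the average over i of the points x + n (y - x)_i e_i, each of which lies on a coordinate
    segment of half-length [delta] around [x]. So every point of [Theta_delta] is interior to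
    [Theta]. *)
Lemma Theta_ball x y : Theta_delta pb delta x -> n%:R * enorm (y - x) <= delta ->
  Theta pb y.
Proof.
move=> Tx yx; have [_ _ cT _] := A_Theta HA.
have Tp i : Theta pb (x + (n%:R * (y - x) 0 i) *: ev R i).
  apply: Theta_coord_line => //; apply: le_trans yx.
  by rewrite normrM normr_nat ler_wpM2l// coord_le_enorm.
have := convex_avg cT n0 Tp; congr (Theta pb _).
have nz : n%:R != 0 :> R by rewrite pnatr_eq0 -lt0n.
rewrite big_split/= scalerDr sumr_const card_ord scaler_sumr.
under eq_bigr do rewrite scalerA mulKf//.
by rewrite -row_sum_ev -[x *+ n]scaler_nat scalerA mulVf// scale1r addrC subrK.
Qed.

End BetaMap.

(** * Derivatives of [beta] and the bias of central differences *)

Section BetaDeriv.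
Context {R : realType} {n m d : nat} (pb : problem R n m d).
Context (delta sigma : R) (bmin : nat) (c : constants R).
Hypotheses (HA : assumptionA pb delta sigma bmin) (HV : valid_constants pb c).
Hypotheses (n0 : (0 < n)%N) (delta0 : 0 < delta).

Lemma beta_differentiable y : differentiable (beta pb) y.
Proof. by have [/(_ y) h _] := A_beta HA; exact: h. Qed.

Lemma Dbeta_differentiable u y : differentiable ('D_u (beta pb)) y.
Proof. by have [_ /(_ u)[/(_ y) h _]] := A_beta HA; exact: h. Qed.

Lemma near_Theta x v : Theta_delta pb delta x ->
  \forall h \near (0 : R)^', Theta pb (h *: v + x).
Proof.
move=> Tx; have e0 : 0 < n%:R * enorm v + 1.
  by rewrite ltr_wpDl// mulr_ge0 ?enorm_ge0.
near=> h; apply: (Theta_ball HA n0 delta0 Tx).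
rewrite addrK enormZ mulrCA.
have : `|h| < delta / (n%:R * enorm v + 1).
  by near: h; apply: dnbhs0_lt; rewrite divr_gt0.
rewrite ltr_pdivlMr// => /ltW; apply: le_trans.
by rewrite ler_wpM2l// lerDl.
Unshelve. all: end_near. Qed.

Lemma Dbeta_le x v : Theta_delta pb delta x ->
  enorm ('D_v (beta pb) x) <= L_beta_Lip c * enorm v.
Proof.
move=> Tx.
apply: (derive_closed (S := [set u | enorm u <= L_beta_Lip c * enorm v])).
- exact/diff_derivable/beta_differentiable.
- exact: closed_enorm_le.
have := near_Theta v Tx; have := nbhs_dnbhs_neq (0 : R).
apply: filterS2 => h h0 Th /=.
rewrite enormZ normfV ler_pdivrMl ?normr_gt0// mulrCA -enormZ.
have := c_beta_Lip HV Th (Theta_deltaW Tx).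
by rewrite addrK.
Qed.

Lemma Dbeta_perp g x v : Theta_delta pb delta x ->
  (forall y, Theta pb y -> dot g (beta pb y - beta pb x) = 0) ->
  dot g ('D_v (beta pb) x) = 0.
Proof.
move=> Tx gB.
apply: (derive_closed (S := [set u | dot g u = 0])).
- exact/diff_derivable/beta_differentiable.
- exact: closed_dot_eq0.
have := near_Theta v Tx; apply: filterS => h Th /=.
by rewrite dotZr gB// mulr0.
Qed.

Lemma D2beta_lip x y u v : Theta pb x -> Theta pb y ->
  enorm u <= 1 -> enorm v <= 1 ->
  enorm (D2 (beta pb) x u v - D2 (beta pb) y u v) <= L_beta_H c * enorm (x - y).
Proof.
move=> Tx Ty u1 v1; apply: le_trans (c_beta_H HV Tx Ty).
pose D (i j : 'I_n) := D2 (beta pb) x (ev R i) (ev R j)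
  - D2 (beta pb) y (ev R i) (ev R j).
(* The values on basis vectors bound the bilinear difference on the unit balls, so the supremum is
   finite. *)
apply: (@opnorm2_ge _ _ _ (fun u v => D2 (beta pb) x u v - D2 (beta pb) y u v)
  u v (\sum_i \sum_j enorm (D i j))) => // {u1 v1}u {}v u1 v1.
have hD z : D2 (beta pb) z u v = \sum_i \sum_j (u 0 i * v 0 j) *:
    D2 (beta pb) z (ev R i) (ev R j).
  apply: derive2_row_sum => *; first exact: beta_differentiable.
  exact: Dbeta_differentiable.
rewrite !hD -sumrB (le_trans (enorm_sum _))//; apply: ler_sum => i _.
rewrite -sumrB (le_trans (enorm_sum _))//; apply: ler_sum => j _.
rewrite -scalerBr enormZ ler_piMl ?enorm_ge0// normrM mulr_ile1//.
  by rewrite (le_trans (coord_le_enorm _ _)).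
by rewrite (le_trans (coord_le_enorm _ _)).
Qed.

Lemma beta_central x i : Theta_delta pb delta x ->
  enorm ((2 * delta)^-1 *: (beta pb (x + delta *: ev R i)
                            - beta pb (x - delta *: ev R i))
         - 'D_(ev R i) (beta pb) x) <= L_beta_H c * delta ^+ 2 / 6.
Proof.
move=> Tx; set e := ev R i; set D := 'D_e (beta pb) x.
have [[_ _ _ _ LH0] _] := c_ge0 HV.
have Tl s : 0 <= s <= delta -> Theta pb (x + s *: e).
  by move=> /andP[s0 sd]; apply: (Theta_coord_line HA) => //; rewrite ger0_norm.
have Tl' s : 0 <= s <= delta -> Theta pb (x + s *: (- e)).
  move=> /andP[s0 sd]; rewrite scalerN -scaleNr.
  by apply: (Theta_coord_line HA) => //; rewrite normrN ger0_norm.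
suff h : enorm (beta pb (x + delta *: e) - beta pb (x + delta *: (- e))
      - (2 * delta) *: D) <= L_beta_H c * delta ^+ 3 / 3.
  have -> : (2 * delta)^-1 *: (beta pb (x + delta *: e) - beta pb (x - delta *: e)) - D
    = (2 * delta)^-1 *: (beta pb (x + delta *: e) - beta pb (x + delta *: (- e))
      - (2 * delta) *: D).
    rewrite scalerN [RHS]scalerBr [in RHS]scalerA mulVf ?scale1r//.
    by rewrite mulf_neq0// gt_eqF.
  have d2 : 0 < 2 * delta by rewrite mulr_gt0.
  rewrite enormZ ger0_norm ?invr_ge0 ?(ltW d2)// ler_pdivrMl//.
  by apply: (le_trans h); rewrite le_eqVlt; apply/orP; left; apply/eqP; field.
apply: enorm_le_dual => [|w].
  by rewrite divr_ge0// mulr_ge0// exprn_ge0// ltW.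
(* The derivative of [f] vanishes at 0. Its second derivative compares second derivatives of [beta]
   at two points at distance 2 s, whence the constant 2 [L_beta_H] |w|; dividing the cubic bound by
   2 [delta] gives the factor 1/6. *)
pose f s := dot (beta pb (x + s *: e) - beta pb (x + s *: (- e)) - (2 * s) *: D) w.
pose f1 s := dot ('D_e (beta pb) (x + s *: e) - 'D_(- e) (beta pb) (x + s *: (- e))
  - 2 *: D) w.
pose f2 s := dot ('D_e ('D_e (beta pb)) (x + s *: e)
  - 'D_(- e) ('D_(- e) (beta pb)) (x + s *: (- e))) w.
have := @central_difference R f f1 f2 (2 * L_beta_H c * enorm w) delta (ltW delta0).
rewrite /f mulr0 !scale0r addr0 !subrr dot0l subr0.
move=> h; apply: le_trans (h _ _ _ _) _.
- move=> s s0; apply: is_derive_dot.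
  apply: is_deriveB; last first.
    have -> : (fun t : R => (2 * t) *: D) = (fun t => id (0 + t *: (2 *: D))).
      by apply/funext => t; rewrite add0r scalerA mulrC.
    have h1 := @is_derive_line R _ _ id 0 (2 *: D) s (@derivable_id _ _ _ _).
    by rewrite derive_id in h1.
  apply: is_deriveB; apply: is_derive_line; apply: diff_derivable;
    exact: beta_differentiable.
- move=> s s0; apply: is_derive_dot.
  rewrite -[X in is_derive _ _ _ X]subr0.
  apply: is_deriveB; apply: is_deriveB; apply: is_derive_line; apply: diff_derivable;
    exact: Dbeta_differentiable.
- move=> s s0; apply: le_trans (dot_le_enorm _ _) _.
  rewrite [leRHS]mulrAC ler_wpM2r ?enorm_ge0//.
  rewrite (@derive2_opp _ _ _ (beta pb) (x + s *: (- e)) e beta_differentiable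
    (Dbeta_differentiable _ _)).
  have e1 : enorm e <= 1 by rewrite enorm_ev.
  have := D2beta_lip (Tl _ s0) (Tl' _ s0) e1 e1; rewrite /D2 => /le_trans; apply.
  rewrite (_ : _ - _ = (2 * s) *: e); last by apply/rowP => j; rewrite !mxE; ring.
  have /andP[s00 _] := s0.
  by rewrite enormZ enorm_ev mulr1 ger0_norm ?mulr_ge0//; lra.
- rewrite /f1 !scale0r addr0 (derive_opp e (beta_differentiable _)).
  by rewrite opprK -/D -[D]scale1r -scalerDl scalerA -scalerBl mulr1 subrr scale0r dot0l.
- by lra.
Qed.

End BetaDeriv.

(** * Integration *)

Section Mixture.
Local Open Scope ereal_scope.
Context dX dY (X : measurableType dX) (Y : measurableType dY) (R : realType).
Context (mu : {measure set X -> \bar R}) (nu : {measure set Y -> \bar R}).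
Context (k : X -> {measure set Y -> \bar R}).
Hypothesis mk : forall U : set Y, measurable U ->
  measurable_fun [set: X] (fun x => k x U : \bar R).
Hypothesis nuE : forall U : set Y, measurable U -> nu U = \int[mu]_x (k x U).

Import HBNNSimple.

Let integral_mixture_nnsfun (f : {nnsfun Y >-> R}) :
  \int[nu]_y (f y)%:E = \int[mu]_x \int[k x]_y (f y)%:E.
Proof.
rewrite integralT_nnsfun sintegralE.
under [RHS]eq_integral do rewrite integralT_nnsfun sintegralE.
have f0 r x : (range f) r -> 0 <= r%:E * k x (f @^-1` [set r]).
  by move=> [y _ <-]; rewrite mule_ge0// lee_fin.
have mkf (r : R) : measurable_fun setT (fun x => r%:E * k x (f @^-1` [set r])).
  by apply: measurable_funeM; exact: mk.
have g0 r x : 0 <= r%:E * k x (f @^-1` [set r]).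
  have [fr|nfr] := pselect (range f r); first exact: f0.
  rewrite (_ : f @^-1` [set r] = set0) ?measure0 ?mule0//.
  by apply/seteqP; split => // y /= fy; apply: nfr; exists y.
rewrite ge0_integral_fsum//; apply: eq_fsbigr => r; rewrite inE => -[y _ <-].
by rewrite ge0_integralZl_EFin ?nuE//; exact: mk.
Qed.

(** From simple functions by monotone convergence. It serves twice: weighted point masses give
    integration against a density, conditional laws give disintegration. *)
Lemma ge0_integral_mixture (f : Y -> \bar R) : measurable_fun setT f ->
  (forall y, 0 <= f y) -> \int[nu]_y f y = \int[mu]_x \int[k x]_y f y.
Proof.
move=> mf f0; pose g := nnsfun_approx measurableT mf.
have gf y : (g n y)%:E @[n --> \oo] --> f y by exact: cvg_nnsfun_approx.
have mg n : measurable_fun setT (EFin \o g n) by exact/measurable_EFinP.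
have g0 n (y : Y) : setT y -> 0 <= (g n y)%:E by move=> _; rewrite lee_fin.
have gnd (y : Y) : setT y -> nondecreasing_seq (fun n => (g n y)%:E).
  by move=> _ a b ab; rewrite lee_fin; exact/lefP/nd_nnsfun_approx.
have lim_g (m : {measure set Y -> \bar R}) :
    \int[m]_y f y = limn (fun n => \int[m]_y (g n y)%:E).
  rewrite -(monotone_convergence _ _ mg g0 gnd)//.
  by apply: eq_integral => y _; apply/esym/cvg_lim => //; exact: gf.
rewrite lim_g; under eq_fun do rewrite integral_mixture_nnsfun.
rewrite -monotone_convergence//.
- by apply: eq_integral => x _; rewrite lim_g.
- move=> n; apply: measurable_fun_integral_kernel => [U| y|]; first exact: mk.
    by rewrite lee_fin.
  exact: mg.
- by move=> n x _; apply: integral_ge0 => y _; rewrite lee_fin.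
- move=> x _ a b ab; apply: ge0_le_integral => //.
  + by move=> y Yy; exact: g0.
  + exact: mg.
  + exact: mg.
  + by move=> y Yy; apply: (gnd y Yy a b ab).
Qed.

End Mixture.

Section Density.
Context dX (X : measurableType dX) (R : realType).
Context (mu nu : {measure set X -> \bar R}) (D : set X) (p : X -> R).
Hypotheses (mD : measurable D) (mp : measurable_fun D p).
Hypothesis p0 : forall x, D x -> 0 <= p x.
Hypothesis nuE : forall S, measurable S ->
  nu S = (\int[mu]_(x in S `&` D) (p x)%:E)%E.

Local Open Scope ereal_scope.

Lemma ge0_integral_density (f : X -> \bar R) : measurable_fun D f ->
  (forall x, D x -> 0 <= f x) ->
  \int[nu]_(x in D) f x = \int[mu]_(x in D) (f x * (p x)%:E).
Proof.
move=> mf f0.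
have q0 x : (0 <= (p \_ D) x)%R.
  by rewrite patchE; case: ifPn => // /set_mem /p0.
(* [nu] is the mixture over [mu] of the point masses p(x) at x, with [p] set to 0 outside [D] so
   that every weight is nonnegative. *)
pose k x : {measure set X -> \bar R} := mscale (NngNum (q0 x)) \d_x.
have kE x U : k x U = ((p \_ D) x)%:E * (\1_U x)%:E by [].
have mq : measurable_fun setT (p \_ D) by exact/(measurable_restrictT _ mD).
have mk U : measurable U -> measurable_fun [set: X] (fun x => k x U : \bar R).
  move=> mU; under eq_fun do rewrite kE.
  apply/measurable_EFinP/measurable_funM => //; exact: measurable_indic.
have nuk U : measurable U -> nu U = \int[mu]_x k x U.
  move=> mU; rewrite nuE// integral_mkcond; apply: eq_integral => x _.
  rewrite kE indicE !patchE in_setI; case: (x \in U); case: (x \in D);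
    by rewrite /= ?mule1 ?mule0 ?mul0e.
rewrite integral_mkcond [RHS]integral_mkcond (ge0_integral_mixture mk nuk).
- apply: eq_integral => x _.
  rewrite /k ge0_integral_mscale//; last 2 first.
  - exact/(measurable_restrictT _ mD).
  - by move=> y _; rewrite patchE; case: ifPn => // /set_mem /f0.
  rewrite integral_dirac ?diracT ?mul1e//; last exact/(measurable_restrictT _ mD).
  by rewrite /= !patchE; case: ifPn => // _; rewrite ?mul0e// muleC.
- exact/(measurable_restrictT _ mD).
- by move=> y; rewrite patchE; case: ifPn => // /set_mem /f0.
Qed.

End Density.

(** * Lower limits, Borel measurability and Riemann sums *)

Section Tools.
Context {R : realType}.

Lemma limn_einf_ge (u : nat -> \bar R) (a : R) :
  (forall e, 0 < e -> exists N, forall n, (N <= n)%N -> ((a - e)%:E <= u n)%E) ->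
  (a%:E <= limn_einf u)%E.
Proof.
move=> ua; rewrite limn_einf_lim; apply/lee_subgt0Pr => e e0.
have [N uN] := ua e e0.
have h : ((a - e)%:E <= einfs u N)%E.
  by apply: le_ereal_inf_tmp => _ [n /= Nn <-]; exact: uN.
apply: (le_trans h); apply: lime_ge; first exact: is_cvg_einfs.
by exists N => // n /= Nn; exact: nondecreasing_einfs.
Qed.

Lemma limn_einf_le (u : nat -> \bar R) (a : \bar R) :
  (forall n, (u n <= a)%E) -> (limn_einf u <= a)%E.
Proof.
move=> ua; rewrite limn_einf_lim; apply: lime_le; first exact: is_cvg_einfs.
apply: nearW => n; apply: le_trans (ua n).
by apply: ereal_inf_lbound; exists n => //=.
Qed.

Lemma open_borel_measurable k (U : set 'rV[R]_k) :
  open U -> measurable (U : set (borel R k)).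
Proof. by move=> oU; apply: sub_sigma_algebra. Qed.

Lemma closed_borel_measurable k (U : set 'rV[R]_k) :
  closed U -> measurable (U : set (borel R k)).
Proof.
move=> cU; rewrite -[U]setCK; apply: measurableC; apply: open_borel_measurable.
exact: closed_openC.
Qed.

Lemma continuous_borel_measurable k (f : 'rV[R]_k -> R) :
  continuous f -> measurable_fun setT (f : borel R k -> R).
Proof.
move=> /continuousP cf; apply: (measurability _ (RGenOpens.measurableE R)).
move=> _ [_ [a [b ->] <-]]; rewrite setTI; apply: open_borel_measurable.
exact/cf/interval_open.
Qed.

(** Nothing is known of [f] outside [D]. The preimage of an interval is therefore written as [D]
    intersected with the open set [W] of points so close to some y in [D] that the Lipschitz bound
    at [y] forces the value into the interval. *)
Lemma lipschitz_on_measurable k (D : set 'rV[R]_k) (f : 'rV[R]_k -> R) K :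
  closed D -> 0 <= K ->
  (forall x y, D x -> D y -> `|f x - f y| <= K * enorm (x - y)) ->
  measurable_fun (D : set (borel R k)) (f : borel R k -> R).
Proof.
move=> cD K0 fK; apply: (measurability _ (RGenOpens.measurableE R)).
move=> _ [_ [a [b ->] <-]].
pose W := [set x | exists y, [/\ D y, a + K * enorm (x - y) < f y &
  f y + K * enorm (x - y) < b]].
have -> : D `&` f @^-1` `]a, b[%classic = D `&` W.
  apply/seteqP; split=> x [Dx /=].
    rewrite in_itv/= => /andP[h1 h2]; split => //; exists x.
    by rewrite subrr enorm0 mulr0 !addr0.
  move=> [y [Dy h1 h2]]; split => //=.
  by have := fK _ _ Dx Dy; rewrite in_itv/= ler_norml; lra.
apply: measurableI; first exact: closed_borel_measurable.
apply: open_borel_measurable; rewrite openE => x [y [Dy h1 h2]].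
pose e := Num.min (f y - a - K * enorm (x - y)) (b - f y - K * enorm (x - y)).
have e0 : 0 < e by rewrite lt_min; apply/andP; split; lra.
have e1 : 0 < e / (K + 1) by rewrite divr_gt0// ltr_wpDl.
have := near_enorm x e1; apply: filterS => x' xx'; exists y.
have h3 : K * enorm (x' - x) < e.
  move: xx'; rewrite ltr_pdivlMr ?ltr_wpDl//; apply: le_lt_trans.
  by rewrite mulrC ler_wpM2l ?enorm_ge0// lerDl.
have h4 : K * enorm (x' - y) <= K * enorm (x' - x) + K * enorm (x - y).
  by rewrite -mulrDr ler_wpM2l// (le_trans _ (enormD _ _))// subrKA.
have : e <= f y - a - K * enorm (x - y) by rewrite ge_min lexx.
have : e <= b - f y - K * enorm (x - y) by rewrite ge_min lexx orbT.
by move=> h5 h6; split => //; lra.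
Qed.

Lemma is_derive_translate (f : R -> R) (a s df : R) :
  is_derive (a + s) 1 f df -> is_derive s 1 (fun t => f (a + t)) df.
Proof.
have E t : a + t *: 1 = a + t by rewrite [t *: 1]mulr1.
rewrite -E => h; have dh : derivable f (a + s *: 1) 1 by [].
have := is_derive_line dh; rewrite derive_val.
by under eq_fun do rewrite E.
Qed.

(** Each of the N + 1 subintervals has a second-order error M / 2 (N + 1)^-2 by [taylor1], so the
    errors add up to order 1 / (N + 1). *)
Lemma riemann_sum_ge (f g h : R -> R) (M : R) N :
  (forall x : R, 0 <= x <= 1 -> is_derive x 1 f (g x)) ->
  (forall x : R, 0 <= x <= 1 -> is_derive x 1 g (h x)) ->
  (forall x : R, 0 <= x <= 1 -> `|h x| <= M) ->
  `|f 1 - f 0| <= N.+1%:R^-1 * (\sum_(k < N.+1) `|g (k%:R / N.+1%:R)|)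
                  + M / 2 * N.+1%:R^-1.
Proof.
move=> fg gh hM; set c : R := N.+1%:R^-1.
have c0 : 0 < c by rewrite invr_gt0.
have Nc : N.+1%:R * c = 1 by rewrite divff.
have sub k x : (k < N.+1)%N -> 0 <= x <= c -> 0 <= k%:R * c + x <= 1.
  move=> kN /andP[x0 xc]; rewrite addr_ge0 ?mulr_ge0// ?(ltW c0)//=.
  have : (k%:R + 1) * c <= N.+1%:R * c.
    by rewrite ler_wpM2r ?(ltW c0)// natr1 ler_nat.
  by rewrite Nc mulrDl mul1r; lra.
have step k : (k < N.+1)%N -> `|f (k.+1%:R * c) - f (k%:R * c)| <=
    c * `|g (k%:R * c)| + M / 2 * c ^+ 2.
  move=> kN.
  have -> : k.+1%:R * c = k%:R * c + c by rewrite -natr1 mulrDl mul1r.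
  have T1 := @taylor1 R (fun x => f (k%:R * c + x)) (fun x => g (k%:R * c + x))
    (fun x => h (k%:R * c + x)) M c (ltW c0).
  have T2 := @taylor1 R (- (fun x => f (k%:R * c + x))) (- (fun x => g (k%:R * c + x)))
    (fun x => - h (k%:R * c + x)) M c (ltW c0).
  have {T1} := T1 (fun x xc => is_derive_translate (fg _ (sub _ _ kN xc)))
     (fun x xc => is_derive_translate (gh _ (sub _ _ kN xc))).
  have {T2} := T2 (fun x xc => is_deriveN (is_derive_translate (fg _ (sub _ _ kN xc))))
     (fun x xc => is_deriveN (is_derive_translate (gh _ (sub _ _ kN xc)))).
  have hM1 x : 0 <= x <= c -> h (k%:R * c + x) <= M.
    by move=> /(sub _ _ kN)/hM; rewrite ler_norml => /andP[].
  have hM2 x : 0 <= x <= c -> - h (k%:R * c + x) <= M.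
    by move=> /(sub _ _ kN)/hM; rewrite ler_norml => /andP[]; lra.
  move=> /(_ hM2); rewrite addr0 -![(- _) _]/(- (_)) => T2 /(_ hM1) T1.
  rewrite addr0 in T2.
  have : c * g (k%:R * c) <= c * `|g (k%:R * c)|.
    by rewrite ler_wpM2l ?(ltW c0)// ler_norm.
  have : c * - g (k%:R * c) <= c * `|g (k%:R * c)|.
    by rewrite ler_wpM2l ?(ltW c0)// -normrN ler_norm.
  rewrite ler_norml => h1 h2; apply/andP; split; lra.
have -> : f 1 - f 0 = \sum_(k < N.+1) (f (k.+1%:R * c) - f (k%:R * c)).
  rewrite -(big_mkord xpredT (fun k => f (k.+1%:R * c) - f (k%:R * c))).
  by rewrite telescope_sumr// Nc mul0r.
rewrite (le_trans (ler_norm_sum _ _ _))//.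
apply: le_trans; first by apply: ler_sum => k _; exact: step.
rewrite big_split/= -mulr_sumr sumr_const card_ord -[X in _ + X]mulr_natl.
rewrite lerD2l (_ : _ * _ = M / 2 * c * (N.+1%:R * c)); last by ring.
by rewrite Nc mulr1.
Qed.

Lemma continuous_bounded01 (f : R -> R) :
  (forall x : R, 0 <= x <= 1 -> {for x, continuous f}) ->
  exists M, forall x : R, 0 <= x <= 1 -> `|f x| <= M.
Proof.
move=> cf.
have [||t _ tP] := @EVT_max R (fun x => `|f x|) 0 1.
- by [].
- apply: continuous_in_subspaceT => x; rewrite inE/= in_itv/= => x01.
  by apply: continuous_comp; [exact: cf|exact: norm_continuous].
by exists (`|f t|) => x x01; apply: tP; rewrite in_itv.
Qed.

End Tools.

(** * Square-integrable functions *)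

Section L2.
Context {R : realType}.

(** The optimal weight is l = b / a; shifting both by a small [t] keeps it defined and positive when
    [a] or [b] vanishes. *)
Lemma le_mul_amgm (x a b : R) : 0 <= a -> 0 <= b ->
  (forall l, 0 < l -> x <= l / 2 * a ^+ 2 + (2 * l)^-1 * b ^+ 2) -> x <= a * b.
Proof.
move=> a0 b0 xl; apply/ler_addgt0Pr => e e0.
pose t := Num.min 1 (e / (a + b + 1)).
have s0 : 0 < a + b + 1 by lra.
have t0 : 0 < t by rewrite lt_min ltr01 divr_gt0.
have t1 : t <= 1 by rewrite ge_min lexx.
have te : t * (a + b + 1) <= e.
  by rewrite -ler_pdivlMr// ge_min lexx orbT.
have at0 : 0 < a + t by lra.
have bt0 : 0 < b + t by lra.
apply: le_trans (xl ((b + t) / (a + t)) (divr_gt0 bt0 at0)) _.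
apply: (@le_trans _ _ ((a + t) * (b + t))).
  apply: (@le_trans _ _ ((b + t) / (a + t) / 2 * (a + t) ^+ 2 +
      (2 * ((b + t) / (a + t)))^-1 * (b + t) ^+ 2)).
    apply: lerD.
      rewrite ler_wpM2l ?divr_ge0 ?(ltW at0) ?(ltW bt0)//.
      by rewrite ler_pXn2r ?nnegrE// ?(ltW at0)// lerDl ltW.
    rewrite ler_wpM2l ?invr_ge0 ?mulr_ge0 ?invr_ge0 ?(ltW at0) ?(ltW bt0)//.
    by rewrite ler_pXn2r ?nnegrE// ?(ltW bt0)// lerDl ltW.
  by rewrite le_eqVlt; apply/orP; left; apply/eqP; field; rewrite ?gt_eqF.
nra.
Qed.

Context {dT} {T : measurableType dT} (P : probability T R) (D : set T).
Hypothesis mD : measurable D.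
Implicit Types f g : T -> R.

Definition L2 f := measurable_fun D f /\
  (\int[P]_(z in D) (f z ^+ 2)%:E < +oo)%E.

Lemma le_L2 f g : measurable_fun D f -> L2 g ->
  (forall z, D z -> `|f z| <= `|g z|) -> L2 f.
Proof.
move=> mf [mg g2] fg; split => //; apply: le_lt_trans g2.
apply: ge0_le_integral => //.
- by move=> z _; rewrite lee_fin sqr_ge0.
- exact/measurable_EFinP/measurable_funX.
- exact/measurable_EFinP/measurable_funX.
- move=> z Dz; rewrite lee_fin -(real_normK (num_real (f z))).
  by rewrite -(real_normK (num_real (g z))) lerXn2r ?nnegrE ?fg.
Qed.

Lemma L2_cst r : L2 (fun=> r).
Proof.
split; first exact: measurable_cst.
rewrite integral_cst//; apply: (@le_lt_trans _ _ ((r ^+ 2)%:E * 1)%E).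
  by rewrite lee_wpmul2l ?probability_le1// lee_fin sqr_ge0.
by rewrite mule1 ltry.
Qed.

Lemma L2_integrable_sqr f : L2 f -> P.-integrable D (fun z => (f z ^+ 2)%:E).
Proof.
move=> [mf f2]; apply/integrableP; split.
  exact/measurable_EFinP/measurable_funX.
by under eq_integral do rewrite gee0_abs ?lee_fin ?sqr_ge0//.
Qed.

Lemma L2_integrableM f g : L2 f -> L2 g -> P.-integrable D (fun z => (f z * g z)%:E).
Proof.
move=> f2 g2; have [[mf _] [mg _]] := (f2, g2).
apply: (le_integrable mD _ _ (integrableD mD (L2_integrable_sqr f2) (L2_integrable_sqr g2))).
  exact/measurable_EFinP/measurable_funM.
move=> z _; rewrite /= lee_fin normrM [leRHS]ger0_norm ?addr_ge0 ?sqr_ge0//.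
have := sqr_ge0 (`|f z| - `|g z|); rewrite sqrrB !real_normK ?num_real//.
have := mulr_ge0 (normr_ge0 (f z)) (normr_ge0 (g z)); lra.
Qed.

Lemma L2_integrable f : L2 f -> P.-integrable D (fun z => (f z)%:E).
Proof.
move=> f2; have := L2_integrableM f2 (L2_cst 1).
by under eq_fun do rewrite mulr1.
Qed.

Lemma L2Z r f : L2 f -> L2 (fun z => r * f z).
Proof.
move=> f2; have [mf _] := f2; split; first exact: measurable_funM.
under eq_integral do rewrite exprMn EFinM.
have := integrable_lty mD (integrableZl mD (r ^+ 2) (L2_integrable_sqr f2)).
by [].
Qed.

Lemma L2D f g : L2 f -> L2 g -> L2 (fun z => f z + g z).
Proof.
move=> f2 g2; have [[mf _] [mg _]] := (f2, g2).
split; first exact: measurable_funD.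
have := integrable_lty mD (integrableD mD (integrableD mD
  (L2_integrable_sqr f2) (L2_integrable_sqr g2))
  (integrableD mD (L2_integrableM f2 g2) (L2_integrableM f2 g2))).
by congr (_ < _)%E; apply: eq_integral => z _ /=; rewrite -!EFinD; congr EFin; ring.
Qed.

Lemma L2B f g : L2 f -> L2 g -> L2 (fun z => f z - g z).
Proof.
move=> f2 g2; have := L2D f2 (L2Z (-1) g2).
by under eq_fun do rewrite mulN1r.
Qed.

(** The pointwise bound |f g| <= l f^2 / 2 + g^2 / (2 l) is integrated, and [le_mul_amgm] optimises
    [l]. *)
Lemma L2_CauchySchwarz f g : L2 f -> L2 g ->
  `|\int[P]_(z in D) (f z * g z)| <=
  Num.sqrt (\int[P]_(z in D) (f z ^+ 2)) * Num.sqrt (\int[P]_(z in D) (g z ^+ 2)).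
Proof.
move=> f2 g2; have ifg := L2_integrableM f2 g2.
apply: (le_trans (le_normr_Rintegral mD ifg)).
apply: le_mul_amgm => [||l l0]; rewrite ?sqrtr_ge0// !sqr_sqrtr; last 2 first.
  by apply: Rintegral_ge0 => z _; rewrite sqr_ge0.
  by apply: Rintegral_ge0 => z _; rewrite sqr_ge0.
have h1 := L2_integrable_sqr f2; have h2 := L2_integrable_sqr g2.
rewrite -!RintegralZl//.
have h1' : P.-integrable D (fun z => (l / 2 * f z ^+ 2)%:E) := integrableZl mD (l / 2) h1.
have h2' : P.-integrable D (fun z => ((2 * l)^-1 * g z ^+ 2)%:E) :=
  integrableZl mD (2 * l)^-1 h2.
rewrite -RintegralD//; apply: le_Rintegral => //.
- exact: (integrable_norm ifg).
- exact: (integrableD mD h1' h2').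
move=> z _; rewrite normrM.
have ll : 0 < (2 * l)^-1 by rewrite invr_gt0 mulr_gt0.
have := mulr_ge0 (ltW ll) (sqr_ge0 (l * `|f z| - `|g z|)).
rewrite sqrrB exprMn !real_normK ?num_real//.
rewrite (_ : (2 * l)^-1 * _ = l / 2 * f z ^+ 2 + (2 * l)^-1 * g z ^+ 2 - `|f z| * `|g z|).
  by lra.
by field; rewrite gt_eqF.
Qed.

End L2.

(** * Integrability of the loss and the score *)

Section Loss.
Context {R : realType} {n m d : nat} (pb : problem R n m d).
Context (delta sigma : R) (bmin : nat).
Hypotheses (HA : assumptionA pb delta sigma bmin).

Let F (zt : 'rV[R]_d * 'rV[R]_n) := loss pb zt.1 zt.2.

Let F_differentiable x : differentiable F x.
Proof. by have [/(_ x) h _] := A_loss_C2 HA; exact: h. Qed.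

Let DF_differentiable v x : differentiable ('D_v F) x.
Proof. by have [_ /(_ v)[/(_ x) h _]] := A_loss_C2 HA; exact: h. Qed.

(** The difference quotients coincide. Joint regularity of [F] thus yields differentiability in the
    parameter as well as continuity, hence measurability, in the data. *)
Let derive_lossE z th v : 'D_v (loss pb z) th = 'D_(0, v) F (z, th).
Proof.
have E : (fun h : R => h^-1 *: ((loss pb z \o shift th) (h *: v) - loss pb z th)) =
  (fun h => h^-1 *: ((F \o shift (z, th)) (h *: (0, v)) - F (z, th))).
  by apply/funext => h; rewrite /F /shift/= scaler0 add0r.
by rewrite /derive E.
Qed.

Let pair_differentiable z (th : 'rV[R]_n) :
  differentiable (fun t : 'rV[R]_n => (z, t) : 'rV[R]_d * 'rV[R]_n) th.
Proof. by apply: differentiable_pair. Qed.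

Let pair_differentiable2 (z : 'rV[R]_d) (th : 'rV[R]_n) :
  differentiable (fun z : 'rV[R]_d => (z, th) : 'rV[R]_d * 'rV[R]_n) z.
Proof. by apply: differentiable_pair. Qed.

Lemma loss_differentiable z th : differentiable (loss pb z) th.
Proof.
exact: (differentiable_comp (g := F) (pair_differentiable z th) (F_differentiable _)).
Qed.

Lemma Dloss_differentiable z v th : differentiable ('D_v (loss pb z)) th.
Proof.
have -> : 'D_v (loss pb z) = 'D_(0, v) F \o (fun t => (z, t)).
  by apply/funext => t; rewrite derive_lossE.
exact: (differentiable_comp (pair_differentiable z th) (DF_differentiable _ _)).
Qed.

Lemma measurable_loss th : measurable_fun setT (fun z : borel R d => loss pb z th).
Proof.
apply: continuous_borel_measurable => z.
apply: (@continuous_comp _ _ _ (fun z : 'rV[R]_d => (z, th)) F).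
  exact/differentiable_continuous/pair_differentiable2.
exact/differentiable_continuous/F_differentiable.
Qed.

Lemma measurable_Dloss v th :
  measurable_fun setT (fun z : borel R d => 'D_v (loss pb z) th).
Proof.
apply: continuous_borel_measurable => z.
under eq_fun do rewrite derive_lossE.
apply: (@continuous_comp _ _ _ (fun z : 'rV[R]_d => (z, th)) ('D_(0, v) F)).
  exact/differentiable_continuous/pair_differentiable2.
exact/differentiable_continuous/DF_differentiable.
Qed.

Lemma measurable_grad_loss th v :
  measurable_fun setT (fun z : borel R d => dot (grad_loss pb z th) v).
Proof.
have := measurable_Dloss v th; congr measurable_fun; apply/funext => z.
by rewrite derive_dot_grad//; exact: loss_differentiable.
Qed.

Lemma measurable_enorm_rV k dT (T : measurableType dT) (D : set T)
    (f : T -> 'rV[R]_k) :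
  (forall i, measurable_fun D (fun z => f z 0 i)) ->
  measurable_fun D (fun z => enorm (f z)).
Proof.
move=> mf; apply: (@measurableT_comp _ _ _ _ _ _ (@Num.sqrt R)) => //.
  apply: continuous_measurable_fun; exact: sqrt_continuous.
by apply: measurable_sum => i; apply: measurable_funX.
Qed.

Lemma derive2_loss_le z th v :
  `|'D_v ('D_v (loss pb z)) th| <= opnorm (hessian (loss pb z) th) * enorm v ^+ 2.
Proof.
have -> : 'D_v ('D_v (loss pb z)) th = dot v (v *m (hessian (loss pb z) th)^T).
  rewrite derive2_row_sum; last 2 first.
  - exact: loss_differentiable.
  - by move=> w; exact: Dloss_differentiable.
  apply: eq_bigr => i _; rewrite !mxE mulr_sumr; apply: eq_bigr => j _.
  by rewrite !mxE [RHS]mulrA.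
apply: (le_trans (normr_dot_le _ _)); rewrite expr2 mulrA [leLHS]mulrC.
by rewrite ler_wpM2r ?enorm_ge0// enorm_mulmx_opnorm.
Qed.

Lemma loss_taylor z (th v : 'rV[R]_n) (h H : R) : 0 <= h ->
  (forall t : R, 0 <= t <= h -> opnorm (hessian (loss pb z) (th + t *: v)) <= H) ->
  `|loss pb z (th + h *: v) - loss pb z th - h * dot (grad_loss pb z th) v|
    <= H * enorm v ^+ 2 * h ^+ 2 / 2.
Proof.
move=> h0 hH; rewrite -derive_dot_grad; last exact: loss_differentiable.
pose f1 (t : R) : R := 'D_v (loss pb z) (th + t *: v).
pose f2 (t : R) : R := 'D_v ('D_v (loss pb z)) (th + t *: v).
have d1 (t : R) : is_derive t 1 (fun t : R => loss pb z (th + t *: v)) (f1 t).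
  by apply: is_derive_line; apply: diff_derivable; exact: loss_differentiable.
have d2 (t : R) : is_derive t 1 f1 (f2 t).
  by apply: is_derive_line; apply: diff_derivable; exact: Dloss_differentiable.
have f2H (t : R) : 0 <= t <= h -> `|f2 t| <= H * enorm v ^+ 2.
  move=> th0; apply: le_trans (derive2_loss_le _ _ _) _.
  by rewrite ler_wpM2r ?sqr_ge0// hH.
have T1 := @taylor1 R (fun t => loss pb z (th + t *: v)) f1 f2 _ h h0
  (fun x _ => d1 x) (fun x _ => d2 x) (fun x xh => le_trans (ler_norm _) (f2H x xh)).
have T2 := @taylor1 R (- (fun t => loss pb z (th + t *: v))) (- f1)
  (fun t => - f2 t) (H * enorm v ^+ 2) h h0
  (fun x _ => is_deriveN (d1 x)) (fun x _ => is_deriveN (d2 x)).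
have {}T2 := T2 (fun x xh =>
  le_trans (ler_norm _) (eq_ind_r (fun y => y <= _) (f2H x xh) (normrN _))).
move: T1 T2; rewrite -![(- _) _]/(- (_)) /f1 scale0r addr0 => T1 T2.
by rewrite ler_norml; apply/andP; split; lra.
Qed.

End Loss.

(** * The density, the score and moment bounds *)

Section Score.
Context {R : realType} {n m d : nat} (pb : problem R n m d).
Context (delta sigma : R) (bmin : nat).
Hypotheses (HA : assumptionA pb delta sigma bmin).

Let mZ : measurable (Z pb) := A_Z HA.

Lemma measurable_dens b : B pb b ->
  measurable_fun (Z pb) (fun z : borel R d => dens pb z b).
Proof. by move=> /(A_dens HA)[]. Qed.

Lemma dens_ge0 z b : Z pb z -> B pb b -> 0 <= dens pb z b.
Proof. by move=> Zz /(A_dens HA)[_ + _]; exact. Qed.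

Lemma integral_dist b (f : borel R d -> \bar R) : B pb b ->
  measurable_fun (Z pb) f -> (forall z, Z pb z -> (0 <= f z)%E) ->
  (\int[dist pb b]_(z in Z pb) f z =
   \int[mu pb]_(z in Z pb) (f z * (dens pb z b)%:E))%E.
Proof.
move=> Bb mf f0; have [mp p0 E] := A_dens HA Bb.
exact: (ge0_integral_density mZ mp p0 E mf f0).
Qed.

Lemma dist_Z b : B pb b -> dist pb b (Z pb) = 1%E.
Proof.
move=> Bb; have [_ _ E] := A_dens HA Bb.
by rewrite -(probability_setT (dist pb b)) !E// setIid setTI.
Qed.

Lemma dens_differentiable z b : Z pb z -> B pb b -> differentiable (dens pb z) b.
Proof.
by move=> Zz Bb; have [U [_ BU [dU _]]] := A_dens_C2 HA Zz; exact/dU/BU.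
Qed.

Lemma measurable_Ddens b j : B pb b ->
  measurable_fun (Z pb) (fun z : borel R d => 'D_(ev R j) (dens pb z) b).
Proof.
move=> Bb; have [_ /(_ j) h _] := A_diff_p HA Bb.
by apply/measurable_EFinP; exact: measurable_int h.
Qed.

(** The chain rule where the density is positive; where it vanishes, the score is 0 by convention
    and so is the inverse of 0. *)
Lemma score_grad_dens z b : Z pb z -> B pb b ->
  score pb z b = (dens pb z b)^-1 *: grad (dens pb z) b.
Proof.
move=> Zz Bb; rewrite /score; case: ltP => [p0|p0]; last first.
  have -> : dens pb z b = 0 by apply/eqP; rewrite eq_le p0 dens_ge0.
  by rewrite invr0 scale0r.
have dp := dens_differentiable Zz Bb.
have lnp : differentiable (@ln R) (dens pb z b).
  by apply/derivable1_diffP; have := is_derive1_ln p0 => -[].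
apply/rowP => i; rewrite !mxE.
rewrite deriveE; last exact: (differentiable_comp dp lnp).
rewrite (diff_comp dp lnp)/= diff1E// derive1E.
have -> : 'D_1 (@ln R) (dens pb z b) = (dens pb z b)^-1.
  by have h := is_derive1_ln p0; rewrite derive_val.
by rewrite deriveE// [LHS]mulrC.
Qed.

Lemma measurable_score b k : B pb b ->
  measurable_fun (Z pb) (fun z : borel R d => score pb z b 0 k).
Proof.
move=> Bb.
(* The inverse is written as a power with exponent -1, a measurable function of the density; the two
   agree on nonnegative reals, 0 included. *)
apply: (@eq_measurable_fun _ _ _ _ _
  (fun z : borel R d => (dens pb z b) `^ (-1) * 'D_(ev R k) (dens pb z) b)).
  move=> z; rewrite inE => Zz; rewrite score_grad_dens// !mxE.
  by rewrite powR_inv1// dens_ge0.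
apply: measurable_funM; last exact: measurable_Ddens.
apply: (@measurableT_comp _ _ _ _ _ _ (fun x : R => x `^ (-1))) => //.
exact: measurable_dens.
Qed.

Lemma measurable_dot_score b v : B pb b ->
  measurable_fun (Z pb) (fun z : borel R d => dot (score pb z b) v).
Proof.
move=> Bb; apply: measurable_sum => i; apply: measurable_funM => //.
exact: measurable_score.
Qed.

Lemma dens_dot_score z b v : Z pb z -> B pb b -> 0 < dens pb z b ->
  dens pb z b * dot (score pb z b) v = 'D_v (dens pb z) b.
Proof.
move=> Zz Bb p0; rewrite score_grad_dens// dotZl mulVKf ?gt_eqF//.
by rewrite derive_dot_grad//; exact: dens_differentiable.
Qed.

Let measurable_enorm (D : set (borel R d)) :
  measurable_fun D (fun z : borel R d => enorm z).
Proof.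
apply: measurable_funTS; apply: continuous_borel_measurable; exact: continuous_enorm.
Qed.

Let integral_poly_le b k (K M : R) (f : borel R d -> R) : B pb b -> 0 <= K ->
  (\int[dist pb b]_(z in Z pb) (enorm z ^+ k)%:E <= M%:E)%E ->
  measurable_fun (Z pb) f -> (forall z, Z pb z -> 0 <= f z) ->
  (forall z, Z pb z -> f z <= K * (1 + enorm z ^+ k)) ->
  (\int[dist pb b]_(z in Z pb) (f z)%:E <= (K * (1 + M))%:E)%E.
Proof.
move=> Bb K0 kM mf f0 fK.
have mk : measurable_fun (Z pb) (fun z : borel R d => (1 + enorm z ^+ k)%:E).
  apply/measurable_EFinP; apply: measurable_funD => //.
  by apply: measurable_funX; exact: measurable_enorm.
apply: (@le_trans _ _ (\int[dist pb b]_(z in Z pb) (K%:E * (1 + enorm z ^+ k)%:E))%E).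
  apply: ge0_le_integral => //.
  - exact/measurable_EFinP.
  - exact: measurable_funeM.
rewrite ge0_integralZl_EFin//; last first.
  by move=> z _; rewrite lee_fin addr_ge0 ?exprn_ge0// enorm_ge0.
rewrite EFinM lee_wpmul2l// EFinD.
under eq_integral do rewrite EFinD.
rewrite ge0_integralD//.
- by rewrite integral_cst// [X in (1 * X + _)%E](dist_Z Bb) mule1; exact: leeD.
- by move=> z _; rewrite lee_fin exprn_ge0 ?enorm_ge0.
- by apply/measurable_EFinP; apply: measurable_funX; exact: measurable_enorm.
Qed.

(** Since (1 + s)^2 <= 2 (1 + s^2), squaring only doubles the exponent; [q_max] dominates the
    doubled exponents of the score, the loss and its gradient. *)
Let L2_poly b q (K M : R) (f : borel R d -> R) : B pb b -> 0 <= K ->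
  (\int[dist pb b]_(z in Z pb) (enorm z ^+ (2 * q))%:E <= M%:E)%E ->
  measurable_fun (Z pb) f -> (forall z, Z pb z -> `|f z| <= K * (1 + enorm z ^+ q)) ->
  L2 (dist pb b) (Z pb) f.
Proof.
move=> Bb K0 kM mf fK; split => //.
apply: le_lt_trans (ltry (2 * K ^+ 2 * (1 + M))).
apply: (integral_poly_le Bb _ kM) => //.
- by rewrite mulr_ge0 ?sqr_ge0.
- exact: measurable_funX.
- by move=> z _; rewrite sqr_ge0.
move=> z Zz; rewrite -(real_normK (num_real (f z))).
apply: (@le_trans _ _ ((K * (1 + enorm z ^+ q)) ^+ 2)).
  by rewrite lerXn2r ?nnegrE ?fK// mulr_ge0// addr_ge0 ?exprn_ge0 ?enorm_ge0.
rewrite exprMn [2 * K ^+ 2]mulrC -[leRHS]mulrA ler_wpM2l ?sqr_ge0// mulnC exprM.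
by have := sqr_ge0 (1 - enorm z ^+ q); rewrite sqrrB sqrrD; lra.
Qed.

Lemma score_L2 b : B pb b ->
  L2 (dist pb b) (Z pb) (fun z => enorm (score pb z b)).
Proof.
move=> Bb.
have [q1 [q2 [q3 [q4 [q5 [K1 [K2 [K3 [K4 [K5 [M]]]]]]]]]]] := A_bounds HA.
move=> [[K10 _ _ _ _] hs _] /= /(_ b (2 * q1)%N Bb).
have -> : (2 * q1 <= \max_(q <- [:: 2 * q1 + q3; q2 + q3; 2 * q3; 2 * q4; q1 + q4; q5]) q)%N.
  by rewrite !big_cons !leq_max leq_addr.
move=> /(_ isT) hM; apply: (L2_poly Bb K10 hM).
  by apply: measurable_enorm_rV => i; exact: measurable_score.
move=> z Zz; rewrite ger0_norm ?enorm_ge0//.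
have [p0|p0] := ltP 0 (dens pb z b); first by have [] := hs _ _ Zz Bb p0.
rewrite /score ltNge p0/= enorm0.
by rewrite mulr_ge0// addr_ge0 ?exprn_ge0 ?enorm_ge0.
Qed.

Lemma grad_loss_L2 b th : B pb b -> Theta pb th ->
  L2 (dist pb b) (Z pb) (fun z => enorm (grad_loss pb z th)).
Proof.
move=> Bb Tt.
have [q1 [q2 [q3 [q4 [q5 [K1 [K2 [K3 [K4 [K5 [M]]]]]]]]]]] := A_bounds HA.
move=> [[_ _ _ K40 _] _ hl] /= /(_ b (2 * q4)%N Bb).
have -> : (2 * q4 <= \max_(q <- [:: 2 * q1 + q3; q2 + q3; 2 * q3; 2 * q4; q1 + q4; q5]) q)%N.
  by rewrite !big_cons !leq_max leqnn !orbT.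
move=> /(_ isT) hM; apply: (L2_poly Bb K40 hM).
  apply: measurable_enorm_rV => i; apply: measurable_funTS.
  by have := measurable_grad_loss HA th (ev R i); under eq_fun do rewrite dot_ev.
by move=> z Zz; rewrite ger0_norm ?enorm_ge0//; have [] := hl _ _ Zz Tt.
Qed.

Lemma loss_L2 b th : B pb b -> Theta pb th ->
  L2 (dist pb b) (Z pb) (fun z => loss pb z th).
Proof.
move=> Bb Tt.
have [q1 [q2 [q3 [q4 [q5 [K1 [K2 [K3 [K4 [K5 [M]]]]]]]]]]] := A_bounds HA.
move=> [[_ _ K30 _ _] _ hl] /= /(_ b (2 * q3)%N Bb).
have -> : (2 * q3 <= \max_(q <- [:: 2 * q1 + q3; q2 + q3; 2 * q3; 2 * q4; q1 + q4; q5]) q)%N.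
  by rewrite !big_cons !leq_max leqnn !orbT.
move=> /(_ isT) hM; apply: (L2_poly Bb K30 hM).
  by apply: measurable_funTS; exact: (measurable_loss HA).
by move=> z Zz; have [] := hl _ _ Zz Tt.
Qed.

(** A measurable majorant that is uniform in the model parameter, so that the Taylor remainder of
    the loss along a whole segment can be integrated. *)
Lemma hessian_bound : exists (H : borel R d -> R) (C : R),
  [/\ 0 <= C, measurable_fun setT H, forall z, 0 <= H z,
    forall z th, Z pb z -> Theta pb th -> opnorm (hessian (loss pb z) th) <= H z &
    forall b, B pb b -> (\int[dist pb b]_(z in Z pb) (H z)%:E <= C%:E)%E].
Proof.
have [q1 [q2 [q3 [q4 [q5 [K1 [K2 [K3 [K4 [K5 [M]]]]]]]]]]] := A_bounds HA.
move=> [[_ _ _ _ K50] _ hl] /= hM.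
have H0 (z : borel R d) : 0 <= K5 * (1 + enorm z ^+ q5).
  by rewrite mulr_ge0// addr_ge0 ?exprn_ge0 ?enorm_ge0.
have mH : measurable_fun setT (fun z : borel R d => K5 * (1 + enorm z ^+ q5)).
  apply: measurable_funM => //; apply: measurable_funD => //.
  by apply: measurable_funX; exact: measurable_enorm.
exists (fun z => K5 * (1 + enorm z ^+ q5)), `|K5 * (1 + M q5)|; split => //.
  by move=> z th Zz Tt; have [] := hl _ _ Zz Tt.
move=> b Bb; apply: (@le_trans _ _ (K5 * (1 + M q5))%:E); last by rewrite lee_fin ler_norm.
apply: (integral_poly_le Bb K50) => //.
  by apply: hM => //; rewrite !big_cons !leq_max leqnn !orbT.
exact: measurable_funTS.
Qed.

End Score.

(** * Lipschitz dependence of expectations on the parameter *)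

Section TotalVariation.
Context {R : realType} {n m d : nat} (pb : problem R n m d).
Context (delta sigma : R) (bmin : nat) (c : constants R).
Hypotheses (HA : assumptionA pb delta sigma bmin) (HV : valid_constants pb c).

Let mZ : measurable (Z pb) := A_Z HA.

Lemma I_max_ge0 : 0 <= I_max c. Proof. by have [_ []] := c_ge0 HV. Qed.

Lemma integral_score_sqr_le b : B pb b ->
  (\int[dist pb b]_(z in Z pb) (enorm (score pb z b) ^+ 2)%:E <= (I_max c)%:E)%E.
Proof.
move=> Bb; have sL2 k : L2 (dist pb b) (Z pb) (fun z => score pb z b 0 k).
  apply: (le_L2 mZ _ (score_L2 HA Bb)); first exact: (measurable_score HA).
  by move=> z _; rewrite [leRHS]ger0_norm ?enorm_ge0// coord_le_enorm.
apply: le_trans (_ : (\tr (fisher pb b))%:E <= _)%E; last first.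
  by rewrite lee_fin; exact: c_fisher HV _ Bb.
rewrite /mxtrace -sumEFin; under eq_integral.
  move=> z _; rewrite enorm_sqr /dot -sumEFin; over.
rewrite ge0_integral_sum//; last 2 first.
- move=> k; apply/measurable_EFinP; apply: measurable_funM; exact: (sL2 k).1.
- by move=> k z _; rewrite lee_fin -expr2 sqr_ge0.
apply: lee_sum => k _; rewrite mxE /expect /Rintegral fineK//.
apply: integrable_fin_num => //; exact: L2_integrableM.
Qed.

Lemma integral_dot_score_sqr_le b v : B pb b ->
  (\int[dist pb b]_(z in Z pb) (dot (score pb z b) v ^+ 2)%:E
    <= (I_max c * enorm v ^+ 2)%:E)%E.
Proof.
move=> Bb; have [ms _] := score_L2 HA Bb.
apply: (@le_trans _ _ (\int[dist pb b]_(z in Z pb)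
   ((enorm v ^+ 2)%:E * (enorm (score pb z b) ^+ 2)%:E))%E).
  apply: ge0_le_integral => //.
  - by move=> z _; rewrite lee_fin sqr_ge0.
  - by apply/measurable_EFinP/measurable_funX; exact: (measurable_dot_score HA).
  - by apply: measurable_funeM; apply/measurable_EFinP/measurable_funX.
  move=> z Zz; rewrite -EFinM lee_fin mulrC -exprMn.
  rewrite -(real_normK (num_real (dot _ _))) lerXn2r ?nnegrE ?normr_dot_le//.
  by rewrite mulr_ge0 ?enorm_ge0.
rewrite ge0_integralZl_EFin ?sqr_ge0//; last 2 first.
- by move=> z _; rewrite lee_fin sqr_ge0.
- by apply/measurable_EFinP/measurable_funX.
rewrite (mulrC (I_max c)) [leRHS]EFinM lee_wpmul2l ?lee_fin ?sqr_ge0//.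
exact: integral_score_sqr_le.
Qed.

Lemma dot_score_L2 b v : B pb b ->
  L2 (dist pb b) (Z pb) (fun z => dot (score pb z b) v).
Proof.
move=> Bb; split; first exact: (measurable_dot_score HA).
by apply: le_lt_trans (integral_dot_score_sqr_le v Bb) _; rewrite ltry.
Qed.

(** A weighted sum rather than a product of square roots: such a bound survives for extended-real
    integrals, averages over nodes and lower limits. The weight [l] is optimised at the end, in
    [TV_le]. *)
Let integral_mul_score_le (f : borel R d -> R) (a l : R) b v : B pb b ->
  measurable_fun (Z pb) f -> 0 < l ->
  (\int[dist pb b]_(z in Z pb) (f z ^+ 2)%:E <= (a ^+ 2)%:E)%E ->
  (\int[dist pb b]_(z in Z pb) (`|f z| * `|dot (score pb z b) v|)%:E <=
    (l / 2 * a ^+ 2 + (2 * l)^-1 * (I_max c * enorm v ^+ 2))%:E)%E.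
Proof.
move=> Bb mf l0 fa; have ms := measurable_dot_score HA v Bb.
have l1 : 0 <= l / 2 by rewrite divr_ge0// ltW.
have l2 : 0 <= (2 * l)^-1 by rewrite invr_ge0 mulr_ge0// ltW.
apply: (@le_trans _ _ (\int[dist pb b]_(z in Z pb) ((l / 2)%:E * (f z ^+ 2)%:E +
   ((2 * l)^-1)%:E * (dot (score pb z b) v ^+ 2)%:E))%E).
  apply: ge0_le_integral => //.
  - by apply/measurable_EFinP/measurable_funM; exact: measurableT_comp.
  - apply: emeasurable_funD; apply: measurable_funeM;
      by apply/measurable_EFinP/measurable_funX.
  move=> z _; rewrite -!EFinM -EFinD lee_fin.
  rewrite -(real_normK (num_real (dot _ _))) -(real_normK (num_real (f z))).
  set x := `|f z|; set y := `|dot _ _|.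
  have := mulr_ge0 l2 (sqr_ge0 (l * x - y)).
  rewrite (_ : (2 * l)^-1 * _ = l / 2 * x ^+ 2 + (2 * l)^-1 * y ^+ 2 - x * y).
    by lra.
  by field; rewrite gt_eqF.
rewrite ge0_integralD//; last 4 first.
- by move=> z _; rewrite -EFinM lee_fin mulr_ge0 ?sqr_ge0.
- by apply: measurable_funeM; apply/measurable_EFinP/measurable_funX.
- by move=> z _; rewrite -EFinM lee_fin mulr_ge0 ?sqr_ge0.
- by apply: measurable_funeM; apply/measurable_EFinP/measurable_funX.
rewrite !ge0_integralZl_EFin//; last 4 first.
- by move=> z _; rewrite lee_fin sqr_ge0.
- by apply/measurable_EFinP/measurable_funX.
- by move=> z _; rewrite lee_fin sqr_ge0.
- by apply/measurable_EFinP/measurable_funX.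
rewrite EFinD [(l / 2 * _)%:E]EFinM [((2 * l)^-1 * _)%:E]EFinM; apply: leeD.
  by rewrite lee_wpmul2l.
by rewrite lee_wpmul2l//; exact: integral_dot_score_sqr_le.
Qed.

(** Common support keeps the density positive along the segment, so its derivative there is score
    times density. [M] bounds the second derivative on the segment and depends on [z]. *)
Let dens_riemann z b0 b1 : Z pb z -> B pb b0 -> B pb b1 -> 0 < dens pb z b0 ->
  exists M, forall N,
    `|dens pb z b1 - dens pb z b0| <=
    N.+1%:R^-1 * (\sum_(k < N.+1) let b := b0 + (k%:R / N.+1%:R) *: (b1 - b0) in
        `|dot (score pb z b) (b1 - b0)| * dens pb z b)
      + M / 2 * N.+1%:R^-1.
Proof.
move=> Zz B0 B1 p0; set v := b1 - b0.
have [U [_ BU [dU dU2]]] := A_dens_C2 HA Zz.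
have [d2U cU2] := dU2 v; have {}cU2 := cU2 v.
have Bt (t : R) : 0 <= t <= 1 -> B pb (b0 + t *: v) by move=> t01; exact: (B_segment HA).
pose f (t : R) : R := dens pb z (b0 + t *: v).
pose g (t : R) : R := 'D_v (dens pb z) (b0 + t *: v).
pose h (t : R) : R := 'D_v ('D_v (dens pb z)) (b0 + t *: v).
have fg (t : R) : 0 <= t <= 1 -> is_derive t 1 f (g t).
  move=> t01; apply: is_derive_line; apply: diff_derivable; exact/dU/BU/Bt.
have gh (t : R) : 0 <= t <= 1 -> is_derive t 1 g (h t).
  move=> t01; apply: is_derive_line; apply: diff_derivable; exact/d2U/BU/Bt.
have lc (t : R) : {for t, continuous (fun t : R => b0 + t *: v)}.
  apply/differentiable_continuous/derivable1_diffP.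
  by have := @is_derive_line R _ _ id b0 v t (@derivable_id _ _ _ _) => -[].
have [t t01|M hM] := @continuous_bounded01 R h.
  apply: (@continuous_comp _ _ _ (fun t : R => b0 + t *: v) ('D_v ('D_v (dens pb z)))).
    exact: lc.
  exact/cU2/BU/Bt.
exists M => N; have := riemann_sum_ge N fg gh hM.
rewrite /f scale1r scale0r addr0 [b0 + v]addrC subrK => /le_trans; apply.
rewrite lerD2r ler_wpM2l ?invr_ge0//; apply: ler_sum => k _.
have k01 : 0 <= (k%:R / N.+1%:R : R) <= 1.
  by rewrite divr_ge0//= ler_pdivrMr// mul1r ler_nat ltnW.
have pk := A_support HA Zz B0 (Bt _ k01) p0.
rewrite /= -/v /g -(dens_dot_score HA v Zz (Bt _ k01) pk).
by rewrite normrM (gtr0_norm pk) mulrC.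
Qed.

(** Each node of the Riemann sum integrates under [mu] to an expectation under the law at that node,
    and all these share the bound [A]; so does their average [g N], and Fatou's lemma passes to the
    limit. *)
Let TV_amgm (f : borel R d -> R) (a l : R) b0 b1 : B pb b0 -> B pb b1 ->
  measurable_fun (Z pb) f -> 0 < l ->
  (forall b, B pb b ->
    (\int[dist pb b]_(z in Z pb) (f z ^+ 2)%:E <= (a ^+ 2)%:E)%E) ->
  (\int[mu pb]_(z in Z pb) (`|f z| * `|dens pb z b1 - dens pb z b0|)%:E <=
    (l / 2 * a ^+ 2 + (2 * l)^-1 * (I_max c * enorm (b1 - b0) ^+ 2))%:E)%E.
Proof.
move=> B0 B1 mf l0 fa; set v := b1 - b0; set A := (_ + _)%R.
pose bk N k := b0 + (k%:R / N.+1%:R) *: v.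
have Bk N (k : 'I_N.+1) : B pb (bk N k).
  apply: (B_segment HA) => //.
  by rewrite divr_ge0//= ler_pdivrMr// mul1r ler_nat ltnW.
pose h N (k : 'I_N.+1) z : \bar R := (`|f z| * `|dot (score pb z (bk N k)) v|)%:E.
pose g N z : \bar R :=
  ((N.+1%:R^-1)%:E * \sum_(k < N.+1) (h N k z * (dens pb z (bk N k))%:E))%E.
have h0 N k z : (0 <= h N k z)%E by rewrite lee_fin mulr_ge0.
have hp0 N (k : 'I_N.+1) z : Z pb z -> (0 <= h N k z * (dens pb z (bk N k))%:E)%E.
  by move=> Zz; rewrite mule_ge0// lee_fin (dens_ge0 HA Zz).
have g0 N z : Z pb z -> (0 <= g N z)%E.
  by move=> Zz; apply: mule_ge0; rewrite ?lee_fin// sume_ge0// => k _; exact: hp0.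
have mh N k : measurable_fun (Z pb) (h N k).
  apply/measurable_EFinP/measurable_funM; apply: measurableT_comp => //.
  exact: (measurable_dot_score HA v (Bk N k)).
have mhp N k : measurable_fun (Z pb) (fun z => (h N k z * (dens pb z (bk N k))%:E)%E).
  apply: emeasurable_funM => //; apply/measurable_EFinP.
  exact: (measurable_dens HA (Bk N k)).
have mg N : measurable_fun (Z pb) (g N).
  by apply: measurable_funeM; apply: emeasurable_sum => k; exact: mhp.
have gA N : (\int[mu pb]_(z in Z pb) g N z <= A%:E)%E.
  rewrite ge0_integralZl_EFin//; last 2 first.
  - by move=> z Zz; apply: sume_ge0 => k _; exact: hp0.
  - by apply: emeasurable_sum => k; exact: mhp.
  rewrite ge0_integral_sum//; last by move=> k z Zz; exact: hp0.
  have hA (k : 'I_N.+1) :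
      (\int[mu pb]_(z in Z pb) (h N k z * (dens pb z (bk N k))%:E) <= A%:E)%E.
    rewrite -(integral_dist HA (Bk N k) (mh N k) (fun z _ => h0 N k z)).
    exact: (integral_mul_score_le v (Bk N k) mf l0 (fa _ (Bk N k))).
  apply: (@le_trans _ _ ((N.+1%:R^-1)%:E * \sum_(k < N.+1) A%:E)%E).
    by rewrite lee_wpmul2l//; apply: lee_sum.
  rewrite sumEFin -EFinM lee_fin sumr_const card_ord -[A *+ _]mulr_natl mulrA.
  by rewrite mulVf// mul1r.
apply: (@le_trans _ _ (\int[mu pb]_(z in Z pb) limn_einf (g^~ z))%E); last first.
  apply: (le_trans (fatou _ _ _ _)) => //; exact: limn_einf_le.
apply: ge0_le_integral => //.
- apply/measurable_EFinP/measurable_funM; apply: measurableT_comp => //.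
  by apply: measurable_funB; exact: (measurable_dens HA).
- rewrite /limn_einf; apply: (measurableT_comp (@oppe_measurable R setT)).
  apply: (measurable_fun_limn_esup (f := fun N z => (- g N z)%E)) => N.
  by apply: (measurableT_comp (@oppe_measurable R setT)); exact: mg.
move=> z Zz; apply: limn_einf_ge => e e0.
(* If the density vanishes at [b0], common support makes it vanish at [b1] too, and the integrand on
   the left is 0. *)
have [p0|p0] := ltP 0 (dens pb z b0); last first.
  exists 0%N => N _; apply: le_trans (g0 N z Zz).
  have p00 : dens pb z b0 = 0 by apply/eqP; rewrite eq_le p0 (dens_ge0 HA).
  have -> : dens pb z b1 = 0.
    apply/eqP; rewrite eq_le (dens_ge0 HA)// andbT leNgt; apply/negP => p1.
    by have := A_support HA Zz B1 B0 p1; rewrite p00 ltxx.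
  by rewrite p00 subrr normr0 mulr0 lee_fin; lra.
have [M HM] := dens_riemann Zz B0 B1 p0.
have fM0 : 0 < `|f z| * `|M| + 1 by rewrite ltr_wpDl// mulr_ge0.
(* From this index on, the error |f z| M / 2 / (N + 1) is at most [e]; adding 1 keeps the numerator
   positive. *)
exists (Num.truncn ((`|f z| * `|M| + 1) / e)) => N hN.
have Ne : (`|f z| * `|M| + 1) * N.+1%:R^-1 <= e.
  rewrite ler_pdivrMr// [leRHS]mulrC -ler_pdivrMr//.
  apply: (le_trans (ltW (truncnS_gt _))).
  by rewrite ler_nat ltnS.
have -> : g N z = (N.+1%:R^-1 * (\sum_(k < N.+1)
    `|f z| * (`|dot (score pb z (bk N k)) v| * dens pb z (bk N k))))%:E.
  rewrite /g EFinM; congr (_ * _)%E; rewrite -sumEFin; apply: eq_bigr => k _.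
  by rewrite /h -EFinM mulrA.
rewrite lee_fin -mulr_sumr mulrCA lerBlDr.
apply: le_trans (ler_wpM2l (normr_ge0 (f z)) (HM N)) _.
rewrite mulrDr lerD2l; apply: le_trans Ne.
rewrite mulrA ler_wpM2r ?invr_ge0//.
have := ler_norm M; have : 0 <= `|M| by [].
have := normr_ge0 (f z); move: `|f z| `|M| => x y; nra.
Qed.

Lemma TV_le (f : borel R d -> R) (a : R) b0 b1 : B pb b0 -> B pb b1 -> 0 <= a ->
  measurable_fun (Z pb) f ->
  (forall b, B pb b ->
    (\int[dist pb b]_(z in Z pb) (f z ^+ 2)%:E <= (a ^+ 2)%:E)%E) ->
  (\int[mu pb]_(z in Z pb) (`|f z| * `|dens pb z b1 - dens pb z b0|)%:E <=
    (a * (Num.sqrt (I_max c) * enorm (b1 - b0)))%:E)%E.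
Proof.
move=> B0 B1 a0 mf fa.
set X := (\int[_]_(_ in _) _)%E.
have X0 : (0 <= X)%E by apply: integral_ge0 => z _; rewrite lee_fin mulr_ge0.
have H l (l0 : 0 < l) := TV_amgm B0 B1 mf l0 fa.
have Xfin : X \is a fin_num.
  by rewrite ge0_fin_numE// (le_lt_trans (H _ ltr01))// ltry.
rewrite -(fineK Xfin) lee_fin; apply: le_mul_amgm => //.
  by rewrite mulr_ge0 ?sqrtr_ge0 ?enorm_ge0.
move=> l l0; rewrite exprMn sqr_sqrtr ?I_max_ge0//.
by rewrite -lee_fin fineK// H.
Qed.

End TotalVariation.

(** * Expectations as Lipschitz functions of the law's parameter *)

Section Expectation.
Context {R : realType} {n m d : nat} (pb : problem R n m d).
Context (delta sigma : R) (bmin : nat) (c : constants R).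
Hypotheses (HA : assumptionA pb delta sigma bmin) (HV : valid_constants pb c).

Let mZ : measurable (Z pb) := A_Z HA.

Lemma Rintegral_sum dT (T : measurableType dT) (P : {measure set T -> \bar R})
    (D : set T) (I : finType) (F : I -> T -> R) : measurable D ->
  (forall i, P.-integrable D (EFin \o F i)) ->
  \int[P]_(z in D) (\sum_i F i z) = \sum_i \int[P]_(z in D) F i z.
Proof.
move=> mD iF; rewrite /Rintegral.
under eq_integral do rewrite -sumEFin.
rewrite integral_sum// (eq_bigr (fun i => (fine (\int[P]_(z in D) (F i z)%:E))%:E)).
  by rewrite sumEFin.
by move=> i _; rewrite fineK//; exact: (integrable_fin_num mD (iF i)).
Qed.

Lemma dot_expect k b (u : borel R d -> 'rV[R]_k) v :
  (forall i, (dist pb b).-integrable (Z pb) (fun z => (u z 0 i)%:E)) ->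
  dot (\row_i expect pb b (fun z => u z 0 i)) v = expect pb b (fun z => dot (u z) v).
Proof.
move=> iu; rewrite /expect /dot Rintegral_sum//.
  apply: eq_bigr => i _; rewrite mxE (RintegralZr (f := fun z => u z 0 i))//.
  exact: iu.
move=> i; have := integrableZr mZ (v 0 i) (iu i).
by congr (_.-integrable _ _); apply/funext => z.
Qed.

Lemma integrable_mu b (g : borel R d -> R) : B pb b ->
  (dist pb b).-integrable (Z pb) (EFin \o g) ->
  (mu pb).-integrable (Z pb) (fun z => (g z * dens pb z b)%:E).
Proof.
move=> Bb /integrableP[mg g1]; apply/integrableP; split.
  apply/measurable_EFinP/measurable_funM; first exact/measurable_EFinP.
  exact: (measurable_dens HA).
rewrite (integral_dist HA Bb) in g1.
- apply: le_lt_trans g1; rewrite le_eqVlt; apply/orP; left; apply/eqP.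
  apply: eq_integral => z; rewrite inE => Zz /=.
  by rewrite normrM (ger0_norm (dens_ge0 HA Zz Bb)).
- exact: measurableT_comp.
- by move=> z _.
Qed.

Lemma expectE b (g : borel R d -> R) : B pb b -> measurable_fun (Z pb) g ->
  expect pb b g = \int[mu pb]_(z in Z pb) (g z * dens pb z b).
Proof.
move=> Bb mg; rewrite /expect /Rintegral; congr fine.
have mg' : measurable_fun (Z pb) (EFin \o g) by exact/measurable_EFinP.
rewrite integralE [RHS]integralE; congr (_ - _)%E.
  rewrite (integral_dist HA Bb)//; last exact: measurable_funepos.
  apply: eq_integral => z; rewrite inE => Zz.
  rewrite !funeposE/= -!EFin_max -EFinM; congr EFin.
  by rewrite maxr_pMl ?mul0r// (dens_ge0 HA).
rewrite (integral_dist HA Bb)//; last exact: measurable_funeneg.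
apply: eq_integral => z; rewrite inE => Zz.
rewrite !funenegE/= -!EFin_max -EFinM; congr EFin.
by rewrite maxr_pMl ?mul0r ?mulNr// (dens_ge0 HA).
Qed.

Lemma expect_lip (g : borel R d -> R) (a : R) b0 b1 : B pb b0 -> B pb b1 -> 0 <= a ->
  measurable_fun (Z pb) g ->
  (forall b, B pb b ->
    (\int[dist pb b]_(z in Z pb) (g z ^+ 2)%:E <= (a ^+ 2)%:E)%E) ->
  `|expect pb b1 g - expect pb b0 g| <=
    a * (Num.sqrt (I_max c) * enorm (b1 - b0)).
Proof.
move=> B0 B1 a0 mg ga; rewrite !expectE//.
have g2 b : B pb b -> L2 (dist pb b) (Z pb) g.
  by move=> Bb; split => //; apply: le_lt_trans (ga _ Bb) _; rewrite ltry.
have i0 := integrable_mu B0 (L2_integrable mZ (g2 _ B0)).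
have i1 := integrable_mu B1 (L2_integrable mZ (g2 _ B1)).
rewrite -RintegralB//.
have i10 : (mu pb).-integrable (Z pb)
    (EFin \o (fun z => g z * dens pb z b1 - g z * dens pb z b0)).
  exact: (integrableB mZ i1 i0).
apply: (le_trans (le_normr_Rintegral mZ i10)).
have := TV_le HA HV B0 B1 a0 mg ga; rewrite -lee_fin; apply: le_trans.
have i10n := integrable_norm i10.
rewrite /Rintegral fineK; last exact: (integrable_fin_num mZ i10n).
rewrite le_eqVlt; apply/orP; left; apply/eqP; apply: eq_integral => z _.
by rewrite /= -mulrBr normrM.
Qed.

Lemma dist_setIZ b (S : set (borel R d)) : B pb b -> measurable S ->
  fine (dist pb b S) = expect pb b \1_S.
Proof.
move=> Bb mS; rewrite /expect /Rintegral; congr fine.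
rewrite integral_indic//; have [_ _ E] := A_dens HA Bb.
rewrite [LHS]E// [RHS](E (S `&` Z pb)); last exact: measurableI.
by rewrite -setIA setIid.
Qed.

(** An indicator has second moment at most 1, so this is a total variation bound. It makes the
    conditional laws of the samples measurable along a run. *)
Lemma dist_lip (S : set (borel R d)) b0 b1 : measurable S -> B pb b0 -> B pb b1 ->
  `|fine (dist pb b1 S) - fine (dist pb b0 S)| <=
    Num.sqrt (I_max c) * enorm (b1 - b0).
Proof.
move=> mS B0 B1; rewrite !dist_setIZ// -[leRHS]mul1r; apply: expect_lip => //.
move=> b Bb; under eq_integral do rewrite indicE -natrX.
apply: (@le_trans _ _ (\int[dist pb b]_(z in Z pb) 1)%E); last first.
  by rewrite integral_cst// mul1e expr1n probability_le1.
apply: ge0_le_integral => //.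
- apply/measurable_EFinP; rewrite [X in measurable_fun _ X](_ : _ = \1_S).
    exact: measurable_indic.
  by apply/funext => z; rewrite indicE; case: (z \in S).
- by move=> z _; rewrite lee_fin; case: (z \in S).
Qed.

Lemma dot_grad_loss_L2 b th v : B pb b -> Theta pb th ->
  L2 (dist pb b) (Z pb) (fun z => dot (grad_loss pb z th) v).
Proof.
move=> Bb Tt; have h := L2Z mZ (enorm v) (grad_loss_L2 HA Bb Tt).
apply: (le_L2 mZ _ h).
  by apply: measurable_funTS; exact: (measurable_grad_loss HA).
move=> z _; rewrite [leRHS]ger0_norm ?mulr_ge0 ?enorm_ge0// mulrC.
exact: normr_dot_le.
Qed.

Lemma grad_loss_coord_L2 b th i : B pb b -> Theta pb th ->
  L2 (dist pb b) (Z pb) (fun z => grad_loss pb z th 0 i).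
Proof.
move=> Bb Tt; have := dot_grad_loss_L2 (ev R i) Bb Tt.
by under eq_fun do rewrite dot_ev.
Qed.

Lemma dot_expect_grad_loss b th v : B pb b -> Theta pb th ->
  dot (expect_grad_loss pb th b) v = expect pb b (fun z => dot (grad_loss pb z th) v).
Proof.
move=> Bb Tt; apply: (dot_expect (u := fun z => grad_loss pb z th)) => i.
exact/(L2_integrable mZ)/grad_loss_coord_L2.
Qed.

Lemma integral_dot_grad_loss_le b th v : B pb b -> Theta pb th ->
  (\int[dist pb b]_(z in Z pb) (dot (grad_loss pb z th) v ^+ 2)%:E
    <= ((L_loss_Lip c * enorm v) ^+ 2)%:E)%E.
Proof.
move=> Bb Tt; have g2 := grad_loss_L2 HA Bb Tt; have [mg _] := g2.
have [[L0 _ _ _ _] _] := c_ge0 HV.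
apply: (@le_trans _ _ (\int[dist pb b]_(z in Z pb)
   ((enorm v ^+ 2)%:E * (enorm (grad_loss pb z th) ^+ 2)%:E))%E).
  apply: ge0_le_integral => //.
  - by move=> z _; rewrite lee_fin sqr_ge0.
  - by apply/measurable_EFinP/measurable_funX; exact: (dot_grad_loss_L2 v Bb Tt).1.
  - by apply: measurable_funeM; apply/measurable_EFinP/measurable_funX.
  move=> z Zz; rewrite -EFinM lee_fin mulrC -exprMn.
  rewrite -(real_normK (num_real (dot _ _))) lerXn2r ?nnegrE ?normr_dot_le//.
  by rewrite mulr_ge0 ?enorm_ge0.
rewrite ge0_integralZl_EFin ?sqr_ge0//; last 2 first.
- by move=> z _; rewrite lee_fin sqr_ge0.
- by apply/measurable_EFinP/measurable_funX.
rewrite mulrC exprMn [leRHS]EFinM lee_wpmul2l ?lee_fin ?sqr_ge0//.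
have i2 := L2_integrable_sqr g2.
rewrite -(fineK (integrable_fin_num mZ i2)) lee_fin.
have E0 : 0 <= expect pb b (fun z => enorm (grad_loss pb z th) ^+ 2).
  by apply: Rintegral_ge0 => z _; rewrite sqr_ge0.
by rewrite -[leLHS](sqr_sqrtr E0) lerXn2r ?nnegrE ?sqrtr_ge0// (c_loss_Lip HV).
Qed.

Lemma expect_grad_loss_lip th b0 b1 : Theta pb th -> B pb b0 -> B pb b1 ->
  enorm (expect_grad_loss pb th b1 - expect_grad_loss pb th b0) <=
    L_loss_Lip c * (Num.sqrt (I_max c) * enorm (b1 - b0)).
Proof.
move=> Tt B0 B1; have [[L0 _ _ _ _] _] := c_ge0 HV.
apply: enorm_le_dual => [|v].
  by rewrite !mulr_ge0 ?sqrtr_ge0 ?enorm_ge0.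
rewrite dotBl !dot_expect_grad_loss// (le_trans (ler_norm _))//.
rewrite mulrAC; apply: expect_lip => //.
- by rewrite mulr_ge0 ?enorm_ge0.
- exact: (dot_grad_loss_L2 v B0 Tt).1.
- by move=> b Bb; exact: integral_dot_grad_loss_le.
Qed.

Lemma expect_grad_loss_sm th th' : Theta pb th -> Theta pb th' ->
  enorm (expect_grad_loss pb th (beta pb th) - expect_grad_loss pb th' (beta pb th))
    <= L_loss_sm c * enorm (th - th').
Proof.
move=> Tt Tt'; have [_ _ /(_ _ Tt) Bb] := A_B HA.
have [[_ L0 _ _ _] _] := c_ge0 HV.
apply: enorm_le_dual => [|v]; first by rewrite mulr_ge0 ?enorm_ge0.
rewrite dotBl !dot_expect_grad_loss//.
have h1 := L2_integrable mZ (dot_grad_loss_L2 v Bb Tt).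
have h2 := L2_integrable mZ (dot_grad_loss_L2 v Bb Tt').
rewrite /expect -RintegralB//.
have hD : L2 (dist pb (beta pb th)) (Z pb)
    (fun z => enorm (grad_loss pb z th - grad_loss pb z th')).
  apply: (le_L2 mZ _ (L2D mZ (grad_loss_L2 HA Bb Tt) (grad_loss_L2 HA Bb Tt'))).
    apply: measurable_enorm_rV => i.
    under eq_fun do rewrite mxE [X in _ + X]mxE.
    by apply: measurable_funB; [exact: (grad_loss_coord_L2 i Bb Tt).1|
      exact: (grad_loss_coord_L2 i Bb Tt').1].
  move=> z _; rewrite !ger0_norm ?addr_ge0 ?enorm_ge0//; exact: enormB.
apply: (@le_trans _ _ (\int[dist pb (beta pb th)]_(z in Z pb)
    (enorm v * enorm (grad_loss pb z th - grad_loss pb z th')))).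
  apply: le_Rintegral => //.
  - exact: (integrableB mZ h1 h2).
  - exact: (integrableZl mZ (enorm v) (L2_integrable mZ hD)).
  - by move=> z _; rewrite -dotBl mulrC dot_le_enorm.
rewrite RintegralZl//; last exact: L2_integrable.
by rewrite mulrC ler_wpM2r ?enorm_ge0//; exact: (c_loss_sm HV Tt Tt').
Qed.

End Expectation.

(** * The score in the directions of [B] *)

Section ScoreDirections.
Context {R : realType} {n m d : nat} (pb : problem R n m d).
Context (delta sigma : R) (bmin : nat) (c : constants R).
Hypotheses (HA : assumptionA pb delta sigma bmin) (HV : valid_constants pb c).

Let mZ : measurable (Z pb) := A_Z HA.

Lemma nbhs_enorm k (x : 'rV[R]_k) (P : set 'rV[R]_k) : nbhs x P ->
  exists2 r, 0 < r & forall y, enorm (y - x) < r -> P y.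
Proof.
move=> /nbhs_ballP[r /= r0 rP]; exists r => // y yx; apply: rP.
rewrite -ball_normE/=; apply: le_lt_trans yx.
by rewrite distrC norm_le_enorm.
Qed.

(** By common support the density vanishes on the whole segment from [b0] to [b]. The difference
    quotients from that side are 0, and the derivative exists, so it is 0. *)
Lemma Ddens_zero z b0 b : Z pb z -> B pb b0 -> B pb b -> dens pb z b0 = 0 ->
  'D_(b - b0) (dens pb z) b0 = 0.
Proof.
move=> Zz B0 Bb p0; set v := b - b0.
have pt t : 0 <= t <= 1 -> dens pb z (t *: v + b0) = 0.
  move=> t01; have Bt := B_segment HA B0 Bb t01.
  apply/eqP; rewrite eq_le addrC (dens_ge0 HA Zz Bt) andbT leNgt; apply/negP => pt.
  by have := A_support HA Zz Bt B0 pt; rewrite p0 ltxx.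
have dp : derivable (dens pb z) b0 v := diff_derivable (dens_differentiable HA Zz B0).
apply/eqP/negPn/negP => D0.
have e0 : 0 < `|'D_v (dens pb z) b0| / 2 by rewrite divr_gt0// normr_gt0.
move/cvgrPdist_lt : (dp) => /(_ _ e0).
rewrite -/('D_v (dens pb z) b0) => -[r /= r0 hr].
pose t := Num.min (r / 2) 1.
have t0 : 0 < t by rewrite lt_min divr_gt0//= ltr01.
have tr : t < r by rewrite gt_min ltr_pdivrMr// ltr_pMr// ltr1n.
have t1 : t <= 1 by rewrite ge_min lexx orbT.
have := hr t; rewrite /= sub0r normrN gtr0_norm// => /(_ tr).
rewrite gt_eqF// => /(_ isT); rewrite pt ?(ltW t0)// p0 subrr scaler0 subr0.
by have := normr_ge0 ('D_v (dens pb z) b0); lra.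
Qed.

Lemma dens_dot_score_dir z b0 b : Z pb z -> B pb b0 -> B pb b ->
  dot (score pb z b0) (b - b0) * dens pb z b0 = 'D_(b - b0) (dens pb z) b0.
Proof.
move=> Zz B0 Bb; have [p0|p0] := ltP 0 (dens pb z b0).
  by rewrite mulrC (dens_dot_score HA).
have p00 : dens pb z b0 = 0 by apply/eqP; rewrite eq_le p0 (dens_ge0 HA).
by rewrite p00 mulr0 Ddens_zero.
Qed.

(* [B] may have empty interior, so the derivative of the density at a zero is
   controlled only in the directions of [B - b0]. *)
Lemma dot_integral_Ddens (f : borel R d -> R) b0 b : B pb b0 -> B pb b ->
  L2 (dist pb b0) (Z pb) f ->
  (forall j, (mu pb).-integrable (Z pb)
     (fun z => (f z * 'D_(ev R j) (dens pb z) b0)%:E)) ->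
  dot (\row_j \int[mu pb]_(z in Z pb) (f z * 'D_(ev R j) (dens pb z) b0)) (b - b0) =
  expect pb b0 (fun z => f z * dot (score pb z b0) (b - b0)).
Proof.
move=> B0 Bb f2 iD; rewrite (expectE HA B0); last first.
  apply: measurable_funM; first exact: f2.1.
  exact: (measurable_dot_score HA).
transitivity (\int[mu pb]_(z in Z pb) (\sum_j
    (f z * 'D_(ev R j) (dens pb z) b0) * (b - b0) 0 j)).
  rewrite Rintegral_sum//.
    by apply: eq_bigr => j _; rewrite mxE RintegralZr//; exact: iD.
  by move=> j; exact: (integrableZr mZ ((b - b0) 0 j) (iD j)).
apply: eq_Rintegral => z; rewrite inE => Zz.
rewrite -mulrA dens_dot_score_dir//.
rewrite derive_row_sum; last exact: (dens_differentiable HA).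
rewrite mulr_sumr; apply: eq_bigr => j _.
by rewrite -mulrA; congr (_ * _); rewrite mulrC.
Qed.

Definition mean_score b0 : 'rV[R]_m := \row_k expect pb b0 (fun z => score pb z b0 0 k).

Lemma score_coord_L2 b k : B pb b ->
  L2 (dist pb b) (Z pb) (fun z => score pb z b 0 k).
Proof.
move=> Bb; have := dot_score_L2 HA HV (ev R k) Bb.
by under eq_fun do rewrite dot_ev.
Qed.

Lemma dot_mean_score b v : B pb b ->
  dot (mean_score b) v = expect pb b (fun z => dot (score pb z b) v).
Proof.
move=> Bb; apply: (dot_expect HA (u := fun z => score pb z b)) => i.
exact/(L2_integrable mZ)/score_coord_L2.
Qed.

Lemma dot_G th b v : Theta pb th -> B pb b ->
  dot (G pb th b) v = expect pb b (fun z => loss pb z th * dot (score pb z b) v).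
Proof.
move=> Tt Bb; have l2 := loss_L2 HA Bb Tt.
have -> : G pb th b =
    \row_k expect pb b (fun z => (loss pb z th *: score pb z b) 0 k).
  by apply/rowP => k; rewrite !mxE; congr expect; apply/funext => z; rewrite mxE.
rewrite (dot_expect HA (u := fun z => loss pb z th *: score pb z b)).
  by congr expect; apply/funext => z; rewrite dotZl.
move=> i; under eq_fun do rewrite mxE.
apply: (L2_integrableM mZ l2); exact: score_coord_L2.
Qed.

(** The total mass is 1 everywhere on [B], so in the expansion of the mass along b0 + t (b - b0)
    only the linear term remains; being o(t), it vanishes. *)
Lemma mean_score_dir b0 b : B pb b0 -> B pb b -> dot (mean_score b0) (b - b0) = 0.
Proof.
move=> B0 Bb; have [_ iD gD] := A_diff_p HA B0.
have := dot_integral_Ddens B0 Bb (L2_cst (dist pb b0) mZ 1).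
have iD' j : (mu pb).-integrable (Z pb) (fun z => (1 * 'D_(ev R j) (dens pb z) b0)%:E).
  by under eq_fun do rewrite mul1r.
move=> /(_ iD'); rewrite dot_mean_score//.
under [X in _ = expect _ _ X -> _]eq_fun do rewrite mul1r.
move=> <-.
have -> : (\row_j \int[mu pb]_(z in Z pb) (1 * 'D_(ev R j) (dens pb z) b0)) =
  (\row_j \int[mu pb]_(z in Z pb) ('D_(ev R j) (dens pb z) b0)) :> 'rV[R]_m.
  by apply/rowP => j; rewrite !mxE; apply: eq_Rintegral => z _; rewrite mul1r.
set g := \row_j _ in gD *; set v := b - b0.
have mass b1 : B pb b1 -> \int[mu pb]_(z in Z pb) dens pb z b1 = 1.
  move=> B1; have := expectE HA B1 (@measurable_cst _ _ _ _ (Z pb) (1:R)).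
  under [X in _ = X -> _]eq_Rintegral do rewrite mul1r.
  by move=> <-; rewrite /expect Rintegral_cst// [X in _ * fine X](dist_Z HA B1) mulr1.
have [->|v0] := eqVneq v 0; first by rewrite dot0r.
have v1 : 0 < enorm v by rewrite enorm_gt0.
apply/normr0_eq0/eqP; rewrite eq_le normr_ge0 andbT.
apply/ler_addgt0Pr => e e0; rewrite add0r.
have e1 : 0 < e / enorm v by rewrite divr_gt0.
have [r r0 hr] := nbhs_enorm (gD _ e1).
(* At most 1 to remain in [B], and small enough to remain within distance [r] of [b0]. *)
pose t := Num.min 1 (r / (2 * enorm v)).
have t0 : 0 < t by rewrite lt_min ltr01 divr_gt0// mulr_gt0.
have t1 : t <= 1 by rewrite ge_min lexx.
have tr : enorm (t *: v) < r.
  rewrite enormZ gtr0_norm//; apply: (@le_lt_trans _ _ (r / 2)).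
    rewrite -ler_pdivlMr//; apply: (@le_trans _ _ (r / (2 * enorm v))).
      by rewrite ge_min lexx orbT.
    by rewrite invfM mulrA.
  by rewrite ltr_pdivrMr// ltr_pMr// ltr1n.
have Bt : B pb (b0 + t *: v) by apply: (B_segment HA); rewrite ?(ltW t0).
have E : b0 + t *: v - b0 = t *: v by rewrite addrAC subrr add0r.
have := hr (b0 + t *: v); rewrite E => /(_ tr Bt).
rewrite !mass// subrr sub0r normrN dotZr normrM (gtr0_norm t0) enormZ.
by rewrite (gtr0_norm t0) mulrCA divfK ?gt_eqF// ler_pM2l.
Qed.

End ScoreDirections.

(** * Smoothness of the performative loss *)

Section PerfLoss.
Context {R : realType} {n m d : nat} (pb : problem R n m d).
Context (delta sigma : R) (bmin : nat) (c : constants R).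
Hypotheses (HA : assumptionA pb delta sigma bmin) (HV : valid_constants pb c).

Let mZ : measurable (Z pb) := A_Z HA.

Let beta_B th : Theta pb th -> B pb (beta pb th).
Proof. by have [_ _] := A_B HA; exact. Qed.

(** [variance] integrates over the whole space and [expect] over [Z]. Leaving the centre [r]
    abstract avoids comparing the two means: [dot_G_le] may subtract any constant. *)
Lemma loss_centered_sqr_le th b : Theta pb th -> B pb b -> exists r : R,
  (\int[dist pb b]_(z in Z pb) ((loss pb z th - r) ^+ 2)%:E <= (M_loss c)%:E)%E.
Proof.
move=> Tt Bb; exists (fine 'E_(dist pb b)[fun z : borel R d => loss pb z th]).
apply: le_trans (c_var HV Tt Bb).
rewrite /variance covariance.unlock; set r := fine _.
rewrite expectation.unlock.
apply: (@le_trans _ _ (\int[dist pb b]_z ((loss pb z th - r) ^+ 2)%:E)%E).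
  apply: ge0_subset_integral => //.
  - apply/measurable_EFinP/measurable_funX/measurable_funB => //.
    exact: (measurable_loss HA).
  - by move=> z _; rewrite lee_fin sqr_ge0.
rewrite le_eqVlt; apply/orP; left; apply/eqP; apply: eq_integral => z _.
by rewrite expr2.
Qed.

(** In a direction orthogonal to the mean score, a constant can be subtracted from the loss.
    Cauchy-Schwarz then brings in the variance of the loss instead of its second moment. *)
Lemma dot_G_le th b v : Theta pb th -> B pb b -> dot (mean_score pb b) v = 0 ->
  `|dot (G pb th b) v| <= Num.sqrt (M_loss c * I_max c) * enorm v.
Proof.
move=> Tt Bb s0; have [r Hr] := loss_centered_sqr_le Tt Bb.
have [_ [_ _ M0 I0]] := c_ge0 HV.
have l2 := loss_L2 HA Bb Tt.
have s2 := dot_score_L2 HA HV v Bb.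
have lr2 := L2B mZ l2 (L2_cst (dist pb b) mZ r).
have -> : dot (G pb th b) v =
    expect pb b (fun z => (loss pb z th - r) * dot (score pb z b) v).
  rewrite (dot_G HA HV)//.
  under [X in _ = expect _ _ X]eq_fun do rewrite mulrBl.
  have ir : (dist pb b).-integrable (Z pb) (EFin \o fun z => r * dot (score pb z b) v).
    by exact: (integrableZl mZ r (L2_integrable mZ s2)).
  rewrite /expect RintegralB//; last exact: (L2_integrableM mZ l2 s2).
  rewrite RintegralZl//; last exact: (L2_integrable mZ s2).
  have := dot_mean_score HA HV v Bb; rewrite s0 /expect => <-.
  by rewrite mulr0 subr0.
apply: (le_trans (L2_CauchySchwarz mZ lr2 s2)).
rewrite sqrtrM// -mulrA; apply: ler_pM; rewrite ?sqrtr_ge0//.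
  rewrite ler_wsqrtr// -lee_fin /Rintegral fineK//.
  exact: (integrable_fin_num mZ (L2_integrable_sqr lr2)).
rewrite -(ger0_norm (enorm_ge0 v)) -sqrtr_sqr -sqrtrM// ler_wsqrtr//.
rewrite -lee_fin /Rintegral fineK; first exact: (integral_dot_score_sqr_le HA HV).
exact: (integrable_fin_num mZ (L2_integrable_sqr s2)).
Qed.

Hypotheses (n0 : (0 < n)%N) (delta0 : 0 < delta).

Lemma mean_score_Dbeta b th v : B pb b -> Theta_delta pb delta th ->
  dot (mean_score pb b) ('D_v (beta pb) th) = 0.
Proof.
move=> Bb Tt; apply: (Dbeta_perp HA n0 delta0 v Tt) => y Ty.
have -> : beta pb y - beta pb th = (beta pb y - b) - (beta pb th - b).
  by rewrite opprB addrA subrK.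
rewrite dotBr !(mean_score_dir HA HV)// ?subrr//; apply: beta_B => //.
exact: Theta_deltaW Tt.
Qed.

Lemma dot_grad_perf th u : Theta_delta pb delta th ->
  dot (grad_perf pb th) u = dot (expect_grad_loss pb th (beta pb th)) u +
    dot (G pb th (beta pb th)) ('D_u (beta pb) th).
Proof.
move=> Tt; rewrite /grad_perf dotDl /grad2 dot_mulmx -derive_jac//.
exact: (beta_differentiable HA).
Qed.

Lemma L_perf_sm_ge0 : 0 <= L_perf_sm c.
Proof.
have [[? ? ? ? ?] [? ? ? ?]] := c_ge0 HV.
by rewrite /L_perf_sm !addr_ge0// !mulr_ge0 ?sqrtr_ge0// addr_ge0// mulr_ge0.
Qed.

Let sum_diff_le (a a' a1 b b' b1 r1 r2 r3 r4 : R) :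
  a - a' <= r1 -> a' - a1 <= r2 -> b - b' <= r3 -> b' - b1 <= r4 ->
  a + b - (a1 + b1) <= r1 + r2 + r3 + r4.
Proof. lra. Qed.

(** One ingredient moves at a time: the loss gradient, the law it is averaged under, the Jacobian,
    then [G]. The four differences produce the four terms of [L_perf_sm]. *)
Lemma grad_perf_lip th th' : Theta_delta pb delta th -> Theta_delta pb delta th' ->
  enorm (grad_perf pb th - grad_perf pb th') <= L_perf_sm c * enorm (th - th').
Proof.
move=> Tt Tt'; have [[L1 L2 L3 L4 L5] [L6 L7 L8 L9]] := c_ge0 HV.
have Th := Theta_deltaW Tt; have Th' := Theta_deltaW Tt'.
have Bt := beta_B Th; have Bt' := beta_B Th'.
apply: enorm_le_dual => [|u]; first by rewrite mulr_ge0 ?L_perf_sm_ge0 ?enorm_ge0.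
rewrite dotBl.
have E1 := dot_grad_perf u Tt.
have E2 := dot_grad_perf u Tt'.
have E := congr2 (fun x y => x - y) E1 E2.
rewrite [leLHS]E.
set D := enorm (th - th'); set U := enorm u.
have D0 : 0 <= D by exact: enorm_ge0.
have U0 : 0 <= U by exact: enorm_ge0.
have hb : enorm (beta pb th - beta pb th') <= L_beta_Lip c * D := c_beta_Lip HV Th Th'.
have hD := Dbeta_le HA HV n0 delta0 u Tt'.
have T1 : dot (expect_grad_loss pb th (beta pb th)) u -
   dot (expect_grad_loss pb th' (beta pb th)) u <= L_loss_sm c * D * U.
  rewrite -dotBl (le_trans (dot_le_enorm _ _))// ler_wpM2r//.
  exact: (expect_grad_loss_sm HA HV).
have T2 : dot (expect_grad_loss pb th' (beta pb th)) u -
   dot (expect_grad_loss pb th' (beta pb th')) u <=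
   L_loss_Lip c * (Num.sqrt (I_max c) * (L_beta_Lip c * D)) * U.
  rewrite -dotBl (le_trans (dot_le_enorm _ _))// ler_wpM2r//.
  apply: (le_trans (expect_grad_loss_lip HA HV Th' Bt' Bt)).
  by rewrite ler_wpM2l// ler_wpM2l ?sqrtr_ge0.
have T3 : dot (G pb th (beta pb th)) ('D_u (beta pb) th) -
   dot (G pb th (beta pb th)) ('D_u (beta pb) th') <=
   Num.sqrt (M_loss c * I_max c) * (L_beta_sm c * D * U).
  rewrite -dotBr (le_trans (ler_norm _))//.
  apply: (le_trans (dot_G_le Th Bt _)).
    by rewrite dotBr (mean_score_Dbeta u Bt Tt) (mean_score_Dbeta u Bt Tt') subrr.
  rewrite ler_wpM2l ?sqrtr_ge0//.
  rewrite (derive_jac u (beta_differentiable HA th)).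
  rewrite (derive_jac u (beta_differentiable HA th')).
  rewrite -mulmxBr -linearB/=.
  apply: (le_trans (enorm_mulmx_opnorm _ _)).
  by rewrite ler_wpM2r//; exact: c_beta_sm HV _ _ Th Th'.
have T4 : dot (G pb th (beta pb th)) ('D_u (beta pb) th') -
   dot (G pb th' (beta pb th')) ('D_u (beta pb) th') <=
   (L_G_beta c * (L_beta_Lip c * D) + L_G_theta c * D) * (L_beta_Lip c * U).
  rewrite -dotBl (le_trans (dot_le_enorm _ _))// ler_pM ?enorm_ge0//.
  apply: (le_trans (c_G HV Th Th' Bt Bt')).
  by rewrite lerD2r ler_wpM2l.
apply: le_trans (sum_diff_le T1 T2 T3 T4) _.
by rewrite /L_perf_sm le_eqVlt; apply/orP; left; apply/eqP; ring.
Qed.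

End PerfLoss.

(** * First-order expansion and descent inequality for the performative loss *)

Section Descent.
Context {R : realType} {n m d : nat} (pb : problem R n m d).
Context (delta sigma : R) (bmin : nat) (c : constants R).
Hypotheses (HA : assumptionA pb delta sigma bmin) (HV : valid_constants pb c).

Let mZ : measurable (Z pb) := A_Z HA.

Let beta_B th : Theta pb th -> B pb (beta pb th).
Proof. by have [_ _] := A_B HA; exact. Qed.

Lemma expect_loss_expand th b0 e : Theta pb th -> B pb b0 -> 0 < e ->
  exists2 r, 0 < r & forall b, B pb b -> enorm (b - b0) < r ->
  `|expect pb b (fun z => loss pb z th) - expect pb b0 (fun z => loss pb z th)
    - dot (G pb th b0) (b - b0)| <= e * enorm (b - b0).
Proof.
move=> Tt B0 e0; have [_ iD gD] := A_diff_lp HA Tt B0.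
have [r r0 hr] := nbhs_enorm (gD _ e0); exists r => // b Bb br.
have mloss : measurable_fun (Z pb) (fun z : borel R d => loss pb z th).
  by apply: measurable_funTS; exact: (measurable_loss HA).
rewrite !(expectE HA)//.
have DE z j : Z pb z -> 'D_(ev R j) (fun b1 => loss pb z th * dens pb z b1) b0 =
   loss pb z th * 'D_(ev R j) (dens pb z) b0.
  by move=> Zz; rewrite deriveZ//; apply/diff_derivable/(dens_differentiable HA).
have iD' j : (mu pb).-integrable (Z pb)
    (fun z => (loss pb z th * 'D_(ev R j) (dens pb z) b0)%:E).
  apply: eq_integrable (iD j) => // z; rewrite inE => Zz.
  by rewrite DE.
have := hr b br Bb; rewrite (dot_G HA HV)//.
rewrite -(dot_integral_Ddens HA B0 Bb (loss_L2 HA B0 Tt) iD').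
congr (`|_ - dot _ _| <= _).
apply/rowP => j; rewrite !mxE; apply: eq_Rintegral => z; rewrite inE => Zz.
by rewrite DE.
Qed.

(** The loss is changed first, under the law at [y]; its linear term is then moved to the law at
    [th]. Both errors are quadratic. The change of law at a fixed loss stays explicit on the right,
    since [expect_loss_expand] only makes it o(|y - th|). *)
Lemma perf_loss_expand : exists2 C, 0 <= C & forall th y, Theta pb th -> Theta pb y ->
  `|perf_loss pb y - perf_loss pb th
    - dot (expect_grad_loss pb th (beta pb th)) (y - th)
    - dot (G pb th (beta pb th)) (beta pb y - beta pb th)| <=
  C * enorm (y - th) ^+ 2 +
  `|expect pb (beta pb y) (fun z => loss pb z th)
    - expect pb (beta pb th) (fun z => loss pb z th)
    - dot (G pb th (beta pb th)) (beta pb y - beta pb th)|.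
Proof.
have [H [C [C0 mH H0 hH HC]]] := hessian_bound HA.
have [[L1 _ L3 _ _] _] := c_ge0 HV.
exists (C / 2 + L_loss_Lip c * (Num.sqrt (I_max c) * L_beta_Lip c)).
  by rewrite addr_ge0 ?mulr_ge0 ?sqrtr_ge0 ?invr_ge0.
move=> th y Tt Ty; set w := y - th.
have Bt := beta_B Tt; have By := beta_B Ty.
set b := beta pb th; set b' := beta pb y.
have ly := L2_integrable mZ (loss_L2 HA By Ty).
have lt := L2_integrable mZ (loss_L2 HA By Tt).
have lg := L2_integrable mZ (dot_grad_loss_L2 HA w By Tt).
have A1 : `|expect pb b' (fun z => loss pb z y) - expect pb b' (fun z => loss pb z th)
    - dot (expect_grad_loss pb th b') w| <= C / 2 * enorm w ^+ 2.
  have -> : dot (expect_grad_loss pb th b') w =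
     expect pb b' (fun z => dot (grad_loss pb z th) w).
    exact: (dot_expect_grad_loss HA w By Tt).
  rewrite /expect -RintegralB// -RintegralB//; last exact: (integrableB mZ ly lt).
  have i3 : (dist pb b').-integrable (Z pb) (EFin \o (fun z => loss pb z y - loss pb z th
      - dot (grad_loss pb z th) w)).
    exact: (integrableB mZ (integrableB mZ ly lt) lg).
  apply: (le_trans (le_normr_Rintegral mZ i3)).
  have iH : (dist pb b').-integrable (Z pb) (EFin \o H).
    apply/integrableP; split; first by apply/measurable_EFinP; exact: measurable_funTS.
    under eq_integral do rewrite gee0_abs ?lee_fin//.
    by apply: le_lt_trans (HC _ By) _; rewrite ltry.
  apply: (@le_trans _ _ (\int[dist pb b']_(z in Z pb) (enorm w ^+ 2 / 2 * H z))).
    apply: le_Rintegral => //.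
    - exact: (integrable_norm i3).
    - exact: (integrableZl mZ (enorm w ^+ 2 / 2) iH).
    move=> z Zz.
    have := @loss_taylor R n m d pb _ _ _ HA z th w 1 (H z) ler01.
    rewrite scale1r [th + w]addrC subrK mul1r expr1n mulr1 => h.
    apply: (le_trans (h _)) => [t t01|]; last by lra.
    by apply: hH => //; exact: (Theta_segment HA).
  rewrite RintegralZl//.
  have : \int[dist pb b']_(z in Z pb) H z <= C.
    rewrite -lee_fin /Rintegral fineK; first exact: HC.
    exact: (integrable_fin_num mZ iH).
  have := sqr_ge0 (enorm w); nra.
have A2 : `|dot (expect_grad_loss pb th b') w - dot (expect_grad_loss pb th b) w| <=
    L_loss_Lip c * (Num.sqrt (I_max c) * L_beta_Lip c) * enorm w ^+ 2.
  rewrite -dotBl (le_trans (normr_dot_le _ _))//.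
  rewrite expr2 mulrA ler_wpM2r ?enorm_ge0//.
  apply: (le_trans (expect_grad_loss_lip HA HV Tt Bt By)).
  rewrite -!mulrA ler_wpM2l// ler_wpM2l ?sqrtr_ge0//.
  exact: c_beta_Lip HV _ _ Ty Tt.
rewrite /perf_loss -/b -/b' mulrDl.
set A3 := `|expect pb b' _ - expect pb b _ - _|.
have A3r := lexx A3; rewrite {1}/A3 in A3r.
move: A1 A2 A3r.
move: (expect pb b' (fun z => loss pb z y)) (expect pb b' (fun z => loss pb z th)).
move: (expect pb b (fun z => loss pb z th)) (dot (expect_grad_loss pb th b') w).
move: (dot (expect_grad_loss pb th b) w) (dot (G pb th b) (b' - b)).
move: (C / 2 * enorm w ^+ 2) (L_loss_Lip c * _ * _) A3 => r1 r2 r3 x1 x2 x3 x4 x5 x6.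
rewrite !ler_norml; lra.
Qed.

Hypotheses (n0 : (0 < n)%N) (delta0 : 0 < delta).

(** Three errors of at most e / 3 |h| each: the quadratic remainder of [perf_loss_expand], the
    expansion in the law, and the difference quotient of [beta]. As [th] is interior to [Theta], all
    small [h] of either sign are allowed. *)
Lemma perf_loss_derive th v : Theta_delta pb delta th ->
  derivable (perf_loss pb) th v /\
  'D_v (perf_loss pb) th = dot (grad_perf pb th) v.
Proof.
move=> Tt; have Th := Theta_deltaW Tt; have Bt := beta_B Th.
suff cv : (h^-1 *: ((perf_loss pb \o shift th) (h *: v) - perf_loss pb th))
    @[h --> (0:R)^'] --> (dot (grad_perf pb th) v : R).
  split; first by apply/cvg_ex; exists (dot (grad_perf pb th) v).
  exact/cvg_lim.
have E := dot_grad_perf HA v Tt.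
have [C C0 HC] := perf_loss_expand.
have [[_ _ L3 _ _] _] := c_ge0 HV.
set D := 'D_v (beta pb) th in E; set g := G pb th (beta pb th) in E.
apply/cvgrPdist_le => e e0.
have e3 : 0 < e / 3 by rewrite divr_gt0.
set lv := L_beta_Lip c * enorm v.
have lv0 : 0 <= lv by rewrite mulr_ge0 ?enorm_ge0.
have lv1 : 0 < lv + 1 by rewrite ltr_wpDl.
have g1 : 0 < enorm g + 1 by rewrite ltr_wpDl ?enorm_ge0.
have K1 : 0 < C * enorm v ^+ 2 + 1.
  by rewrite ltr_wpDl// mulr_ge0// sqr_ge0.
have [r r0 hr] := expect_loss_expand Th Bt (divr_gt0 e3 lv1).
have Dcv : \forall h \near (0:R)^',
    enorm (h^-1 *: (beta pb (h *: v + th) - beta pb th) - D) < e / 3 / (enorm g + 1).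
  have dD : derivable (beta pb) th v by apply/diff_derivable/(beta_differentiable HA).
  exact: (dD _ (near_enorm D (divr_gt0 e3 g1))).
near=> h.
have h0 : h != 0 by near: h; exact: nbhs_dnbhs_neq.
have hp : 0 < `|h| by rewrite normr_gt0.
have Ty : Theta pb (h *: v + th) by near: h; exact: (near_Theta HA n0 delta0).
have By := beta_B Ty.
have bl : enorm (beta pb (h *: v + th) - beta pb th) <= lv * `|h|.
  apply: (le_trans (c_beta_Lip HV Ty Th)).
  by rewrite addrK enormZ mulrCA mulrC.
have h1 : C * enorm v ^+ 2 * `|h| <= e / 3.
  apply: (@le_trans _ _ ((C * enorm v ^+ 2 + 1) * `|h|)).
    by rewrite ler_wpM2r// lerDl.
  rewrite mulrC -ler_pdivlMr//; apply: ltW.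
  by near: h; apply: dnbhs0_lt; rewrite divr_gt0.
have h2 : enorm (beta pb (h *: v + th) - beta pb th) < r.
  apply: le_lt_trans bl _; apply: (@le_lt_trans _ _ ((lv + 1) * `|h|)).
    by rewrite ler_wpM2r// lerDl.
  rewrite mulrC -ltr_pdivlMr//.
  by near: h; apply: dnbhs0_lt; rewrite divr_gt0.
have h3 : enorm (h^-1 *: (beta pb (h *: v + th) - beta pb th) - D) < e / 3 / (enorm g + 1).
  by near: h.
have := HC _ _ Th Ty; rewrite addrK dotZr enormZ exprMn real_normK ?num_real// -/g.
set b' := beta pb (h *: v + th) in By bl h2 h3 *; set b := beta pb th in Bt hr bl h2 h3 *.
move=> H1; have {H1} := le_trans H1 (lerD (lexx _) (hr _ By h2)).
have H3 : `|dot g (b' - b) - h * dot g D| <= e / 3 * `|h|.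
  rewrite -dotZr -dotBr.
  have -> : b' - b - h *: D = h *: (h^-1 *: (b' - b) - D).
    by rewrite scalerBr scalerA divff// scale1r.
  apply: (le_trans (normr_dot_le _ _)); rewrite enormZ mulrCA mulrC ler_wpM2r//.
  apply: (@le_trans _ _ ((enorm g + 1) * (e / 3 / (enorm g + 1)))).
    by rewrite ler_pM ?enorm_ge0 ?(ltW h3)// lerDl.
  by rewrite mulrC divfK// gt_eqF.
have H2 : e / 3 / (lv + 1) * enorm (b' - b) <= e / 3 * `|h|.
  apply: (@le_trans _ _ (e / 3 / (lv + 1) * ((lv + 1) * `|h|))).
    apply: ler_wpM2l; first exact: divr_ge0 (ltW e3) (ltW lv1).
    by apply: (le_trans bl); rewrite ler_wpM2r// lerDl.
  by rewrite mulrA divfK// gt_eqF.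
have H0 : C * (h ^+ 2 * enorm v ^+ 2) <= e / 3 * `|h|.
  rewrite -(real_normK (num_real h)).
  have := ler_wpM2r (ltW hp) h1.
  by rewrite (_ : C * (`|h| ^+ 2 * _) = C * enorm v ^+ 2 * `|h| * `|h|)//; ring.
move=> H1.
rewrite -(ler_pM2r hp) -normrM mulrBl.
rewrite (_ : h^-1 *: _ * h = perf_loss pb (h *: v + th) - perf_loss pb th); last first.
  by rewrite /shift/= -[_ *: _]/(h^-1 * _) mulrAC mulVf// mul1r.
have -> : dot (grad_perf pb th) v * h = h * (dot (expect_grad_loss pb th b) v + dot g D).
  by rewrite mulrC; congr (_ * _); exact: E.
move: H0 H1 H2 H3.
move: (perf_loss pb (h *: v + th)) (perf_loss pb th) (dot g D) (dot g (b' - b)).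
move: (dot _ v) (C * (h ^+ 2 * enorm v ^+ 2)) (_ / (lv + 1) * _).
move=> x1 x2 x3 x4 x5 x6 x7.
rewrite !ler_norml; lra.
Unshelve. all: by end_near. Qed.

Lemma is_derive_perf_loss x v t : Theta_delta pb delta (x + t *: v) ->
  is_derive (t : R) 1 (fun t : R => perf_loss pb (x + t *: v))
    (dot (grad_perf pb (x + t *: v)) v).
Proof.
move=> /(perf_loss_derive v)[dp <-]; exact: is_derive_line.
Qed.

(** After subtracting the quadratic model, the loss is nonincreasing along the segment, which stays
    in the convex set [Theta_delta] where the derivative is known. *)
Lemma perf_loss_descent x y : Theta_delta pb delta x -> Theta_delta pb delta y ->
  perf_loss pb y <= perf_loss pb x + dot (grad_perf pb x) (y - x)
    + L_perf_sm c / 2 * enorm (y - x) ^+ 2.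
Proof.
move=> Tx Ty; set v := y - x.
have Tt (t : R) : 0 <= t <= 1 -> Theta_delta pb delta (x + t *: v).
  by move=> t01; exact: (Theta_delta_segment HA).
pose a := dot (grad_perf pb x) v; pose q := L_perf_sm c * enorm v ^+ 2.
have := @le_of_derive R ((fun t : R => perf_loss pb (x + t *: v)) - (fun t => a * t ^+ 1)
  - (fun t => q / 2 * t ^+ 2))
  (fun t => dot (grad_perf pb (x + t *: v)) v - a * (1%:R * t ^+ 0) - q / 2 * (2%:R * t ^+ 1))
  0 1 ler01.
rewrite -![(_ - _ - _) _]/(_ - _ - _) scale1r scale0r addr0 [x + v]addrC subrK.
move=> h; suff : perf_loss pb y - a * 1 ^+ 1 - q / 2 * 1 ^+ 2 <=
    perf_loss pb x - a * 0 ^+ 1 - q / 2 * 0 ^+ 2.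
  rewrite !expr1n !expr0n/= !mulr1 !mulr0 !subr0 /a /q mulrAC => h'.
  by rewrite !lerBlDr addrAC in h'.
apply: h => t t01.
  apply: is_deriveB; last exact: is_derive_monomial.
  apply: is_deriveB; last exact: is_derive_monomial.
  exact/is_derive_perf_loss/Tt.
have H : dot (grad_perf pb (x + t *: v)) v - a <= q * t.
  rewrite /a -dotBl (le_trans (dot_le_enorm _ _))//.
  rewrite /q expr2 mulrA [leRHS]mulrAC ler_wpM2r ?enorm_ge0//.
  apply: (le_trans (grad_perf_lip HA HV n0 delta0 (Tt _ t01) Tx)).
  have /andP[t0 _] := t01.
  by rewrite addrAC subrr add0r enormZ ger0_norm// -mulrA [enorm v * t]mulrC.
by move: H; rewrite expr0 expr1; lra.
Qed.

Lemma Theta_delta_bounded : exists2 D : R, 0 <= D &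
  forall x y, Theta_delta pb delta x -> Theta_delta pb delta y -> enorm (x - y) <= D.
Proof.
have [T0 _ _ cT] := A_Theta_delta HA.
have [x _ xP] := @compact_EVT_max _ _ (@enorm R n) _ T0 cT
  (continuous_subspaceT (@continuous_enorm R n)).
exists (enorm x + enorm x); first by rewrite addr_ge0 ?enorm_ge0.
move=> u v Tu Tv; apply: (le_trans (enormB _ _)).
by apply: lerD; apply: xP; rewrite inE.
Qed.

(** For the measurability of the loss along a run. The descent inequality is used in both orders, on
    a set of bounded diameter. *)
Lemma perf_loss_lipschitz : exists2 K, 0 <= K &
  forall x y, Theta_delta pb delta x -> Theta_delta pb delta y ->
    `|perf_loss pb x - perf_loss pb y| <= K * enorm (x - y).
Proof.
have [[x0 T0] _ _ _] := A_Theta_delta HA.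
have [D D0 HD] := Theta_delta_bounded.
have L0 := L_perf_sm_ge0 HV.
pose K := enorm (grad_perf pb x0) + L_perf_sm c * D + L_perf_sm c / 2 * D.
have K0 : 0 <= K by rewrite !addr_ge0 ?mulr_ge0 ?enorm_ge0 ?divr_ge0.
exists K => //.
have HK x y : Theta_delta pb delta x -> Theta_delta pb delta y ->
    perf_loss pb y - perf_loss pb x <= K * enorm (y - x).
  move=> Tx Ty; have := perf_loss_descent Tx Ty.
  have h1 : dot (grad_perf pb x) (y - x) <=
     (enorm (grad_perf pb x0) + L_perf_sm c * D) * enorm (y - x).
    apply: (le_trans (dot_le_enorm _ _)); rewrite ler_wpM2r ?enorm_ge0//.
    rewrite -[X in enorm X <= _](subrK (grad_perf pb x0)) addrC.
    apply: (le_trans (enormD _ _)); rewrite lerD2l.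
    apply: (le_trans (grad_perf_lip HA HV n0 delta0 Tx T0)).
    by rewrite ler_wpM2l// HD.
  have h2 : L_perf_sm c / 2 * enorm (y - x) ^+ 2 <= L_perf_sm c / 2 * D * enorm (y - x).
    rewrite expr2 mulrA ler_wpM2r ?enorm_ge0// ler_wpM2l ?divr_ge0// HD//.
  move=> h; rewrite lerBlDl /K mulrDl; apply: (le_trans h).
  by rewrite -addrA lerD2l; exact: lerD.
move=> x y Tx Ty; rewrite ler_norml; apply/andP; split; last exact: HK.
by rewrite lerNl opprB enorm_distC; exact: HK.
Qed.

End Descent.

(** * Laws of i.i.d. batches *)

Section TupleLaw.
Context {R : realType} {dT} {T : measurableType dT}.
Local Open Scope ereal_scope.

Definition rect n (S : 'I_n -> set T) : set (n.-tuple T) :=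
  [set x | forall j, S j (tnth x j)].

Lemma measurable_rect n (S : 'I_n -> set T) :
  (forall j, measurable (S j)) -> measurable (rect S).
Proof.
move=> mS; have -> : rect S = \bigcap_(j in [set: 'I_n]) ((@tnth _ T ^~ j) @^-1` S j).
  by apply/seteqP; split=> [x Sx j _|x Sx j]; [exact: Sx|exact: Sx].
apply: fin_bigcap_measurable => // j _.
by rewrite -[X in measurable X]setTI; exact: measurable_tnth.
Qed.

Let mfun_of d1 d2 (T1 : measurableType d1) (T2 : measurableType d2) (f : T1 -> T2)
  (mf : measurable_fun setT f) : {mfun T1 >-> T2} := mfun_Sub (mem_set mf).

Let cons_pair n (p : T * n.-tuple T) : n.+1.-tuple T := [the n.+1.-tuple T of p.1 :: p.2].

Let measurable_cons_pair n : measurable_fun setT (@cons_pair n).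
Proof. by apply: measurable_cons. Qed.

(** The hypothesis on the estimator quantifies over i.i.d. laws of tuples, so one has to be built to
    make use of it: the image of [P \x Q] under consing. *)
Lemma iid_exists (P : probability T R) n :
  exists Q : probability (n.-tuple T) R, iid_law P Q.
Proof.
elim: n => [|n [Q HQ]].
  exists (dirac [tuple]) => S mS.
  by rewrite big_ord0 /= diracE mem_set// => -[].
exists (distribution (P \x Q) (mfun_of (@measurable_cons_pair n))) => S mS.
rewrite /distribution /pushforward/=.
have -> : (@cons_pair n) @^-1` [set x | forall j, S j (tnth x j)] =
    S ord0 `*` rect (fun j => S (lift ord0 j)).
  apply/seteqP; split => [[x y] /= Sxy|[x y] /= [Sx Sy] j].
    split; first exact: (Sxy ord0).
    by move=> j; have := Sxy (lift ord0 j); rewrite tnthS.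
  have [->//|j0] := eqVneq j ord0.
  case: (unliftP ord0 j) => [i ->|jE]; last by rewrite jE eqxx in j0.
  by rewrite tnthS; exact: Sy.
rewrite product_measure1E//; last exact: measurable_rect.
rewrite [X in _ * X](HQ _ (fun j => mS (lift ord0 j))) big_ord_recl EFinM fineK//.
exact: fin_num_measure.
Qed.

Context {dX} {X : measurableType dX}.

Definition cylinders n : set (set (X * n.-tuple T)) :=
  [set U | exists A (S : 'I_n -> set T), [/\ measurable A,
     forall j, measurable (S j) & U = A `*` rect S]].

Lemma cylinders_setI n : setI_closed (@cylinders n).
Proof.
move=> _ _ [A [S [mA mS ->]]] [A' [S' [mA' mS' ->]]].
exists (A `&` A'), (fun j => S j `&` S' j); split.
- exact: measurableI.
- by move=> j; exact: measurableI.
apply/seteqP; split => [[x y]/= [[Ax Sy] [Ax' Sy']]|[x y]/= [[Ax Ax'] SSy]].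
  by split => // j; split.
by split; split => // j; have [] := SSy j.
Qed.

(** For the hard inclusion, the identity is measurable from the sigma-algebra generated by the
    cylinders, because each of its coordinates is. *)
Lemma measurable_cylinders n :
  @measurable _ (X * n.-tuple T)%type = <<s @cylinders n >>.
Proof.
apply/seteqP; split; last first.
  apply: smallest_sub; first exact: sigma_algebra_measurable.
  by move=> _ [A [S [mA mS ->]]]; apply: measurableX => //; exact: measurable_rect.
move=> U mU.
pose Y := g_sigma_algebraType (@cylinders n).
have mid : measurable_fun [set: Y] (fun x : Y => (x.1, x.2) : X * n.-tuple T).
  apply: measurable_fun_pair.
    move=> _ A mA; rewrite setTI; apply: sub_sigma_algebra.
    exists A, (fun=> setT); split => //.
    by apply/seteqP; split => [x Ax|x []]//=; split.
  apply/measurable_fun_tnthP => j _ A mA; rewrite setTI; apply: sub_sigma_algebra.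
  exists setT, (fun i => if i == j then A else setT); split => //.
    by move=> i; case: ifPn.
  apply/seteqP; split => [x Ax|x [_ /(_ j)]]//=; last by rewrite eqxx.
  by split => // i; case: ifPn => // /eqP ->.
have := mid measurableT U mU; rewrite setTI.
by rewrite (_ : _ @^-1` U = U)//; apply/seteqP; split => -[].
Qed.

(** Turns a bound that holds under each conditional law, with the first argument frozen, into a
    bound on the joint expectation, although the conditional laws are only specified on
    rectangles. *)
Lemma ge0_integral_disintegration_le dO (Omega : measurableType dO)
    (P : probability Omega R) n (x : Omega -> X) (z : Omega -> n.-tuple T)
    (Q : Omega -> probability (n.-tuple T) R) :
  measurable_fun setT x -> measurable_fun setT z ->
  (forall S, (forall j, measurable (S j)) ->
    measurable_fun setT (fun w => Q w (rect S))) ->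
  (forall A S, measurable A -> (forall j, measurable (S j)) ->
    P (x @^-1` A `&` z @^-1` rect S) = \int[P]_(w in x @^-1` A) Q w (rect S)) ->
  forall F : X * n.-tuple T -> \bar R, measurable_fun setT F ->
  (forall u, 0 <= F u) -> forall C : R,
  (forall w, \int[Q w]_y F (x w, y) <= C%:E) -> \int[P]_w F (x w, z w) <= C%:E.
Proof.
move=> mx mz mQ PQ F mF F0 C FC.
have mpair w : measurable_fun setT (fun y : n.-tuple T => (x w, y)).
  by apply: measurable_fun_pair.
(* [k w] is the law of the pair with its first entry frozen at [x w]; the joint law [nu] will be the
   mixture of the [k w] under [P]. *)
pose k w := distribution (Q w) (mfun_of (mpair w)).
have mxz : measurable_fun setT (fun w => (x w, z w)) by apply: measurable_fun_pair.
pose nu := distribution P (mfun_of mxz).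
have kE w A S : k w (A `*` rect S) = (\1_A (x w))%:E * Q w (rect S).
  rewrite /k /distribution /pushforward/= indicE.
  have [xA|xA] := boolP (x w \in A).
    rewrite mul1e; congr (Q w _); apply/seteqP; split => [y []//|y Sy] /=.
    by split => //; exact: set_mem.
  rewrite mul0e (_ : _ @^-1` _ = set0) ?measure0//.
  by apply/seteqP; split => // y [/mem_set]; rewrite (negbTE xA).
have k01 w U : measurable U -> k w U <= 1 by move=> mU; exact: probability_le1.
have kmix U : measurable U ->
    measurable_fun setT (fun w => k w U) /\ nu U = \int[P]_w k w U.
  move=> mU; have sU : <<s @cylinders n >> U by rewrite -measurable_cylinders.
  apply: (@dynkin_induction _ _ _ (fun U => measurable_fun setT (fun w => k w U) /\
      nu U = \int[P]_w k w U) (@measurable_cylinders n) (@cylinders_setI n) _ _ _ _ U sU).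
  - split.
      have -> : (fun w => k w setT) = cst 1 by apply/funext => w; exact: probability_setT.
      exact: measurable_cst.
    have -> : (fun w => k w setT) = cst 1 by apply/funext => w; exact: probability_setT.
    transitivity (1 : \bar R); first exact: probability_setT.
    by rewrite integral_cst// mul1e; exact/esym/probability_setT.
  - move=> _ [A [S [mA mS ->]]].
    have mxA : measurable (x @^-1` A) by rewrite -[X in measurable X]setTI; exact: mx.
    under eq_fun do rewrite kE.
    split.
      apply: emeasurable_funM; last exact: mQ.
      by apply/measurable_EFinP; apply: measurableT_comp => //; exact: measurable_indic.
    transitivity (P (x @^-1` A `&` z @^-1` rect S)); first by [].
    rewrite PQ// integral_mkcond; apply: eq_integral => w _.
    rewrite patchE indicE.
    have -> : (w \in x @^-1` A) = (x w \in A).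
      by apply/idP/idP; rewrite !inE.
    by case: ifPn; rewrite ?mul1e ?mul0e.
  - move=> S mS [mkS nuS].
    have kC w : k w (~` S) = 1 - k w S by exact: probability_setC.
    have mkC : measurable_fun setT (fun w => k w (~` S)).
      under eq_fun do rewrite kC.
      by apply: emeasurable_funB.
    split => //.
    have h : nu (~` S) + nu S = \int[P]_w k w (~` S) + nu S.
      rewrite [in RHS]nuS -ge0_integralD//.
      transitivity (\int[P]_w (cst 1 w : \bar R)).
        rewrite integral_cst// mul1e [RHS]probability_setT.
        rewrite [X in X + _](probability_setC _ mS) subeK//.
        exact: fin_num_measure.
      apply: eq_integral => w _; rewrite kC subeK//.
      exact: fin_num_measure.
    have fS : nu S \is a fin_num by exact: fin_num_measure.
    by have := congr1 (fun u => u - nu S) h; rewrite !addeK.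
  - move=> G mG tG HG.
    have kU w : k w (\bigcup_i G i) = \sum_(i <oo) k w (G i).
      by apply: measure_semi_bigcup => //; exact: bigcup_measurable.
    split.
      under eq_fun do rewrite kU.
      by apply: ge0_emeasurable_sum => // i _; have [] := HG i.
    under eq_integral do rewrite kU.
    rewrite integral_nneseries//; last by move=> i; have [] := HG i.
    transitivity (\sum_(i <oo) nu (G i)).
      by apply: measure_semi_bigcup => //; exact: bigcup_measurable.
    by apply: eq_eseriesr => i _; have [] := HG i.
have := ge0_integral_mixture (k := k) (fun U mU => (kmix U mU).1)
  (fun U mU => (kmix U mU).2) mF F0.
rewrite ge0_integral_distribution// => ->.
apply: (@le_trans _ _ (\int[P]_w C%:E)).
  apply: ge0_le_integral => //.
  - by move=> w _; apply: integral_ge0.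
  - apply: measurable_fun_integral_kernel => // U mU; exact: (kmix U mU).1.
  - by move=> w _; rewrite ge0_integral_distribution.
by rewrite integral_cst// [X in _ * X]probability_setT mule1.
Qed.

End TupleLaw.

(** * One step and a whole run *)

Section GradientError.
Context {R : realType} {n m d : nat} (pb : problem R n m d).
Context (delta sigma : R) (bmin : nat) (c : constants R).
Hypotheses (HA : assumptionA pb delta sigma bmin) (HV : valid_constants pb c).
Hypotheses (n0 : (0 < n)%N) (delta0 : 0 < delta).

Let beta_B th : Theta pb th -> B pb (beta pb th).
Proof. by have [_ _] := A_B HA; exact. Qed.

Lemma query_Theta th k : Theta_delta pb delta th -> Theta pb (query delta th k).
Proof. by move=> [Tt Td]; case: k => [[i []]|]//=; have [] := Td i. Qed.

(** A column error is two estimation errors divided by 2 [delta] plus the central-difference bias;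
    the factor 3 turns the squared bias coefficient 1/36 into 1/12. *)
Lemma jac_hat_error th (bh : batch n -> 'rV[R]_m) i : Theta_delta pb delta th ->
  enorm (ev R i *m (jac_hat delta bh - jac (beta pb) th)^T) ^+ 2 <=
    L_beta_H c ^+ 2 * delta ^+ 4 / 12 + 3 / (4 * delta ^+ 2) *
    (enorm (bh (Some (i, true)) - beta pb (query delta th (Some (i, true)))) ^+ 2 +
     enorm (bh (Some (i, false)) - beta pb (query delta th (Some (i, false)))) ^+ 2).
Proof.
move=> Tt; have [[_ _ _ _ LH0] _] := c_ge0 HV.
set p := bh (Some (i, true)); set q := bh (Some (i, false)).
set bp := beta pb (query delta th (Some (i, true))).
set bq := beta pb (query delta th (Some (i, false))).
have -> : ev R i *m (jac_hat delta bh - jac (beta pb) th)^T =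
   (2 * delta)^-1 *: (p - bp) + (- (2 * delta)^-1) *: (q - bq) +
   ((2 * delta)^-1 *: (bp - bq) - 'D_(ev R i) (beta pb) th).
  rewrite linearB/= mulmxBr -(derive_jac (ev R i) (beta_differentiable HA th)).
  have -> : ev R i *m (jac_hat delta bh)^T = (2 * delta)^-1 *: (p - q).
    by apply/rowP => k; rewrite -rowE !mxE mulrC.
  rewrite addrA; congr (_ - _); apply/rowP => k; rewrite !mxE; ring.
apply: (le_trans (sqr_enormD3 _ _ _)).
have h := beta_central HA HV delta0 i Tt.
have : enorm ((2 * delta)^-1 *: (bp - bq) - 'D_(ev R i) (beta pb) th) ^+ 2 <=
    (L_beta_H c * delta ^+ 2 / 6) ^+ 2.
  apply: lerXn2r h; rewrite nnegrE ?enorm_ge0//.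
  by rewrite divr_ge0// mulr_ge0// sqr_ge0.
rewrite (enormZ _ (p - bp)) (enormZ _ (q - bq)) normrN !exprMn real_normK ?num_real//.
rewrite [(2 * delta)^-1 ^+ 2]exprVn [(2 * delta) ^+ 2]exprMn.
have d2 : 0 < delta ^+ 2 by rewrite exprn_gt0.
have -> : 3 / (4 * delta ^+ 2) = 3 * (2 ^+ 2 * delta ^+ 2)^-1.
  by congr (_ * _^-1); ring.
move: ((2 ^+ 2 * delta ^+ 2)^-1) (enorm (p - bp) ^+ 2) (enorm (q - bq) ^+ 2) => a x y.
move: (enorm _ ^+ 2) => z hz.
apply: (@le_trans _ _ (3 * (a * x + a * y + (L_beta_H c * delta ^+ 2 * 6^-1) ^+ 2))).
  by rewrite ler_pM2l// lerD2l !exprMn.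
by rewrite le_eqVlt; apply/orP; left; apply/eqP; field.
Qed.

Lemma grad_hat_error th (bh : batch n -> 'rV[R]_m) : Theta_delta pb delta th ->
  (forall k, B pb (bh k)) ->
  enorm (grad_hat pb delta th bh - grad_perf pb th) ^+ 2 <=
    3 * (L_loss_Lip c ^+ 2 * I_max c + (L_beta_Lip c * L_G_beta c) ^+ 2)
      * enorm (bh None - beta pb th) ^+ 2 +
    3 * M_loss c * I_max c * \sum_i (L_beta_H c ^+ 2 * delta ^+ 4 / 12 +
      3 / (4 * delta ^+ 2) *
      (enorm (bh (Some (i, true)) - beta pb (query delta th (Some (i, true)))) ^+ 2 +
       enorm (bh (Some (i, false)) - beta pb (query delta th (Some (i, false)))) ^+ 2)).
Proof.
move=> Tt Bh; have Th := Theta_deltaW Tt; have Bt := beta_B Th.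
have [[L1 L2 L3 L4 L5] [L6 L7 L8 L9]] := c_ge0 HV.
set x := enorm (bh None - beta pb th).
pose e1 := expect_grad_loss pb th (bh None) - expect_grad_loss pb th (beta pb th).
pose e2 := (G pb th (bh None) - G pb th (beta pb th)) *m jac (beta pb) th.
(* The Jacobian error is paired with [G] at the estimated parameter, so that [e2] contains only the
   true Jacobian, bounded through [L_beta_Lip]. [e3] falls to [dot_G_le] at that estimated
   parameter, column by column. *)
pose e3 := G pb th (bh None) *m (jac_hat delta bh - jac (beta pb) th).
have -> : grad_hat pb delta th bh - grad_perf pb th = e1 + e2 + e3.
  rewrite /e1 /e2 /e3 /grad_hat /grad_perf /grad1 /grad2 mulmxBr mulmxBl.
  set a := expect_grad_loss _ _ _; set b := expect_grad_loss _ _ _.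
  set u := _ *m jac_hat _ _; set v := _ *m jac _ _; set w := _ *m jac _ _.
  by move: a b u v w => a b u v w; apply/rowP => i; rewrite !mxE; ring.
apply: (le_trans (sqr_enormD3 _ _ _)).
have h1 : enorm e1 ^+ 2 <= L_loss_Lip c ^+ 2 * I_max c * x ^+ 2.
  rewrite -(sqr_sqrtr L9) -!exprMn -mulrA lerXn2r ?nnegrE ?enorm_ge0//.
    by rewrite !mulr_ge0 ?sqrtr_ge0 ?enorm_ge0.
  exact: (expect_grad_loss_lip HA HV).
have h2 : enorm e2 ^+ 2 <= (L_beta_Lip c * L_G_beta c) ^+ 2 * x ^+ 2.
  rewrite -exprMn lerXn2r ?nnegrE ?enorm_ge0 ?mulr_ge0 ?enorm_ge0//.
  apply: enorm_le_dual => [|v]; first by rewrite !mulr_ge0 ?enorm_ge0.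
  rewrite dot_mulmx -(derive_jac v (beta_differentiable HA th)).
  apply: (le_trans (dot_le_enorm _ _)).
  have := Dbeta_le HA HV n0 delta0 v Tt.
  have := c_G HV Th Th (Bh None) Bt; rewrite subrr enorm0 mulr0 addr0 -/x => a1 a2.
  have := ler_pM (enorm_ge0 _) (enorm_ge0 _) a1 a2.
  by rewrite (_ : L_G_beta c * x * (L_beta_Lip c * enorm v) =
    L_beta_Lip c * L_G_beta c * x * enorm v)//; ring.
have h3 : enorm e3 ^+ 2 <= M_loss c * I_max c * \sum_i
    enorm (ev R i *m (jac_hat delta bh - jac (beta pb) th)^T) ^+ 2.
  rewrite mulr_sumr sqr_sqrtr; last by apply: sumr_ge0 => i _; rewrite sqr_ge0.
  apply: ler_sum => i _; rewrite -dot_ev dot_mulmx.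
  have MI0 : 0 <= M_loss c * I_max c by rewrite mulr_ge0.
  rewrite -(sqr_sqrtr MI0) -exprMn -(real_normK (num_real (dot _ _))).
  rewrite lerXn2r ?nnegrE ?mulr_ge0 ?sqrtr_ge0 ?enorm_ge0//.
  apply: (dot_G_le HA HV Th (Bh None)).
  rewrite linearB/= mulmxBr -(derive_jac (ev R i) (beta_differentiable HA th)).
  (* Inserting [bh None] displays the column as a combination of directions of [B] seen from the
     point where the mean score is taken. *)
  have -> : ev R i *m (jac_hat delta bh)^T =
      (2 * delta)^-1 *: ((bh (Some (i, true)) - bh None) - (bh (Some (i, false)) - bh None)).
    by apply/rowP => k; rewrite -rowE !mxE; field; rewrite gt_eqF.
  have s0 := mean_score_Dbeta HA HV n0 delta0 (ev R i) (Bh None) Tt.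
  rewrite dotBr s0 subr0 dotZr dotBr.
  by rewrite !(mean_score_dir HA HV)// subrr mulr0.
have h4 : \sum_i enorm (ev R i *m (jac_hat delta bh - jac (beta pb) th)^T) ^+ 2 <=
  \sum_i (L_beta_H c ^+ 2 * delta ^+ 4 / 12 +
      3 / (4 * delta ^+ 2) *
      (enorm (bh (Some (i, true)) - beta pb (query delta th (Some (i, true)))) ^+ 2 +
       enorm (bh (Some (i, false)) - beta pb (query delta th (Some (i, false)))) ^+ 2)).
  by apply: ler_sum => i _; exact: jac_hat_error.
have h5 := ler_wpM2l (mulr_ge0 L8 L9) h4.
apply: le_trans (ler_wpM2l _ (lerD (lerD h1 h2) (le_trans h3 h5))) _ => //.
by rewrite le_eqVlt; apply/orP; left; apply/eqP; ring.
Qed.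

(** For L = 0 the stepsize is unrestricted and the left-hand side is 0. *)
Let half_smooth_le (s L a : R) : 0 <= s -> 0 <= L -> 0 < a ->
  (0 < L -> a <= 1 / L) -> L / 2 * s <= s / (2 * a).
Proof.
move=> s0 + a0 aL; rewrite le_eqVlt => /orP[/eqP <-|L0].
  by rewrite !mul0r divr_ge0// mulr_ge0// ltW.
have := aL L0; rewrite ler_pdivlMr// => aL1.
rewrite ler_pdivlMr ?mulr_gt0//.
have := ler_wpM2l s0 aL1; lra.
Qed.

Lemma descent_step th (bh : batch n -> 'rV[R]_m) alpha : Theta_delta pb delta th ->
  0 < alpha -> (0 < L_perf_sm c -> alpha <= 1 / L_perf_sm c) ->
  enorm (grad_map pb delta alpha th) ^+ 2 + 2 / alpha *
    (perf_loss pb (eproj (Theta_delta pb delta) (th - alpha *: grad_hat pb delta th bh))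
      - perf_loss pb th) <=
  enorm (grad_hat pb delta th bh - grad_perf pb th) ^+ 2.
Proof.
move=> Tt a0 aL; have [T0 clT cvT cT] := A_Theta_delta HA.
set xp := eproj _ _.
have Txp : Theta_delta pb delta xp by exact: eproj_mem.
pose e := grad_hat pb delta th bh - grad_perf pb th.
have E : grad_hat pb delta th bh = grad_perf pb th + e.
  by rewrite /e; move: (grad_hat _ _ _ _) (grad_perf _ _) => u v; rewrite addrC subrK.
have xpE : xp = eproj (Theta_delta pb delta) (th - alpha *: (grad_perf pb th + e)) :=
  congr1 (fun u => eproj (Theta_delta pb delta) (th - alpha *: u)) E.
have := inexact_prox_step T0 cT cvT Tt a0 erefl xpE; rewrite -/e; apply: le_trans.
apply: lerD; first exact: lexx.
apply: (ler_wpM2l (divr_ge0 (ler0n _ 2) (ltW a0))).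
rewrite lerBlDl addrA; apply: (le_trans (perf_loss_descent HA HV n0 delta0 Tt Txp)).
apply: lerD; first exact: lexx.
exact: (half_smooth_le (sqr_ge0 _) (L_perf_sm_ge0 HV) a0 aL).
Qed.

End GradientError.

(** * Expectations along a run of the algorithm *)

Section Run.
Context {R : realType} {n m d : nat} (pb : problem R n m d).
Context (delta : R) (c : constants R).
Hypotheses (HA : assumptionA pb delta (sigma_max c) (b_min c)).
Hypotheses (HV : valid_constants pb c).
Hypotheses (n0 : (0 < n)%N) (delta0 : 0 < delta).
Context {dO : measure_display} {Omega : measurableType dO} (P : probability Omega R).
Context (theta0 : 'rV[R]_n) (b : nat) (alpha : R).
Context (theta : nat -> Omega -> borel R n)
  (zs : nat -> batch n -> 'I_b -> Omega -> borel R d).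
Hypotheses (Hrun : dsa_run pb P theta0 delta alpha theta zs).
Hypotheses (b0 : (0 < b)%N) (bmin : (b_min c <= b)%N) (T0 : Theta_delta pb delta theta0).
Hypotheses (alpha0 : 0 < alpha) (alphaL : 0 < L_perf_sm c -> alpha <= 1 / L_perf_sm c).

Let beta_B th : Theta pb th -> B pb (beta pb th).
Proof. by have [_ _] := A_B HA; exact. Qed.

Lemma theta_mem t w : Theta_delta pb delta (theta t w).
Proof.
case: t => [|t]; first by rewrite (run_init Hrun).
rewrite (run_step Hrun); have [? _ _ ?] := A_Theta_delta HA; exact: eproj_mem.
Qed.

Definition beta_hat t w : batch n -> 'rV[R]_m :=
  batch_estimates pb (fun k j => zs t k j w).

Lemma beta_hat_B t w k : B pb (beta_hat t w k).
Proof.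
apply: (A_Pred_B HA) => // j; rewrite tnth_mktuple; exact: (run_zs_Z Hrun).
Qed.

Lemma measurable_comp_theta t (f : borel R n -> R) K : 0 <= K ->
  (forall x y, Theta_delta pb delta x -> Theta_delta pb delta y ->
     `|f x - f y| <= K * enorm (x - y)) ->
  measurable_fun setT (fun w => f (theta t w)).
Proof.
move=> K0 fK; have [_ clT _ _] := A_Theta_delta HA.
apply: (measurable_comp (F := Theta_delta pb delta : set (borel R n))).
- exact: closed_borel_measurable.
- by move=> _ [w _ <-]; exact: theta_mem.
- exact: (lipschitz_on_measurable clT K0 fK).
- exact: (run_theta_measurable Hrun).
Qed.

Let query_diff k (x y : 'rV[R]_n) : query delta x k - query delta y k = x - y.
Proof. by case: k => [[i []]|]//=; apply/rowP => j; rewrite !mxE; ring. Qed.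

Let measurable_dist_query t k (S : set (borel R d)) : measurable S ->
  measurable_fun setT
    (fun w => fine (dist pb (beta pb (query delta (theta t w) k)) S)).
Proof.
move=> mS; have [[_ _ L3 _ _] _] := c_ge0 HV.
apply: (@measurable_comp_theta t
  (fun th => fine (dist pb (beta pb (query delta th k)) S))
  (Num.sqrt (I_max c) * L_beta_Lip c)) => [|x y Tx Ty].
  by rewrite mulr_ge0 ?sqrtr_ge0.
have Tx' := query_Theta k Tx; have Ty' := query_Theta k Ty.
apply: (le_trans (dist_lip HA HV mS (beta_B Ty') (beta_B Tx'))).
rewrite -mulrA ler_wpM2l ?sqrtr_ge0// -(query_diff k).
exact: (c_beta_Lip HV).
Qed.

Let measurable_coord k (i : 'I_k) : measurable_fun setT (fun x : borel R k => x 0 i).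
Proof.
apply: continuous_borel_measurable => x.
exact/differentiable_continuous/differentiable_coord.
Qed.

Let sqr_error k (u : borel R n * b.-tuple (borel R d)) : R :=
  enorm (Pred pb u.2 - beta pb (query delta u.1 k)) ^+ 2.

Let measurable_sqr_error k : measurable_fun setT (sqr_error k).
Proof.
apply: measurable_funX; apply: measurable_enorm_rV => i.
under eq_fun do rewrite mxE [X in _ + X]mxE.
apply: measurable_funB.
  apply: (@measurableT_comp _ _ _ _ _ _ (fun y : borel R m => y 0 i)).
    exact: measurable_coord.
  apply: (@measurableT_comp _ _ _ _ _ _ (fun y => Pred pb y : borel R m)) => //.
  exact: (A_Pred_measurable HA).
apply: (@measurableT_comp _ _ _ _ _ _
  (fun y : borel R n => beta pb (query delta y k) 0 i)) => //.
apply: continuous_borel_measurable => x.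
pose v : 'rV[R]_n := query delta 0 k.
have -> : (fun y => beta pb (query delta y k) 0 i) = (fun y => beta pb (y + v) 0 i).
  apply/funext => y; congr (beta pb _ _ _).
  by apply/eqP; rewrite -subr_eq query_diff subr0.
have dv : differentiable (fun y : 'rV[R]_n => y + v) x by [].
have db := differentiable_comp dv (beta_differentiable HA (x + v)).
have dc := @differentiable_coord R 1 m (beta pb (x + v)) 0 i.
exact: (differentiable_continuous (differentiable_comp db dc)).
Qed.

Let samples t k w : b.-tuple (borel R d) := [tuple zs t k j w | j < b].

Let measurable_samples t k : measurable_fun setT (samples t k).
Proof.
apply/measurable_fun_tnthP => j.
rewrite (_ : _ \o _ = zs t k j); first exact: (run_zs_measurable Hrun).
by apply/funext => w; rewrite /= tnth_mktuple.
Qed.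

Definition pred_err t k w : R :=
  enorm (beta_hat t w k - beta pb (query delta (theta t w) k)) ^+ 2.

Lemma measurable_pred_err t k : measurable_fun setT (pred_err t k).
Proof.
have mp := measurable_fun_pair (run_theta_measurable Hrun t) (measurable_samples t k).
exact: (measurableT_comp (measurable_sqr_error k) mp).
Qed.

(** Given the iterate, batch [k] is an i.i.d. sample at a fixed parameter of [Theta], so the error
    bound of the estimator applies for each [w]; disintegration then integrates it. *)
Lemma expectation_pred_err_le t k :
  (\int[P]_w (pred_err t k w)%:E <= (sigma_max c ^+ 2 / b%:R)%:E)%E.
Proof.
pose D w := dist pb (beta pb (query delta (theta t w) k)).
(* Chosen separately for each [w]: measurability in [w] is only required of the probabilities of
   rectangles, which are explicit products. *)
pose Q w := sval (cid (iid_exists (D w) b)).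
have QD w : iid_law (D w) (Q w) by exact: svalP (cid (iid_exists (D w) b)).
have QE w S : (forall j, measurable (S j)) ->
  Q w (rect S) = (\prod_(j < b) fine (D w (S j)))%:E by move=> mS; exact: QD.
apply: (@ge0_integral_disintegration_le _ _ _ _ _ _ _ P b (theta t) (samples t k) Q _ _ _ _
  (fun u => (sqr_error k u)%:E)); first last.
- move=> w; apply: (A_Pred_error HA _ b0 bmin (QD w)).
  exact/query_Theta/theta_mem.
- by move=> u; rewrite lee_fin sqr_ge0.
- exact/measurable_EFinP.
- move=> A S mA mS; under eq_integral do rewrite QE//.
  (* Freshness concerns all batches at once; the others are left unconstrained and contribute a
     factor 1. *)
  pose S' k' j := if k' == k then S j else setT.
  have pA : past theta zs t (theta t @^-1` A).
    by apply: sub_sigma_algebra; left; exists t => //; exists A.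
  have mS' k' j : measurable (S' k' j) by rewrite /S'; case: ifP.
  have := run_fresh Hrun pA mS'.
  have -> : [set w | forall k' j, S' k' j (zs t k' j w)] = samples t k @^-1` rect S.
    apply/seteqP; split => [w Sw j|w Sw k' j].
      by rewrite /= tnth_mktuple; have := Sw k j; rewrite /S' eqxx.
    by rewrite /S'; case: eqP => [->|//]; have := Sw j; rewrite /= tnth_mktuple.
  move=> ->; apply: eq_integral => w _; congr EFin.
  rewrite (bigD1 k)//= [X in _ * X]big1 ?mulr1 => [|k' k'k].
    by apply: eq_bigr => j _; rewrite /S' eqxx.
  by apply: big1 => j _; rewrite /S' (negbTE k'k) probability_setT.
- move=> S mS; under eq_fun do rewrite QE//.
  apply/measurable_EFinP; apply: measurable_prod => j _.
  exact: measurable_dist_query.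
- exact: measurable_samples.
- exact: (run_theta_measurable Hrun).
Qed.

Let A0 := 3 * (L_loss_Lip c ^+ 2 * I_max c + (L_beta_Lip c * L_G_beta c) ^+ 2).
Let A1 := 3 * M_loss c * I_max c.
Let B0 := L_beta_H c ^+ 2 * delta ^+ 4 / 12.
Let B1 := 3 / (4 * delta ^+ 2).

Let A0_ge0 : 0 <= A0.
Proof.
have [_ [_ _ _ I0]] := c_ge0 HV.
by rewrite mulr_ge0// addr_ge0 ?sqr_ge0// mulr_ge0 ?sqr_ge0.
Qed.

Let A1_ge0 : 0 <= A1.
Proof. by have [_ [_ _ M0 I0]] := c_ge0 HV; rewrite !mulr_ge0. Qed.

Let B0_ge0 : 0 <= B0.
Proof. by rewrite divr_ge0// mulr_ge0 ?sqr_ge0// exprn_ge0// ltW. Qed.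

Let B1_ge0 : 0 <= B1.
Proof. by rewrite divr_ge0// mulr_ge0// sqr_ge0. Qed.

Let err t w : R := A0 * pred_err t None w + A1 * \sum_i (B0 + B1 *
  (pred_err t (Some (i, true)) w + pred_err t (Some (i, false)) w)).

(** For delta^6 = 1 / b this is C1 / b + n C2 delta^4. *)
Definition grad_err_bound : R := A0 * (sigma_max c ^+ 2 / b%:R) +
  A1 * (n%:R * (B0 + B1 * (2 * (sigma_max c ^+ 2 / b%:R)))).

Let pred_err_ge0 t k w : 0 <= pred_err t k w.
Proof. exact: sqr_ge0. Qed.

Let pair_err t i w : R := pred_err t (Some (i, true)) w + pred_err t (Some (i, false)) w.

Let measurable_pair_err t i : measurable_fun setT (pair_err t i).
Proof. by apply: measurable_funD; exact: measurable_pred_err. Qed.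

Let err_ge0 t w : 0 <= err t w.
Proof.
apply: addr_ge0; apply: mulr_ge0 => //; apply: sumr_ge0 => i _.
by apply: addr_ge0 => //; apply: mulr_ge0 => //; apply: addr_ge0.
Qed.

Let measurable_dir_err t i :
  measurable_fun setT (fun w => B0 + B1 * pair_err t i w).
Proof. by apply: measurable_funD => //; apply: measurable_funM. Qed.

Let measurable_err t : measurable_fun setT (err t).
Proof.
apply: measurable_funD; apply: measurable_funM => //.
  exact: measurable_pred_err.
by apply: measurable_sum => i; exact: measurable_dir_err.
Qed.

Let expectation_dir_err_le t i :
  (\int[P]_w (B0 + B1 * pair_err t i w)%:E <=
   (B0 + B1 * (2 * (sigma_max c ^+ 2 / b%:R)))%:E)%E.
Proof.
under eq_integral do rewrite EFinD.
rewrite ge0_integralD//; last 2 first.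
- by move=> w _; rewrite lee_fin mulr_ge0// addr_ge0.
- by apply/measurable_EFinP; apply: measurable_funM.
rewrite integral_cst// [X in (_ * X + _)%E]probability_setT mule1 [leRHS]EFinD.
apply: leeD => //; under eq_integral do rewrite EFinM.
rewrite ge0_integralZl_EFin//; last 2 first.
- by move=> w _; rewrite lee_fin addr_ge0.
- exact/measurable_EFinP.
rewrite [leRHS]EFinM lee_wpmul2l//.
under eq_integral do rewrite EFinD.
rewrite ge0_integralD//; last 4 first.
- by move=> w _; rewrite lee_fin.
- by apply/measurable_EFinP; exact: measurable_pred_err.
- by move=> w _; rewrite lee_fin.
- by apply/measurable_EFinP; exact: measurable_pred_err.
by rewrite mulr_natl mulr2n [leRHS]EFinD; apply: leeD; exact: expectation_pred_err_le.
Qed.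

Let expectation_err_le t : (\int[P]_w (err t w)%:E <= grad_err_bound%:E)%E.
Proof.
under eq_integral do rewrite EFinD.
have dir0 i w : (0 <= (B0 + B1 * pair_err t i w)%:E)%E.
  by rewrite lee_fin addr_ge0// mulr_ge0// addr_ge0.
have mdir i : measurable_fun setT (fun w => (B0 + B1 * pair_err t i w)%:E).
  by apply/measurable_EFinP; exact: measurable_dir_err.
rewrite ge0_integralD//; last 4 first.
- by move=> w _; rewrite lee_fin mulr_ge0.
- by apply/measurable_EFinP; apply: measurable_funM => //; exact: measurable_pred_err.
- by move=> w _; rewrite lee_fin mulr_ge0// sumr_ge0// => i _; exact: dir0.
- apply/measurable_EFinP; apply: measurable_funM => //.
  by apply: measurable_sum => i; exact: measurable_dir_err.
rewrite [leRHS]EFinD; apply: leeD.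
  under eq_integral do rewrite EFinM.
  rewrite ge0_integralZl_EFin//; last 2 first.
  - by move=> w _; rewrite lee_fin.
  - by apply/measurable_EFinP; exact: measurable_pred_err.
  by rewrite [leRHS]EFinM lee_wpmul2l//; exact: expectation_pred_err_le.
under eq_integral do rewrite EFinM -sumEFin.
rewrite ge0_integralZl_EFin//; last 2 first.
- by move=> w _; apply: sume_ge0 => i _; exact: dir0.
- by apply: emeasurable_sum => i; exact: mdir.
rewrite [leRHS]EFinM lee_wpmul2l// ge0_integral_sum//; last by move=> i w _; exact: dir0.
apply: (@le_trans _ _ (\sum_(i < n) (B0 + B1 * (2 * (sigma_max c ^+ 2 / b%:R)))%:E)%E).
  by apply: lee_sum => i _; exact: expectation_dir_err_le.
by rewrite sumEFin sumr_const card_ord lee_fin [leRHS]mulr_natl.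
Qed.

Let sqr_grad_map t w : R := enorm (grad_map pb delta alpha (theta t w)) ^+ 2.

Let sqr_grad_map_ge0 t w : 0 <= sqr_grad_map t w.
Proof. exact: sqr_ge0. Qed.

Let gap t w : R := 2 / alpha * (perf_loss pb (theta t w) - perf_loss_inf pb).

Let step_le t w : sqr_grad_map t w + gap t.+1 w <= gap t w + err t w.
Proof.
have h1 := descent_step HA HV n0 delta0 (beta_hat t w) (theta_mem t w) alpha0 alphaL.
have h2 := grad_hat_error HA HV n0 delta0 (theta_mem t w) (beta_hat_B t w).
have := le_trans h1 h2.
have -> : eproj (Theta_delta pb delta)
    (theta t w - alpha *: grad_hat pb delta (theta t w) (beta_hat t w)) = theta t.+1 w.
  by rewrite (run_step Hrun).
rewrite -[X in _ <= X]/(err t w) /gap => h.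
rewrite -/(sqr_grad_map t w) in h.
rewrite -lerBlDl; apply: le_trans h; rewrite -addrA lerD2l -mulrBr.
by rewrite le_eqVlt; apply/orP; left; apply/eqP; congr (_ * _); ring.
Qed.

Let measurable_gap t : measurable_fun setT (gap t).
Proof.
have [K K0 HK] := perf_loss_lipschitz HA HV n0 delta0.
apply: measurable_funM => //; apply: measurable_funB => //.
exact: (measurable_comp_theta t K0 HK).
Qed.

Let gap_ge0 t w : 0 <= gap t w.
Proof.
rewrite mulr_ge0 ?divr_ge0 ?(ltW alpha0)// subr_ge0.
apply: ge_inf; first exact: c_inf HV.
by exists (theta t w) => //; exact: Theta_deltaW (theta_mem t w).
Qed.

Let grad_map_lip x y : Theta_delta pb delta x -> Theta_delta pb delta y ->
  enorm (grad_map pb delta alpha x - grad_map pb delta alpha y) <=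
    alpha^-1 * (2 + alpha * L_perf_sm c) * enorm (x - y).
Proof.
move=> Tx Ty; have [D0 clT cvT cT] := A_Theta_delta HA.
rewrite /grad_map -scalerBr enormZ ger0_norm ?invr_ge0 ?(ltW alpha0)//.
have ai : 0 <= alpha^-1 by rewrite invr_ge0 ltW.
rewrite -mulrA; apply: (ler_wpM2l ai).
have h1 := eproj_nonexp D0 cT cvT (x - alpha *: grad_perf pb x) (y - alpha *: grad_perf pb y).
have h2 := grad_perf_lip HA HV n0 delta0 Tx Ty.
move: h1 h2; move: (grad_perf pb x) (grad_perf pb y) => u v.
move: (eproj _ (x - alpha *: u)) (eproj _ (y - alpha *: v)) => p q h1 h2.
have h3 : enorm (x - alpha *: u - (y - alpha *: v)) <=
    enorm (x - y) + alpha * enorm (u - v).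
  have -> : x - alpha *: u - (y - alpha *: v) = (x - y) - alpha *: (u - v).
    by apply/rowP => i; rewrite !mxE; ring.
  by apply: (le_trans (enormB _ _)); rewrite enormZ gtr0_norm.
have h4 : enorm (x - p - (y - q)) <= enorm (x - y) + enorm (p - q).
  have -> : x - p - (y - q) = (x - y) - (p - q) by apply/rowP => i; rewrite !mxE; ring.
  exact: enormB.
have h5 := ler_wpM2l (ltW alpha0) h2.
rewrite (_ : (2 + _) * _ = enorm (x - y) + (enorm (x - y) +
  alpha * (L_perf_sm c * enorm (x - y)))); last by ring.
apply: (le_trans h4); apply: lerD => //.
by apply: (le_trans h1); apply: (le_trans h3); apply: lerD.
Qed.

Let measurable_sqr_grad_map t : measurable_fun setT (sqr_grad_map t).
Proof.
apply: measurable_funX.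
apply: (@measurable_comp_theta t (fun x => enorm (grad_map pb delta alpha x))
  (alpha^-1 * (2 + alpha * L_perf_sm c))).
  by rewrite mulr_ge0 ?invr_ge0 ?addr_ge0 ?mulr_ge0 ?(ltW alpha0)// (L_perf_sm_ge0 HV).
move=> x y Tx Ty; apply: (le_trans (enorm_lip _ _)); exact: grad_map_lip.
Qed.

Lemma sum_sqr_grad_map_le N :
  (\sum_(0 <= t < N)
     'E_P[fun w => (enorm (grad_map pb delta alpha (theta t w)) ^+ 2)%R] <=
   (2 / alpha * (perf_loss pb theta0 - perf_loss_inf pb) + N%:R * grad_err_bound)%:E)%E.
Proof.
(* Keeping the final gap on the left makes the induction telescope without subtracting extended
   reals; being nonnegative, it is dropped afterwards. *)
suff h : (\sum_(0 <= t < N) \int[P]_w (sqr_grad_map t w)%:E + \int[P]_w (gap N w)%:E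
    <= (2 / alpha * (perf_loss pb theta0 - perf_loss_inf pb) + N%:R * grad_err_bound)%:E)%E.
  apply: le_trans h; rewrite expectation.unlock leeDl//.
  by apply: integral_ge0 => w _; rewrite lee_fin.
elim: N => [|N IH].
  rewrite big_nil add0e mul0r addr0.
  rewrite (eq_integral (cst (2 / alpha * (perf_loss pb theta0 - perf_loss_inf pb))%:E)).
    by rewrite integral_cst// [X in (_ * X)%E]probability_setT mule1.
  by move=> w _; rewrite /gap (run_init Hrun).
rewrite big_nat_recr//= -addeA.
have : (\int[P]_w (sqr_grad_map N w)%:E + \int[P]_w (gap N.+1 w)%:E <=
    \int[P]_w (gap N w)%:E + \int[P]_w (err N w)%:E)%E.
  rewrite -!ge0_integralD//; try exact/measurable_EFinP;
    try by move=> w _; rewrite lee_fin.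
  apply: ge0_le_integral => //.
  - by move=> w _; rewrite adde_ge0// lee_fin.
  - by apply: emeasurable_funD; exact/measurable_EFinP.
  - by apply: emeasurable_funD; exact/measurable_EFinP.
  - by move=> w _; rewrite -!EFinD lee_fin step_le.
move=> h; apply: (le_trans (leeD (lexx _) h)); rewrite addeA.
apply: (le_trans (leeD IH (expectation_err_le N))).
rewrite -EFinD lee_fin -[N.+1%:R]natr1; move: grad_err_bound (2 / alpha * _) => u v.
by rewrite mulrDl mul1r addrA.
Qed.

End Run.

(** * Rates *)

Section Rates.
Context {R : realType}.

(** By minimality k - 1 is below [x], unless k = 1, where 0 <= x is enough. *)
Lemma least_pos_le (x : R) k : 0 <= x -> least_pos (fun k => x <= k%:R) k ->
  k%:R <= x + 1.
Proof.
move=> x0 [k0 xk kmin]; case: k k0 xk kmin => // -[|k] _ xk kmin.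
  by rewrite lerDr.
rewrite -natr1 lerD2r leNgt; apply/negP => xk1.
by have := kmin k.+1 isT (ltW xk1); rewrite ltnn.
Qed.

Lemma powR_sixth_root (b : nat) : (0 < b)%N ->
  (b%:R `^ (- (1 / 6)) : R) ^+ 6 = b%:R^-1.
Proof.
move=> b0; rewrite -powR_mulrn ?powR_ge0// -powRrM.
by rewrite (_ : - (1 / 6) * 6%:R = -1) ?powR_inv1//; field.
Qed.

Lemma powR_sqr_cube (y : R) : 0 <= y -> (y `^ (3 / 2)) ^+ 2 = y ^+ 3.
Proof.
move=> y0; rewrite -powR_mulrn ?powR_ge0// -powRrM -powR_mulrn//.
by congr (_ `^ _); field.
Qed.

(** Cubing turns delta^12 into b^-2, and squaring the condition on [b] gives y^3 <= (b e^3)^2. This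
    is the origin of the exponents 3/2 and 3 in the batch size. *)
Lemma three_halves_rate (y e delta : R) (b : nat) : (0 < b)%N -> 0 <= y -> 0 < e ->
  0 < delta -> delta ^+ 6 = b%:R^-1 -> y `^ (3 / 2) / e ^+ 3 <= b%:R ->
  y * delta ^+ 4 <= e ^+ 2.
Proof.
move=> b0 y0 e0 d0 d6; rewrite ler_pdivrMr ?exprn_gt0// => yb.
have b1 : 0 < b%:R :> R by rewrite ltr0n.
suff : (y * delta ^+ 4) ^+ 3 <= (e ^+ 2) ^+ 3.
  by rewrite ler_pXn2r ?nnegrE ?mulr_ge0 ?exprn_ge0 ?(ltW e0) ?(ltW d0).
have -> : (y * delta ^+ 4) ^+ 3 = y ^+ 3 * b%:R^-1 ^+ 2.
  by rewrite -d6; ring.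
rewrite exprVn ler_pdivrMr ?exprn_gt0//.
rewrite (_ : (e ^+ 2) ^+ 3 * b%:R ^+ 2 = (b%:R * e ^+ 3) ^+ 2); last by ring.
rewrite -powR_sqr_cube//; apply: lerXn2r => //; rewrite nnegrE ?powR_ge0//.
by rewrite mulr_ge0 ?exprn_ge0 ?(ltW e0) ?(ltW b1).
Qed.

Lemma card_sample_index n b T : #|sample_index n b T| = (T * (2 * n + 1) * b)%N.
Proof.
rewrite !card_prod !card_ord card_option card_prod card_ord card_bool addn1.
by rewrite mulnC [(n * 2)%N]mulnC mulnC.
Qed.

(** The factor 3 is from 2 n + 1 <= 3 n; the first bracket bounds T e^2, the second b e^3 / n^(3/2),
    with positive powers of e replaced by powers of its upper bound [em]. *)
Definition sample_rate (em a g : R) (bm : nat) (c1 c2 : R) : R :=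
  3 * (6 * g / a + em ^+ 2) *
  ((bm%:R + 1) * em ^+ 3 + 3 * c1 * em + (3 * c2) `^ (3 / 2)).

Lemma sample_count_le (n T b bm : nat) (e em a g c1 c2 : R) :
  (0 < n)%N -> 0 < e -> e <= em -> 0 < a -> 0 <= g -> 0 <= c1 -> 0 <= c2 ->
  least_pos (fun k => 6 * g / (a * e ^+ 2) <= k%:R) T ->
  least_pos (fun k => Num.max bm%:R (Num.max (3 * c1 / e ^+ 2)
                        ((3 * n%:R * c2) `^ (3 / 2) / e ^+ 3)) <= k%:R) b ->
  (T * (2 * n + 1) * b)%N%:R <=
    sample_rate em a g bm c1 c2 * n%:R `^ (5 / 2) * e ^- 5.
Proof.
move=> n0 e0 eem a0 g0 c10 c20 HT Hb.
have em0 : 0 < em by exact: lt_le_trans eem.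
have n1 : 1 <= n%:R :> R by rewrite ler1n.
have nn : 0 <= n%:R :> R by [].
have e2 : 0 < e ^+ 2 by rewrite exprn_gt0.
have e3 : 0 < e ^+ 3 by rewrite exprn_gt0.
have hT : T%:R * e ^+ 2 <= 6 * g / a + em ^+ 2.
  have := least_pos_le _ HT.
  have q0 : 0 <= 6 * g / (a * e ^+ 2) by rewrite divr_ge0// mulr_ge0 // ltW.
  move=> /(_ q0) h.
  have := ler_wpM2r (ltW e2) h; rewrite mulrDl mul1r => /le_trans; apply.
  apply: lerD; last by rewrite ler_pXn2r ?nnegrE ?(ltW e0) ?(ltW em0).
  by rewrite le_eqVlt; apply/orP; left; apply/eqP; field; rewrite !gt_eqF.
set y := (3 * n%:R * c2) `^ (3 / 2) in Hb.
have y0 : 0 <= y by exact: powR_ge0.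
set n32 := n%:R `^ (3 / 2) : R.
(* This allows n^(3/2) to be factored out of the terms of the batch size that do not grow with n. *)
have n32_1 : 1 <= n32.
  by apply: (le_trans n1); apply: le1r_powR => //; lra.
have yE : y = n32 * (3 * c2) `^ (3 / 2).
  by rewrite /y /n32 -powRM ?mulr_ge0//; congr (_ `^ _); ring.
have c20' : 0 <= (3 * c2) `^ (3 / 2) by exact: powR_ge0.
have hb : b%:R * e ^+ 3 <= n32 * ((bm%:R + 1) * em ^+ 3 + 3 * c1 * em + (3 * c2) `^ (3 / 2)).
  have q1 : 0 <= 3 * c1 / e ^+ 2 by rewrite divr_ge0 ?mulr_ge0// ltW.
  have q2 : 0 <= y / e ^+ 3 by rewrite divr_ge0// ltW.
  have := least_pos_le _ Hb; rewrite le_max ler0n => /(_ isT) h.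
  have {h} h : b%:R <= bm%:R + 3 * c1 / e ^+ 2 + y / e ^+ 3 + 1.
    apply: (le_trans h); rewrite lerD2r !ge_max; apply/and3P; split.
    - by rewrite -addrA lerDl addr_ge0.
    - by rewrite [bm%:R + _]addrC -addrA lerDl addr_ge0.
    - by rewrite lerDr addr_ge0.
  apply: (le_trans (ler_wpM2r (ltW e3) h)).
  have -> : (bm%:R + 3 * c1 / e ^+ 2 + y / e ^+ 3 + 1) * e ^+ 3 =
      (bm%:R + 1) * e ^+ 3 + 3 * c1 * e + y by field; rewrite gt_eqF.
  rewrite yE mulrDr; apply: lerD => //.
  set s := (bm%:R + 1) * em ^+ 3 + 3 * c1 * em.
  have s0 : 0 <= s.
    by rewrite addr_ge0// mulr_ge0 ?addr_ge0 ?mulr_ge0 ?exprn_ge0 ?(ltW em0).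
  apply: (@le_trans _ _ s); last by rewrite -[leLHS]mul1r ler_wpM2r.
  apply: lerD; first by rewrite ler_wpM2l ?addr_ge0// ler_pXn2r ?nnegrE ?(ltW e0) ?(ltW em0).
  by rewrite ler_wpM2l ?mulr_ge0.
have hn : (2 * n + 1)%N%:R <= 3 * n%:R :> R.
  by rewrite natrD natrM; lra.
have n52 : n%:R `^ (5 / 2) = n%:R * n32 :> R.
  rewrite /n32 -{2}(powRr1 nn) -powRD; last by apply/implyP => _; rewrite pnatr_eq0 -lt0n.
  by congr (_ `^ _); field.
rewrite ler_pdivlMr ?exprn_gt0// !natrM n52 /sample_rate.
set u := 6 * g / a + em ^+ 2 in hT *; set v := _ + (3 * c2) `^ _ in hb *.
have -> : T%:R * (2 * n + 1)%N%:R * b%:R * e ^+ 5 =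
  (T%:R * e ^+ 2) * (2 * n + 1)%N%:R * (b%:R * e ^+ 3) by ring.
have -> : 3 * u * v * (n%:R * n32) = u * (3 * n%:R) * (n32 * v) by ring.
have p1 : 0 <= T%:R * e ^+ 2 by rewrite mulr_ge0 ?(ltW e2).
have p2 : 0 <= b%:R * e ^+ 3 by rewrite mulr_ge0 ?(ltW e3).
by apply: ler_pM => //; [exact: mulr_ge0 | exact: ler_pM].
Qed.

End Rates.

Theorem theorem1 (R : realType) :
  (* K eps_max alpha gap b_min C1 C2, with gap := perf_loss theta0 - perf_loss_inf,
     is the constant hidden in the O *)
  exists K : R -> R -> R -> nat -> R -> R -> R,
  forall (n m d : nat) (pb : problem R n m d) (c : constants R)
    (theta0 : 'rV[R]_n) (alpha eps delta : R) (T b : nat),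
  (0 < n)%N -> (0 < m)%N -> (0 < d)%N ->
  0 < eps ->
  least_pos (fun k => 6 * (perf_loss pb theta0 - perf_loss_inf pb)
                        / (alpha * eps ^+ 2) <= k%:R) T ->
  least_pos (fun k => Num.max (b_min c)%:R
                        (Num.max (3 * C1 c / eps ^+ 2)
                           ((3 * n%:R * C2 c) `^ (3 / 2) / eps ^+ 3)) <= k%:R) b ->
  delta = b%:R `^ (- (1 / 6)) ->
  assumptionA pb delta (sigma_max c) (b_min c) ->
  valid_constants pb c ->
  Theta_delta pb delta theta0 ->
  0 < alpha ->
  (* if L_perf_sm = 0 then 1 / L_perf_sm is read as +oo *)
  (0 < L_perf_sm c -> alpha <= 1 / L_perf_sm c) ->
  (forall (dO : measure_display) (Omega : measurableType dO)
     (P : probability Omega R) (theta : nat -> Omega -> borel R n)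
     (zs : nat -> batch n -> 'I_b -> Omega -> borel R d),
     dsa_run pb P theta0 delta alpha theta zs ->
     ((T%:R^-1)%:E *
        \sum_(0 <= t < T)
          'E_P[fun w => (enorm (grad_map pb delta alpha (theta t w)) ^+ 2)%R]
      <= (eps ^+ 2)%:E)%E) /\
  #|sample_index n b T| = (T * (2 * n + 1) * b)%N /\
  (forall eps_max : R, eps <= eps_max ->
     #|sample_index n b T|%:R <=
       K eps_max alpha (perf_loss pb theta0 - perf_loss_inf pb)
         (b_min c) (C1 c) (C2 c)
       * n%:R `^ (5 / 2) * eps ^- 5).
Proof.
exists (@sample_rate R) => n m d pb c theta0 alpha eps delta T b n0 m0 d0 eps0 HT Hb deltaE.
move=> HA HV T0 alpha0 alphaL.
have [_ [_ _ M0 I0]] := c_ge0 HV.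
have C10 : 0 <= C1 c.
  by rewrite /C1 mulr_ge0 ?sqr_ge0// mulr_ge0// addr_ge0 ?sqr_ge0// mulr_ge0 ?sqr_ge0.
have C20 : 0 <= C2 c.
  by rewrite /C2 !mulr_ge0// addr_ge0// ?divr_ge0// ?sqr_ge0// mulr_ge0 ?sqr_ge0.
have gap0 : 0 <= perf_loss pb theta0 - perf_loss_inf pb.
  rewrite subr_ge0; apply: ge_inf; first exact: c_inf HV.
  by exists theta0 => //; exact: Theta_deltaW T0.
split; last first.
  split; first exact: card_sample_index.
  by move=> eps_max epsm; rewrite card_sample_index; exact: sample_count_le.
move=> dO Omega P theta zs Hrun.
have [b0 bE _] := Hb; have [Tpos TE _] := HT.
have bR : 0 < b%:R :> R by rewrite ltr0n.
have TR : 0 < T%:R :> R by rewrite ltr0n.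
have e2 : 0 < eps ^+ 2 by rewrite exprn_gt0.
have delta0 : 0 < delta by rewrite deltaE powR_gt0.
have delta6 : delta ^+ 6 = b%:R^-1 by rewrite deltaE powR_sixth_root.
move: bE; rewrite !ge_max ler_nat => /and3P[bmin b1 b2].
(* Replacing 1 / b by delta^6 turns the noise 3 / (4 delta^2) * 2 sigma^2 / b into 3 sigma^2 delta^4
   / 2, the same power of [delta] as the squared bias. *)
have E : @grad_err_bound R n delta c b = C1 c / b%:R + n%:R * C2 c * delta ^+ 4.
  rewrite /grad_err_bound /C1 /C2 -delta6; field.
  by rewrite gt_eqF.
have h1 : C1 c / b%:R <= eps ^+ 2 / 3.
  move: b1; rewrite !ler_pdivrMr// => h; lra.
have h2 : n%:R * C2 c * delta ^+ 4 <= eps ^+ 2 / 3.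
  have y0 : 0 <= 3 * n%:R * C2 c by rewrite mulr_ge0// mulr_ge0.
  have := three_halves_rate b0 y0 eps0 delta0 delta6 b2; lra.
have h3 : T%:R^-1 * (2 / alpha * (perf_loss pb theta0 - perf_loss_inf pb)) <= eps ^+ 2 / 3.
  rewrite ler_pdivrMl//; move: TE; rewrite ler_pdivrMr ?mulr_gt0// => h.
  rewrite mulrAC ler_pdivrMr//; lra.
have H := sum_sqr_grad_map_le HA HV n0 delta0 Hrun b0 bmin T0 alpha0 alphaL T.
have T1 : (0 <= (T%:R^-1)%:E :> \bar R)%E by rewrite lee_fin invr_ge0.
apply: (le_trans (lee_wpmul2l T1 H)).
rewrite -EFinM lee_fin mulrDr [_ * (T%:R * _)]mulrA mulVf ?gt_eqF// mul1r E.
by apply: (le_trans (lerD h3 (lerD h1 h2))); lra.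
Qed.
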